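(* Let $R(\vartheta_0)=I_X(\vartheta_0)/I_{X,Y}(\vartheta_0)$ be the ratio of the limiting Fisher information rates under partial observation (of $X$ only) and full observation (of $(X,Y)$) in the model with parameters $(a,b,c,\vartheta_0)$, where the parameters satisfy $a+c<0$, $b\ne0$, $ac-b\vartheta_0>0$. Then $$R(\vartheta_0)\xrightarrow{|b|\to\infty}1,\qquad R(\vartheta_0)\xrightarrow{|\vartheta_0|\to\infty}0,\qquad R(\vartheta_0)\xrightarrow{c\to-\infty}0,\qquad R(\vartheta_0)\xrightarrow{a\to-\infty}\rho,$$ where $\rho\in(0,1)$. In each limit, all other parameters are fixed.
   Context: Model. For real $a,b,c,\vartheta$ with $a+c<0$, $b\neq0$, $ac-b\vartheta>0$, let $(X_t,Y_t)_{t\ge0}$ solve $$dX_t=(aX_t+\vartheta Y_t)dt+dW^X_t,\qquad dY_t=(bX_t+cY_t)dt+dW^Y_t,\qquad X_0=Y_0=0,$$ with independent standard Brownian motions $W^X,W^Y$; $\mathbb E_\vartheta$ denotes expectation under this model. The parameters $a,b,c$ are known, and $\vartheta_0$ denotes the true value of the unknown parameter $\vartheta$. Filter. $\gamma_t(\vartheta)$ is the solution of $\frac{d}{dt}\gamma_t(\vartheta)=2c\gamma_t(\vartheta)+1-\vartheta^2\gamma_t(\vartheta)^2$, $\gamma_0(\vartheta)=0$. The process $m_t(\vartheta)$ is the solution of $$dm_t(\vartheta)=(cm_t(\vartheta)+bX_t)dt+\vartheta\gamma_t(\vartheta)\bigl(dX_t-(\vartheta m_t(\vartheta)+aX_t)dt\bigr),\quad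 m_0(\vartheta)=0;$$ under the model with parameter $\vartheta$ it equals $\mathbb E_\vartheta[Y_t\mid\sigma(X_s:s\le t)]$. The process $\partial_\vartheta m_t(\vartheta)$, the mean square derivative of $m_t(\vartheta)$ in $\vartheta$, is the solution of $$d(\partial_\vartheta m_t(\vartheta))=\bigl((c-\vartheta^2\gamma_t(\vartheta))\partial_\vartheta m_t(\vartheta)-\vartheta\gamma_t(\vartheta)m_t(\vartheta)\bigr)dt+\bigl(\gamma_t(\vartheta)+\vartheta\partial_\vartheta\gamma_t(\vartheta)\bigr)\bigl(dX_t-(\vartheta m_t(\vartheta)+aX_t)dt\bigr),$$ $\partial_\vartheta m_0(\vartheta)=0$. Fisher informations. With partial information, $I_{X,T}(\vartheta_0)=\mathbb E_{\vartheta_0}\bigl[\int_0^T(m_t(\vartheta_0)+\vartheta_0\partial_\vartheta m_t(\vartheta_0))^2dt\bigr]$; with full information, $I_{X,Y,T}(\vartheta_0)=\mathbb E_{\vartheta_0}\bigl[\int_0^TY_t^2dt\bigr]$. The limiting rates are $I_X(\vartheta_0)=\lim_{T\to\infty}\frac1TI_{X,T}(\vartheta_0)$ and $I_{X,Y}(\vartheta_0)=\lim_{T\to\infty}\frac1TI_{X,Y,T}(\vartheta_0)$.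
   Formalization: The limit c→−∞ is stated only for a≠0 (for a=0 the ratio tends to b²/(b²−bϑ₀)>0, not 0), and the limit a→−∞ only for c≠0 and ϑ₀≠0 (otherwise the ratio tends to 0, so ρ is not in (0,1)). *)

(* Defs.v *)
From HB Require Import structures.
From mathcomp Require Import all_boot all_order all_algebra.
From mathcomp Require Import all_classical all_reals all_analysis.

Set Implicit Arguments.
Unset Strict Implicit.
Unset Printing Implicit Defensive.

Import Order.TTheory GRing.Theory Num.Theory.
Import numFieldNormedType.Exports.

Local Open Scope classical_set_scope.
Local Open Scope ring_scope.

(* Processes are functions R -> Omega -> R; only times t >= 0 matter. *)

Section Processes.
Context (R : realType) (d : measure_display) (Omega : measurableType d).
Context (P : probability Omega R).
Implicit Types (W V X A : R -> Omega -> R) (H : R -> R) (J : Omega -> R).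

Definition continuous_paths X : Prop :=
  {ae P, forall w, {within `[0, +oo[, continuous (fun t => X t w)}}.

(* The joint measurability gives meaning to the expected time integrals below. *)
Definition continuous_process X : Prop :=
  measurable_fun ([set t : measurableTypeR R | 0 <= t] `*` [set: Omega])
    (fun z => X z.1 z.2) /\
  continuous_paths X.

Definition independent_increments W : Prop :=
  forall (n : nat) (t : nat -> R) (B : 'I_n -> set R),
    0 <= t 0%N -> (forall i, t i <= t i.+1) -> (forall i, measurable (B i)) ->
    P [set w | forall i : 'I_n, B i (W (t i.+1) w - W (t i) w)] =
    (\prod_(i < n) P [set w | B i (W (t i.+1) w - W (t i) w)%R])%E.

(* [normal_prob m s] takes the standard deviation s, not the variance. *)
Definition standard_brownian_motion W : Prop :=
  [/\ forall t, 0 <= t -> measurable_fun [set: Omega] (W t),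
      {ae P, forall w, W 0 w = 0},
      independent_increments W,
      forall s t (B : set R), 0 <= s -> s < t -> measurable B ->
        P [set w | B (W t w - W s w)] = normal_prob 0 (Num.sqrt (t - s)) B
    & continuous_paths W].

(* Independence of the generated sigma-algebras, on the pi-systems of
   finite-dimensional rectangles. *)
Definition independent_processes V W : Prop :=
  forall (n k : nat) (s : 'I_n -> R) (t : 'I_k -> R)
         (B : 'I_n -> set R) (C : 'I_k -> set R),
    (forall i, 0 <= s i) -> (forall j, 0 <= t j) ->
    (forall i, measurable (B i)) -> (forall j, measurable (C j)) ->
    P ([set w | forall i, B i (V (s i) w)] `&`
       [set w | forall j, C j (W (t j) w)]) =
    (P [set w | forall i, B i (V (s i) w)] *
     P [set w | forall j, C j (W (t j) w)])%E.

(* int_0^t f(s) ds *)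
Definition time_integral (f : R -> R) (t : R) : R :=
  \int[lebesgue_measure]_(s in `[0, t]) f s.

(* Partitions 0 = u_0 <= ... <= u_k = t, and their mesh. *)
Definition is_partition (t : R) (k : nat) (u : nat -> R) : Prop :=
  [/\ u 0%N = 0, u k = t & forall i, (i < k)%N -> u i <= u i.+1].

Definition mesh (k : nat) (u : nat -> R) : R :=
  \big[Num.max/0]_(i < k) (u i.+1 - u i).

Definition ito_sum H V (k : nat) (u : nat -> R) (w : Omega) : R :=
  \sum_(i < k) H (u i) * (V (u i.+1) w - V (u i) w).

Definition cvg_in_probability (S : nat -> Omega -> R) J : Prop :=
  forall e : R, 0 < e -> P [set w | e <= `|S n w - J w|] @[n --> \oo] --> 0%E.

(* J = int_0^t H dV in Ito's sense, for a continuous integrand H: limit in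
   probability of the left-point sums along partitions of vanishing mesh.  All
   integrands below are deterministic. *)
Definition is_ito_integral H V (t : R) J : Prop :=
  forall (k : nat -> nat) (u : nat -> nat -> R),
    (forall n, is_partition t (k n) (u n)) ->
    mesh (k n) (u n) @[n --> \oo] --> (0 : R) ->
    cvg_in_probability (fun n => ito_sum H V (k n) (u n)) J.

(* dZ_t = A_t dt + H_t dV_t, Z_0 = 0 *)
Definition solves_sde A H V (Z : R -> Omega -> R) : Prop :=
  forall t, 0 <= t ->
    is_ito_integral H V t
      (fun w => Z t w - time_integral (fun s => A s w) t).

(* dZ_t = A_t dt + dW_t, Z_0 = 0; no stochastic integral is needed *)
Definition solves_additive_sde A W (Z : R -> Omega -> R) : Prop :=
  {ae P, forall w, forall t, 0 <= t ->
    Z t w = time_integral (fun s => A s w) t + W t w}.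

End Processes.

Section Model.
Context (R : realType).

Definition riccati_solution (c th : R) (g : R -> R) : Prop :=
  [/\ g 0 = 0,
      {within `[0, +oo[, continuous g}
    & forall t : R, 0 < t ->
        is_derive t 1 g (2 * c * g t + 1 - th ^+ 2 * g t ^+ 2)].

Record params := Params {
  pa : R; pb : R; pc : R; pth : R;
  trace_lt0 : pa + pc < 0;
  pb_neq0 : pb != 0;
  det_gt0 : 0 < pa * pc - pb * pth }.

(* [gamma c th t] is gamma_t(th) for the drift parameter c. *)
Record model (gamma : R -> R -> R -> R) (p : params) := Model {
  disp : measure_display;
  Omega : measurableType disp;
  prob : probability Omega R;
  WX : R -> Omega -> R;
  WY : R -> Omega -> R;
  Xp : R -> Omega -> R;
  Yp : R -> Omega -> R;
  mp : R -> Omega -> R;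
  dmp : R -> Omega -> R; (* the theta-derivative of m *)
  (* X_t - int_0^t (theta m_s + a X_s) ds, the integrator in both equations of
     the filter *)
  innovation : R -> Omega -> R := fun t w =>
    Xp t w - time_integral (fun s => pth p * mp s w + pa p * Xp s w) t;
  gam : R -> R := gamma (pc p) (pth p);
  dgam : R -> R := fun t => derive1 (fun th => gamma (pc p) th t) (pth p);
  WX_brownian : standard_brownian_motion prob WX;
  WY_brownian : standard_brownian_motion prob WY;
  WX_WY_independent : independent_processes prob WX WY;
  X_process : continuous_process prob Xp;
  Y_process : continuous_process prob Yp;
  m_process : continuous_process prob mp;
  dm_process : continuous_process prob dmp;
  X_sde : solves_additive_sde prob
    (fun t w => pa p * Xp t w + pth p * Yp t w) WX Xp;
  Y_sde : solves_additive_sde prob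
    (fun t w => pb p * Xp t w + pc p * Yp t w) WY Yp;
  m_sde : solves_sde prob
    (fun t w => pc p * mp t w + pb p * Xp t w)
    (fun t => pth p * gam t) innovation mp;
  dm_sde : solves_sde prob
    (fun t w => (pc p - pth p ^+ 2 * gam t) * dmp t w - pth p * gam t * mp t w)
    (fun t => gam t + pth p * dgam t) innovation dmp }.

Arguments Xp {gamma p} M t w : rename.
Arguments Yp {gamma p} M t w : rename.
Arguments mp {gamma p} M t w : rename.
Arguments dmp {gamma p} M t w : rename.

Section Fisher.
Context (gamma : R -> R -> R -> R) (p : params) (M : model gamma p).

Definition fisher_X (T : R) : \bar R :=
  ('E_(prob M)[fun w =>
     (time_integral (fun t => (mp M t w + pth p * dmp M t w) ^+ 2) T)%R])%E.

Definition fisher_XY (T : R) : \bar R :=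
  ('E_(prob M)[fun w => (time_integral (fun t => Yp M t w ^+ 2) T)%R])%E.

Definition fisher_rate_X : \bar R :=
  lim ((T^-1)%:E * fisher_X T @[T --> +oo%R])%E.

Definition fisher_rate_XY : \bar R :=
  lim ((T^-1)%:E * fisher_XY T @[T --> +oo%R])%E.

Definition fisher_ratio : R := fine fisher_rate_X / fine fisher_rate_XY.

(* [lim], [fine] and division are total; this says that they are used
   meaningfully in [fisher_ratio]. *)
Definition fisher_rates_exist : Prop :=
  [/\ cvg ((T^-1)%:E * fisher_X T @[T --> +oo%R])%E,
      cvg ((T^-1)%:E * fisher_XY T @[T --> +oo%R])%E,
      fisher_rate_X \is a fin_num,
      fisher_rate_XY \is a fin_num
    & (0 < fisher_rate_XY)%E].

End Fisher.

(* "h p -> +oo, with p subject to D"; admissibility is part of [params].  The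
   filter is improper when h is bounded above on D. *)
Definition params_to_infty (D : set params) (h : params -> R) :
    set_system params :=
  filter_from [set: R] (fun B => [set p | D p /\ B < h p]).

Global Instance params_to_infty_filter (D : set params) (h : params -> R) :
  Filter (params_to_infty D h).
Proof.
apply: filter_from_filter; first by exists 0.
move=> i j _ _; exists (Num.max i j) => // p /= [Dp].
by rewrite gt_max => /andP[hi hj].
Qed.

End Model.

(* Main.v *)
(** Ito integrals of smooth deterministic integrands can be integrated by parts
    pathwise, so (X, Y, e, q), with e = Y - m the filtering error and
    q = m + theta * dm, solves a linear system with additive noise, and its
    covariances solve a linear differential equation.  In it, e has variance
    gamma_t and is uncorrelated with X and q.  Since gamma_t converges and the
    covariances stay bounded, the time averages of E[Y^2] and E[q^2] converge,
    and pairing the covariances with the solution of the adjoint equation gives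
    the limits.  With k = sqrt (c^2 + theta^2), tau = - (a + c) and
    D = a c - b theta they are
      I_XY = (D + a^2 + b^2) / (2 tau D),
      I_X = b^2 / (2 tau D) + 2 b theta / (k (k^2 + tau k + D)) + theta^2 / (2 k^3).
    When a -> -oo, which forces c < 0, the ratio tends to theta^2 |c| / k^3. *)
Require Import Defs.
From HB Require Import structures.
From mathcomp Require Import all_boot all_order all_algebra.
From mathcomp Require Import all_classical all_reals all_analysis.
From mathcomp Require Import measurable_realfun ring lra.

Set Implicit Arguments.
Unset Strict Implicit.
Unset Printing Implicit Defensive.

Import Order.TTheory GRing.Theory Num.Theory.
Import numFieldNormedType.Exports.

Local Open Scope classical_set_scope.
Local Open Scope ring_scope.

(** * Integrals over [0, t] and linear differential inequalities *)

(** The model provides stochastic integrals only as limits in probability of sums, and no moment of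
    any of its processes. No stochastic calculus is developed: after integration by parts the
    equations hold path by path, pathwise Gronwall bounds supply the second moments, and the absence
    of anticipation enters only through covariances of the noise. The processes are controlled only
    for t >= 0 and outside a null set; clamping time at 0 and zeroing on the null set give versions
    to which Fubini applies on every path. The Fisher integrand is q^2, and q is also the coordinate
    in which the two filter equations close up. Convergence of the covariances is never established.
    A bounded combination F of them with F' = C - 2 k Var q + o(1) is enough: the average of F'
    vanishes, so that of Var q tends to C / (2 k). Boundedness comes from quadratic Lyapunov
    functions. Finally, theta enters gamma only through k, so its theta-derivative is the chain rule
    applied to an explicit formula in k. *)

Section TimeIntegral.
Context (R : realType).
Implicit Types (f g F : R -> R) (t T : R).
Local Notation mu := (@lebesgue_measure R).

(** Clamping the argument into [A] turns continuity on [A], which is all that the model gives for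
    [A] = [0, +oo[, into continuity on the whole line. *)
Lemma continuous_retract (A : set R) F (r : R -> R) :
  {within A, continuous F} -> continuous r -> (forall t, A (r t)) ->
  continuous (F \o r).
Proof.
move=> /subspace_continuousP FA cr Ar x.
apply: (@cvg_comp _ _ _ r F _ (within A (nbhs (r x)))); last exact: FA.
move=> U AU; have := cr x _ AU.
by apply: (@filterS _ (nbhs x)) => t /=; apply; exact: Ar.
Qed.

Lemma continuous_maxr0 : continuous (fun t : R => Num.max t 0).
Proof. by move=> x; apply: continuous_max; [exact: cvg_id|exact: cvg_cst]. Qed.

Lemma continuous_clamp F : {within `[0, +oo[, continuous F} ->
  continuous (fun t => F (Num.max t 0)).
Proof.
move=> cF; apply: (continuous_retract cF continuous_maxr0) => t /=.
by rewrite in_itv/= andbT le_max lexx orbT.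
Qed.

Definition locally_bounded f :=
  forall T : R, exists2 C : R, 0 <= C & forall s : R, 0 <= s <= T -> `|f s| <= C.

Definition integrable_from0 f :=
  forall t, mu.-integrable `[0, t] (EFin \o f).

Lemma continuous_locally_bounded f : continuous f -> locally_bounded f.
Proof.
move=> cf T; have [T0|T0] := leP 0 T; last first.
  by exists 0 => // s /andP[s0 sT]; move: (le_trans s0 sT); rewrite leNgt T0.
have [||c _ fc] := @EVT_max R (fun x => `|f x|) 0 T => //.
  apply: continuous_subspaceT => x.
  by apply: (@continuous_comp _ _ _ f Num.norm); [exact: cf|exact: norm_continuous].
by exists `|f c| => // s sT; apply: fc; rewrite in_itv.
Qed.

Lemma bounded_integrable_from0 f : measurable_fun setT f ->
  locally_bounded f -> integrable_from0 f.
Proof.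
move=> mf bf t; have [C C0 fC] := bf t.
apply: measurable_bounded_integrable => //.
- have /= -> := lebesgue_measure_itv `[0, t].
  by case: ifP => // _; rewrite -EFinD ltry.
- exact: measurable_funTS.
exists C; split; first by rewrite num_real.
by move=> M CM x /=; rewrite in_itv/= => /fC/le_trans; apply; exact: ltW.
Qed.

Lemma continuous_measurable f : continuous f -> measurable_fun setT f.
Proof. exact: continuous_measurable_fun. Qed.

Lemma cont_integrable_from0 f :
  continuous f -> integrable_from0 f.
Proof.
move=> cf; apply: bounded_integrable_from0.
  exact: continuous_measurable_fun.
exact: continuous_locally_bounded.
Qed.

Lemma time_integral_le0 f t : t <= 0 -> time_integral f t = 0.
Proof.
rewrite /time_integral le_eqVlt => /predU1P[->|t0].
  by rewrite set_itv1 Rintegral_set1.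
by rewrite set_itv_ge ?Rintegral_set0// bnd_simp -ltNge.
Qed.

Lemma time_integral0 f : time_integral f 0 = 0.
Proof. exact: time_integral_le0. Qed.

Lemma eq_time_integral f g t : (forall s, 0 <= s <= t -> f s = g s) ->
  time_integral f t = time_integral g t.
Proof. by move=> fg; apply: eq_Rintegral => s; rewrite inE/= in_itv => /fg. Qed.

Lemma time_integralD f g t : integrable_from0 f ->
  integrable_from0 g ->
  time_integral (fun s => f s + g s) t = time_integral f t + time_integral g t.
Proof. by move=> lf lg; exact: RintegralD. Qed.

Lemma time_integralB f g t : integrable_from0 f ->
  integrable_from0 g ->
  time_integral (fun s => f s - g s) t = time_integral f t - time_integral g t.
Proof. by move=> lf lg; exact: RintegralB. Qed.

Lemma time_integralZ f c t : integrable_from0 f ->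
  time_integral (fun s => c * f s) t = c * time_integral f t.
Proof. by move=> lf; exact: RintegralZl. Qed.

Lemma time_integral_cst c t : 0 <= t -> time_integral (fun=> c) t = c * t.
Proof.
move=> t0; rewrite /time_integral Rintegral_cst//= lebesgue_measure_itv/=.
rewrite lte_fin; case: ltP => [_|t0']; first by rewrite oppr0 adde0.
have -> : t = 0 by apply/eqP; rewrite eq_le t0 t0'.
by rewrite /= !mulr0.
Qed.

Lemma integrable_from0D f g : integrable_from0 f ->
  integrable_from0 g -> integrable_from0 (fun s => f s + g s).
Proof.
by move=> lf lg t; have := integrableD _ (lf t) (lg t); apply.
Qed.

Lemma integrable_from0Z f c : integrable_from0 f ->
  integrable_from0 (fun s => c * f s).
Proof. by move=> lf t; have := integrableZl _ c (lf t); apply. Qed.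

Lemma integrable_from0_cst0 : integrable_from0 (fun=> 0).
Proof. by move=> t; exact: integrable0. Qed.

Lemma integrable_from0_sum (I : Type) (r : seq I) (h : I -> R -> R) :
  (forall i, integrable_from0 (h i)) ->
  integrable_from0 (fun s => \sum_(i <- r) h i s).
Proof.
move=> lh; elim: r => [|i r ih].
  by under eq_fun do rewrite big_nil; exact: integrable_from0_cst0.
under eq_fun do rewrite big_cons.
exact: integrable_from0D.
Qed.

Lemma integrable_from0_norm f : integrable_from0 f ->
  integrable_from0 (fun s => `|f s|).
Proof. by move=> lf t; have := integrable_abse (lf t). Qed.

Lemma ler_time_integral f g t : integrable_from0 f ->
  integrable_from0 g -> (forall s, 0 <= s <= t -> f s <= g s) ->
  time_integral f t <= time_integral g t.
Proof.
by move=> lf lg fg; exact: le_Rintegral.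
Qed.

Lemma time_integral_ge0 f t : (forall s, 0 <= s <= t -> 0 <= f s) ->
  0 <= time_integral f t.
Proof.
by move=> f0; exact: Rintegral_ge0.
Qed.

Lemma ler_norm_time_integral f t : integrable_from0 f ->
  `|time_integral f t| <= time_integral (fun s => `|f s|) t.
Proof. by move=> lf; exact: le_normr_Rintegral. Qed.

Lemma time_integral_split f s t : integrable_from0 f -> 0 <= s <= t ->
  time_integral f t = time_integral f s + \int[mu]_(x in `]s, t]) f x.
Proof.
move=> lf /andP[s0 st]; have := @Rintegral_itvB R f (BLeft 0) (BRight t) s (lf t).
by rewrite !bnd_simp => /(_ s0 st) <-; rewrite addrC subrK.
Qed.

Lemma ler_time_integral2 f s t : integrable_from0 f ->
  (forall x, 0 <= x -> 0 <= f x) -> 0 <= s <= t ->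
  time_integral f s <= time_integral f t.
Proof.
move=> lf f0 st; rewrite (time_integral_split lf st) lerDl.
apply: Rintegral_ge0 => x /=; rewrite in_itv/= => /andP[sx _].
by apply: f0; case/andP: st => /le_trans/(_ (ltW sx)).
Qed.

Lemma continuous_time_integral f : integrable_from0 f ->
  continuous (time_integral f).
Proof.
move=> lf x; pose b := `|x| + 1.
have b0 : 0 <= b by rewrite /b addr_ge0.
(* The clamp into [0, b] reduces continuity at x to continuity on a segment: b lies beyond x, and
   the integral vanishes at negative times. *)
pose r (t : R) := Num.min (Num.max t 0) b.
have cr : continuous r.
  move=> y; apply: (@continuous_min R R (fun t => Num.max t 0) (fun=> b)).
    exact: continuous_maxr0.
  exact: cvg_cst.
have := @parameterized_integral_continuous R 0 b f b0 (lf b).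
move=> /continuous_retract/(_ cr).
have Ar t : [set` `[0, b]] (r t).
  by rewrite /= in_itv/= le_min le_max lexx orbT b0/= ge_min lexx orbT.
move=> /(_ Ar x) h.
have e t : t < b -> time_integral f t =
    (parameterized_integral mu 0) ^~ f (r t).
  move=> tb; rewrite /r; have [t0|t0] := leP t 0.
    by rewrite min_l// time_integral_le0// -[RHS]/(time_integral f 0) time_integral0.
  by rewrite min_l// ltW.
have xb : x < b by rewrite /b (le_lt_trans (ler_norm x))// ltrDl.
rewrite /continuous_at e//.
apply: cvg_trans h; apply: near_eq_cvg; near=> t.
by rewrite e//; near: t; exact: lt_nbhsl.
Unshelve. all: by end_near. Qed.

Lemma is_derive_time_integral f t : continuous f -> 0 < t ->
  is_derive t 1 (time_integral f) (f t).
Proof.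
move=> cf t0.
have [||||d e] := @continuous_FTC1_closed R f 0 t (t + 1).
- by rewrite ltrDl.
- exact: cont_integrable_from0.
- exact: t0.
- exact: cf.
by apply: DeriveDef d _; rewrite -derive1E e.
Qed.

Lemma time_integral_FTC F f t : continuous F -> continuous f ->
  (forall s : R, 0 < s -> is_derive s 1 F (f s)) -> 0 <= t ->
  time_integral f t = F t - F 0.
Proof.
move=> cF cf dF; rewrite le_eqVlt => /predU1P[<-|t0].
  by rewrite subrr time_integral0.
rewrite /time_integral /Rintegral (@continuous_FTC2 R f F)//.
- exact: continuous_subspaceT.
- split.
  + by move=> x /[!in_itv]/= /andP[x0 _]; have [] := dF x x0.
  + exact/cvg_at_right_filter/cF.
  + exact/cvg_at_left_filter/cF.
by move=> x /[!in_itv]/= /andP[x0 _]; rewrite derive1E; have [_] := dF x x0.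
Qed.

Lemma nonincreasing_of_derive F f t : {within `[0, +oo[, continuous F} ->
  (forall s : R, 0 < s -> is_derive s 1 F (f s)) ->
  (forall s, 0 < s <= t -> f s <= 0) -> 0 <= t -> F t <= F 0.
Proof.
move=> cF dF f0 t0.
apply: (@ler0_derive1_nincr R F 0 t) => //.
- by move=> s /[!in_itv]/= /andP[s0 _]; have [] := dF s s0.
- move=> s /[!in_itv]/= /andP[s0 st]; rewrite derive1E.
  by have [_ ->] := dF s s0; rewrite f0// s0 ltW.
- apply: continuous_subspaceW cF => s /=; rewrite !in_itv/= andbT.
  by case/andP.
Qed.

(* [int_0^t f] satisfies [F' <= C F + B], so [(F + B/C) exp(-C t)] is
   nonincreasing. *)
Lemma gronwall f (B C T : R) : continuous f -> 0 <= C -> 0 <= B -> 0 <= T ->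
  (forall t, 0 <= t <= T -> f t <= B + C * time_integral f t) ->
  forall t, 0 <= t <= T -> f t <= B * expR (C * t).
Proof.
move=> cf; rewrite le_eqVlt => /predU1P[<- B0 T0 h t tT|C0 B0 T0 h t /andP[t0 tT]].
  by have := h t tT; rewrite !mul0r addr0 expR0 mulr1.
pose F t := (C * time_integral f t + B) * expR (- C * t).
have cI : continuous (time_integral f).
  exact/continuous_time_integral/cont_integrable_from0.
have cF : continuous F.
  move=> x; apply: cvgM.
    by apply: cvgD; [apply: cvgM; [exact: cvg_cst|exact: cI]|exact: cvg_cst].
  apply: (@continuous_comp _ _ _ ( *%R (- C)) expR); last exact: continuous_expR.
  exact: mulrl_continuous.
have : F t <= F 0.
  apply: (@nonincreasing_of_derive F (fun t =>
    C * (f t - (B + C * time_integral f t)) * expR (- C * t))) => //.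
  - exact: continuous_subspaceT.
  - move=> s s0; have d1 := is_derive_time_integral cf s0.
    apply: is_derive_eq; rewrite /GRing.scale/=; ring.
  - move=> s /andP[s0 st]; rewrite -mulrA pmulr_rle0// pmulr_lle0 ?expR_gt0//.
    by rewrite subr_le0 h// (ltW s0) (le_trans st).
rewrite /F time_integral0 !mulr0 expR0 add0r mulr1 mulNr expRN.
rewrite ler_pdivrMr ?expR_gt0// addrC.
by apply: le_trans; rewrite h// t0.
Qed.

Lemma time_integral_by_parts f g F G t :
  continuous f -> continuous g -> continuous F -> continuous G ->
  (forall s : R, 0 < s -> is_derive s 1 F (f s)) ->
  (forall s : R, 0 < s -> is_derive s 1 G (g s)) -> 0 <= t ->
  time_integral (fun s => f s * G s) t + time_integral (fun s => F s * g s) t =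
  F t * G t - F 0 * G 0.
Proof.
move=> cf cg cF cG dF dG t0.
have cfG : continuous (fun s => f s * G s) by move=> x; apply: cvgM; [exact: cf|exact: cG].
have cFg : continuous (fun s => F s * g s) by move=> x; apply: cvgM; [exact: cF|exact: cg].
rewrite -time_integralD; [|exact: cont_integrable_from0..].
apply: (@time_integral_FTC (fun s => F s * G s)) => //.
- by move=> x; apply: cvgM; [exact: cF|exact: cG].
- by move=> x; apply: cvgD; [exact: cfG|exact: cFg].
- move=> s s0; have d1 := dF s s0; have d2 := dG s s0.
  by apply: is_derive_eq; rewrite /GRing.scale/=; ring.
Qed.

(** The integrating factor exp (- K t) makes [F] nonincreasing. Continuity is asked on [0, +oo[
    only, so that the lemma applies directly to [riccati_solution]. *)
Lemma derive_le_linear F f (K T : R) : {within `[0, +oo[, continuous F} ->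
  (forall s : R, 0 < s -> is_derive s 1 F (f s)) ->
  (forall s, 0 < s <= T -> f s <= K * F s) -> F 0 <= 0 -> 0 <= T -> F T <= 0.
Proof.
move=> cF dF fF F0 T0; pose G t := F t * expR (- K * t).
suff : G T <= G 0.
  rewrite /G mulr0 expR0 mulr1 => /le_trans/(_ F0).
  by rewrite pmulr_lle0// expR_gt0.
apply: (@nonincreasing_of_derive G (fun s => (f s - K * F s) * expR (- K * s))) => //.
- move=> x; apply: (@cvgM R); first exact: cF.
  apply: (@continuous_subspaceT _ _ _ (fun s => expR (- K * s))) => y.
  apply: (@continuous_comp _ _ _ ( *%R (- K)) expR); last exact: continuous_expR.
  exact: mulrl_continuous.
- move=> s s0; have d := dF s s0.
  by apply: is_derive_eq; rewrite /GRing.scale/=; ring.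
- by move=> s sT; rewrite pmulr_lle0 ?expR_gt0// subr_le0 fF.
Qed.

Lemma continuousD_fun f g : continuous f -> continuous g ->
  continuous (fun x => f x + g x).
Proof. by move=> cf cg x; apply: cvgD; [exact: cf|exact: cg]. Qed.

Lemma continuousM_fun f g : continuous f -> continuous g ->
  continuous (fun x => f x * g x).
Proof. by move=> cf cg x; apply: cvgM; [exact: cf|exact: cg]. Qed.

Lemma continuousN_fun f : continuous f -> continuous (fun x => - f x).
Proof. by move=> cf x; apply: cvgN; exact: cf. Qed.

Lemma continuousX_fun f n : continuous f -> continuous (fun x => f x ^+ n).
Proof.
move=> cf x; apply: (@continuous_comp _ _ _ f (fun y => y ^+ n)); first exact: cf.
exact: exprn_continuous.
Qed.

Lemma continuous_norm_fun f : continuous f -> continuous (fun x => `|f x|).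
Proof.
move=> cf x; apply: (@continuous_comp _ _ _ f Num.norm); first exact: cf.
exact: norm_continuous.
Qed.

Lemma continuous_sum_fun (I : Type) (r : seq I) (h : I -> R -> R) :
  (forall i, continuous (h i)) -> continuous (fun x => \sum_(i <- r) h i x).
Proof.
move=> ch; elim: r => [|i r ih].
  by under eq_fun do rewrite big_nil; exact: cst_continuous.
by under eq_fun do rewrite big_cons; exact: continuousD_fun.
Qed.

Lemma continuous_id_fun : continuous (fun x : R => x).
Proof. by move=> x; exact: cvg_id. Qed.

Lemma continuous_cst_fun (c : R) : continuous (fun _ : R => c).
Proof. exact: cst_continuous. Qed.

Lemma continuousZ_fun (x : R) f : continuous f -> continuous (fun s => x * f s).
Proof. by move=> cf; apply: continuousM_fun => //; exact: continuous_cst_fun. Qed.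

Lemma continuousB_fun f g : continuous f -> continuous g ->
  continuous (fun s => f s - g s).
Proof. by move=> cf cg; apply: continuousD_fun => //; exact: continuousN_fun. Qed.

End TimeIntegral.

(** * The Riccati equation *)

Section Riccati.
Context (R : realType).
Implicit Types (c k t th : R).

(** Since g1^2 - g2^2 factors, the squared difference solves a homogeneous linear equation, whose
    coefficient [K] is bounded on [0, t]. *)
Lemma riccati_solution_unique c th (g1 g2 : R -> R) t :
  riccati_solution c th g1 -> riccati_solution c th g2 -> 0 <= t ->
  g1 t = g2 t.
Proof.
move=> [g10 cg1 dg1] [g20 cg2 dg2] t0.
pose K (s : R) := 2 * (2 * c - th ^+ 2 * (g1 s + g2 s)).
have cK : continuous (fun s : R => K (Num.max s 0)).
  rewrite /K; have c1 := continuous_clamp cg1; have c2 := continuous_clamp cg2.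
  apply/continuousZ_fun/continuousB_fun; first exact: continuous_cst_fun.
  exact/continuousZ_fun/continuousD_fun.
have [C C0 KC] := continuous_locally_bounded cK t.
have : (g1 t - g2 t) ^+ 2 <= 0.
  apply: (@derive_le_linear R (fun s : R => (g1 s - g2 s) ^+ 2)
    (fun s : R => K s * (g1 s - g2 s) ^+ 2) C) => //.
  - move=> x; apply: (@cvgM R); apply: (@cvgB _ R^o);
      by [exact: cg1|exact: cg2].
  - move=> s s0; have d1 := dg1 s s0; have d2 := dg2 s s0.
    by apply: is_derive_eq; rewrite /K /GRing.scale/=; ring.
  - move=> s /andP[s0 st]; apply: ler_wpM2r; first exact: sqr_ge0.
    have := KC s; rewrite (ltW s0) st => /(_ isT).
    by rewrite max_l ?(ltW s0)//; apply: le_trans; exact: ler_norm.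
  - by rewrite g10 g20 subrr expr0n.
by rewrite real_exprn_even_le0 ?num_real//= subr_eq0 => /eqP.
Qed.

(** With th^2 = k^2 - c^2 the Riccati field factors as (1 - (k - c) g) (1 + (k + c) g), and
    separation of variables gives the quotient below, which tends to the root 1 / (k - c). Written
    in k instead of th, the formula covers th = 0 without division by th^2. *)
Definition riccati_den c k t := (k - c) + (k + c) * expR (- (2 * k) * t).

Definition riccati_sol c k t := (1 - expR (- (2 * k) * t)) / riccati_den c k t.

(* Partial derivative of [riccati_sol c k t] in k. *)
Definition riccati_dsol c k t :=
  (2 * t * expR (- (2 * k) * t) * riccati_den c k t -
   (1 - expR (- (2 * k) * t)) *
   (1 + expR (- (2 * k) * t) - 2 * t * (k + c) * expR (- (2 * k) * t))) /
  riccati_den c k t ^+ 2.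

Lemma riccati_den_gt0 c k t : 0 < k -> `|c| <= k -> 0 < riccati_den c k t.
Proof.
move=> k0 ck; rewrite /riccati_den; set E := expR _.
have E0 : 0 < E by exact: expR_gt0.
move: ck; rewrite ler_norml => /andP[c1 c2].
have := mulr_ge0 (_ : 0 <= k + c) (ltW E0).
have [c0|c0] := ltP c k.
  move=> h; have : 0 <= (k + c) * E by apply: h; lra.
  by move=> h'; lra.
have -> : c = k by lra.
by move=> _; rewrite subrr add0r mulr_gt0//; lra.
Qed.

Lemma riccati_sol0 c k : riccati_sol c k 0 = 0.
Proof. by rewrite /riccati_sol mulr0 expR0 subrr mul0r. Qed.

Lemma is_derive_riccati_sol c k t : 0 < k -> `|c| <= k ->
  is_derive t 1 (riccati_sol c k)
    (2 * c * riccati_sol c k t + 1 - (k ^+ 2 - c ^+ 2) * riccati_sol c k t ^+ 2).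
Proof.
move=> k0 ck; have den := lt0r_neq0 (riccati_den_gt0 t k0 ck).
rewrite /riccati_sol /riccati_den in den *.
apply: is_derive_eq; rewrite /GRing.scale/=.
move: den; set E := expR _ => den.
by field.
Qed.

Lemma is_derive_riccati_sol_k c k t : 0 < k -> `|c| <= k ->
  is_derive k 1 (fun k : R => riccati_sol c k t) (riccati_dsol c k t).
Proof.
move=> k0 ck; have den := lt0r_neq0 (riccati_den_gt0 t k0 ck).
rewrite /riccati_sol /riccati_dsol /riccati_den in den *.
apply: is_derive_eq; rewrite /GRing.scale/=.
move: den; set E := expR _ => den.
by field.
Qed.

(* The right-hand side is the k-derivative of the Riccati vector field. *)
Lemma is_derive_riccati_dsol c k t : 0 < k -> `|c| <= k ->
  is_derive t 1 (riccati_dsol c k)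
    (2 * c * riccati_dsol c k t - 2 * k * riccati_sol c k t ^+ 2 -
     2 * (k ^+ 2 - c ^+ 2) * riccati_sol c k t * riccati_dsol c k t).
Proof.
move=> k0 ck; have den := lt0r_neq0 (riccati_den_gt0 t k0 ck).
have den2 : riccati_den c k t ^+ 2 != 0 by rewrite expf_neq0.
rewrite /riccati_sol /riccati_dsol /riccati_den in den den2 *.
apply: is_derive_eq; rewrite /GRing.scale/=.
move: den den2; set E := expR _ => den _.
by field.
Qed.

Lemma continuous_riccati_sol c k : 0 < k -> `|c| <= k ->
  continuous (riccati_sol c k).
Proof.
move=> k0 ck t; have [d _] := is_derive_riccati_sol t k0 ck.
by apply/differentiable_continuous/derivable1_diffP.
Qed.

Lemma continuous_riccati_dsol c k : 0 < k -> `|c| <= k ->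
  continuous (riccati_dsol c k).
Proof.
move=> k0 ck t; have [d _] := is_derive_riccati_dsol t k0 ck.
by apply/differentiable_continuous/derivable1_diffP.
Qed.

Lemma cvg_expRN_lin (a : R) : 0 < a ->
  (fun t : R => expR (- a * t)) @ +oo --> (0 : R).
Proof.
move=> a0; have h : (fun t : R => t * a) @ +oo --> +oo.
  by apply: gt0_cvgMly => //; exact: cvg_id.
have := cvg_comp _ _ h (@cvgr_expR R).
apply: cvg_trans; apply: near_eq_cvg; apply: nearW => t /=.
by rewrite mulNr mulrC.
Qed.

(** Half of the exponent absorbs the linear factor, because a t / 2 <= exp (a t / 2). *)
Lemma cvg_id_expRN_lin (a : R) : 0 < a ->
  (fun t : R => t * expR (- a * t)) @ +oo --> (0 : R).
Proof.
move=> a0; have a20 : 0 < a / 2 by rewrite divr_gt0.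
have h : (fun t : R => (a / 2)^-1 * expR (- (a / 2) * t)) @ +oo --> (0 : R).
  by rewrite -[X in _ --> X](mulr0 (a / 2)^-1); apply: cvgM;
    [exact: cvg_cst|exact: cvg_expRN_lin].
apply: (squeeze_cvgr _ _ h); last exact: (cvg_cst (0 : R)).
near=> t; have t0 : 0 < t by near: t; exact: nbhs_pinfty_gt.
rewrite mulr_ge0 ?expR_ge0 ?(ltW t0)//=.
have -> : - a * t = - (a / 2) * t + - (a / 2) * t by field.
rewrite expRD mulrA ler_wpM2r ?expR_ge0//.
rewrite mulNr expRN ler_pdivrMr ?expR_gt0// mulrC ler_pdivlMr//.
by have := expR_ge1Dx (a / 2 * t); lra.
Unshelve. all: by end_near. Qed.

Lemma cvg_riccati_den c k : 0 < k ->
  riccati_den c k t @[t --> +oo] --> k - c.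
Proof.
move=> k0; rewrite -[X in _ --> X]addr0 -(mulr0 (k + c)).
apply: cvgD; first exact: cvg_cst.
by apply: cvgM; [exact: cvg_cst|apply: cvg_expRN_lin; rewrite mulr_gt0].
Qed.

Lemma cvg_riccati_sol c k : 0 < k -> c < k ->
  riccati_sol c k t @[t --> +oo] --> (k - c)^-1.
Proof.
move=> k0 ck; rewrite -[X in _ --> X]mul1r -[X in X * _]subr0.
apply: cvgM.
  by apply: cvgB; [exact: cvg_cst|apply: cvg_expRN_lin; rewrite mulr_gt0].
by apply: cvgV; [rewrite subr_eq0 gt_eqF|exact: cvg_riccati_den].
Qed.

(** The limit is the k-derivative of 1 / (k - c); rather than interchanging limit and derivative, it
    is computed on the explicit formula. *)
Lemma cvg_riccati_dsol c k : 0 < k -> c < k ->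
  riccati_dsol c k t @[t --> +oo] --> - (k - c) ^- 2.
Proof.
move=> k0 ck.
have e0 : expR (- (2 * k) * t) @[t --> +oo] --> (0 : R).
  by apply: cvg_expRN_lin; rewrite mulr_gt0.
have te0 : 2 * t * expR (- (2 * k) * t) @[t --> +oo] --> 2 * (0 : R).
  under eq_fun do rewrite -mulrA.
  by apply: cvgM; [exact: cvg_cst|apply: cvg_id_expRN_lin; rewrite mulr_gt0].
have te1 : 2 * t * (k + c) * expR (- (2 * k) * t) @[t --> +oo] -->
    (k + c) * (2 * (0 : R)).
  under eq_fun do rewrite mulrAC mulrC.
  by apply: cvgM; [exact: cvg_cst|exact: te0].
have -> : - (k - c) ^- 2 = (2 * 0 * (k - c) - (1 - 0) *
    (1 + 0 - (k + c) * (2 * 0))) * ((k - c) ^+ 2)^-1.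
  by move: ((k - c) ^+ 2)^-1 => x; ring.
have dn := @cvg_riccati_den c k k0.
apply: cvgM; last first.
  apply: cvgV; first by rewrite expf_neq0// subr_eq0 gt_eqF.
  by apply: (cvg_comp _ (fun x => x ^+ 2) dn); exact: exprn_continuous.
apply: cvgB; first by apply: cvgM.
apply: cvgM; first by apply: cvgB; [exact: cvg_cst|].
by apply: cvgB => //; apply: cvgD; [exact: cvg_cst|].
Qed.

(** Half the square root of the discriminant of the Riccati right-hand side. It is also the
    asymptotic decay rate of the filtering error, see [cvg_error_drift]. *)
Definition kappa c th := Num.sqrt (c ^+ 2 + th ^+ 2).

Lemma kappa_sqr c th : kappa c th ^+ 2 = c ^+ 2 + th ^+ 2.
Proof. by rewrite sqr_sqrtr// addr_ge0// sqr_ge0. Qed.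

Lemma kappa_ge0 c th : 0 <= kappa c th.
Proof. exact: sqrtr_ge0. Qed.

Lemma ler_norm_kappa c th : `|c| <= kappa c th.
Proof. by rewrite -sqrtr_sqr ler_sqrt ?lerDl ?addr_ge0 ?sqr_ge0. Qed.

Lemma kappa_gt0 c th : (c != 0) || (th != 0) -> 0 < kappa c th.
Proof.
move=> h; rewrite sqrtr_gt0 lt0r addr_ge0 ?sqr_ge0// andbT.
by rewrite paddr_eq0 ?sqr_ge0// !sqrf_eq0 negb_and.
Qed.

(** This strict inequality makes [gamma] converge; it fails exactly for th = 0 and c >= 0, where k =
    c. *)
Lemma ltr_kappa c th : (c < 0) || (th != 0) -> c < kappa c th.
Proof.
move=> /orP[c0|th0]; first exact: lt_le_trans c0 (kappa_ge0 c th).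
have := ler_norm_kappa c th; apply: contraTT; rewrite -leNgt => h.
have c0 : 0 <= c := le_trans (kappa_ge0 _ _) h.
rewrite -ltNge ger0_norm// lt_neqAle h andbT.
apply/eqP => e; have := kappa_sqr c th; rewrite e => /esym/eqP.
by rewrite addrC -subr_eq0 addrK sqrf_eq0 (negPf th0).
Qed.

Lemma is_derive_kappa c th : (c != 0) || (th != 0) ->
  is_derive th 1 (kappa c) (th / kappa c th).
Proof.
move=> h; have k0 := kappa_gt0 h.
have p0 : 0 < c ^+ 2 + th ^+ 2 by rewrite -sqrtr_gt0.
have d1 := is_derive1_sqrt p0.
have d2 : is_derive th 1 (fun th => c ^+ 2 + th ^+ 2) (2 * th).
  by apply: is_derive_eq; rewrite /GRing.scale/=; ring.
have d := @is_derive1_comp R _ (fun th => c ^+ 2 + th ^+ 2) th _ _ d1 d2.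
apply: (@is_derive_eq R R R (kappa c) _ _ _ _ d).
rewrite -[Num.ExtraDef.sqrtr _]/(kappa c th).
by field; rewrite lt0r_neq0.
Qed.

Section FilterVariance.
Variables (gamma : R -> R -> R -> R).
Hypothesis hgamma : forall c th, riccati_solution c th (gamma c th).

Lemma riccati_solution_sol c th : (c != 0) || (th != 0) ->
  riccati_solution c th (riccati_sol c (kappa c th)).
Proof.
move=> h; have k0 := kappa_gt0 h; have ck := ler_norm_kappa c th.
split; first exact: riccati_sol0.
  exact/continuous_subspaceT/continuous_riccati_sol.
move=> t _; have := is_derive_riccati_sol t k0 ck.
by have -> : kappa c th ^+ 2 - c ^+ 2 = th ^+ 2 by rewrite kappa_sqr; ring.
Qed.

Lemma gammaE c th t : (c != 0) || (th != 0) -> 0 <= t ->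
  gamma c th t = riccati_sol c (kappa c th) t.
Proof.
move=> h t0; apply: riccati_solution_unique (hgamma c th) _ t0.
exact: riccati_solution_sol.
Qed.

Lemma derive_gammaE c th t : (c != 0) || (th != 0) -> 0 <= t ->
  derive1 (fun th => gamma c th t) th =
  riccati_dsol c (kappa c th) t * (th / kappa c th).
Proof.
move=> h t0; have k0 := kappa_gt0 h; have ck := ler_norm_kappa c th.
have d1 := is_derive_riccati_sol_k t k0 ck.
have d := is_derive1_comp d1 (is_derive_kappa h).
(* The derivative sees [gamma] at parameters near th, so the explicit formula has to be available on
   a neighbourhood; for c = 0 this uses that th != 0 is an open condition. *)
have hx : \forall x \near th, (c != 0) || (x != 0).
  have [c0|c0] := eqVneq c 0; last first.
    by apply: (@filterS _ (nbhs th) _ setT) => [x _//|]; exact: filterT.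
  move: h; rewrite c0 eqxx /= => th0.
  have [th1|th1|e] := ltgtP th 0; last by rewrite e eqxx in th0.
    by apply: (@filterS _ (nbhs th)) (lt_nbhsl th1) => x /lt_eqF ->.
  by apply: (@filterS _ (nbhs th)) (lt_nbhsr th1) => x /gt_eqF ->.
rewrite derive1E; have [_ <-] := d.
by apply: near_eq_derive; apply: (@filterS _ (nbhs th)) hx => x hx; rewrite /= gammaE.
Qed.

End FilterVariance.

End Riccati.

(** * Covariances of linear systems with additive noise *)

Section SquareIntegrable.
Context (R : realType) (d : measure_display) (Omega : measurableType d).
Context (P : probability Omega R).
Implicit Types (f g : Omega -> R) (F Z : R -> Omega -> R) (s t : R).
Local Notation mu := (@lebesgue_measure R).

Definition ev f : R := \int[P]_w f w.

Definition integrable_rv f := P.-integrable [set: Omega] (EFin \o f).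

Definition square_integrable f :=
  measurable_fun [set: Omega] f /\ integrable_rv (fun w => f w ^+ 2).

Lemma le_integrable_rv f g : measurable_fun setT f -> integrable_rv g ->
  (forall w, `|f w| <= g w) -> integrable_rv f.
Proof.
move=> mf ig fg; apply: le_integrable ig => //.
  exact/measurable_EFinP.
by move=> w _ /=; rewrite lee_fin (le_trans (fg w))// ler_norm.
Qed.

Lemma integrable_rvD f g : integrable_rv f -> integrable_rv g ->
  integrable_rv (fun w => f w + g w).
Proof. by move=> lf lg; have := integrableD measurableT lf lg. Qed.

Lemma integrable_rvZ f c : integrable_rv f -> integrable_rv (fun w => c * f w).
Proof. by move=> lf; have := integrableZl measurableT c lf. Qed.

Lemma integrable_rv_cst c : integrable_rv (fun=> c).
Proof. exact: finite_measure_integrable_cst. Qed.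

Lemma integrable_rv_norm f : integrable_rv f -> integrable_rv (fun w => `|f w|).
Proof. by move=> lf; have := integrable_abse lf. Qed.

Lemma integrable_rv_sum (I : Type) (r : seq I) (h : I -> Omega -> R) :
  (forall i, integrable_rv (h i)) ->
  integrable_rv (fun w => \sum_(i <- r) h i w).
Proof.
move=> ih; elim: r => [|i r IH].
  by under eq_fun do rewrite big_nil; exact: integrable_rv_cst.
by under eq_fun do rewrite big_cons; exact: integrable_rvD.
Qed.

Lemma evD f g : integrable_rv f -> integrable_rv g ->
  ev (fun w => f w + g w) = ev f + ev g.
Proof. by move=> lf lg; exact: RintegralD. Qed.

Lemma evZ f c : integrable_rv f -> ev (fun w => c * f w) = c * ev f.
Proof. by move=> lf; exact: RintegralZl. Qed.

Lemma ev_cst c : ev (fun=> c) = c.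
Proof.
rewrite /ev Rintegral_cst//.
by have /= -> := @probability_setT _ _ _ P; rewrite mulr1.
Qed.

Lemma ev_sum (I : Type) (r : seq I) (h : I -> Omega -> R) :
  (forall i, integrable_rv (h i)) ->
  ev (fun w => \sum_(i <- r) h i w) = \sum_(i <- r) ev (h i).
Proof.
move=> ih; elim: r => [|i r IH].
  by under eq_fun do rewrite big_nil; rewrite big_nil ev_cst.
under eq_fun do rewrite big_cons.
by rewrite big_cons evD ?IH//; exact: integrable_rv_sum.
Qed.

Lemma ler_ev f g : integrable_rv f -> integrable_rv g ->
  (forall w, f w <= g w) -> ev f <= ev g.
Proof. by move=> lf lg fg; exact: le_Rintegral. Qed.

Lemma ev_ge0 f : (forall w, 0 <= f w) -> 0 <= ev f.
Proof. by move=> f0; exact: Rintegral_ge0. Qed.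

Lemma ler_norm_ev f : integrable_rv f -> `|ev f| <= ev (fun w => `|f w|).
Proof. by move=> lf; exact: le_normr_Rintegral. Qed.

Let ler_normM_sqr (x y : R) : `|x * y| <= x ^+ 2 + y ^+ 2.
Proof.
rewrite normrM -[x ^+ 2]real_normK ?num_real// -[y ^+ 2]real_normK ?num_real//.
by nra.
Qed.

Lemma square_integrableM f g : square_integrable f -> square_integrable g ->
  integrable_rv (fun w => f w * g w).
Proof.
move=> [mf lf] [mg lg]; apply: (@le_integrable_rv _ (fun w => f w ^+ 2 + g w ^+ 2)).
- exact: measurable_funM.
- exact: integrable_rvD.
by move=> w; exact: ler_normM_sqr.
Qed.

Lemma square_integrable_cst c : square_integrable (fun=> c).
Proof. by split; [exact: measurable_cst|exact: integrable_rv_cst]. Qed.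

Lemma square_integrable_integrable f : square_integrable f -> integrable_rv f.
Proof.
move=> sf; have := square_integrableM sf (square_integrable_cst 1).
by under eq_fun do rewrite mulr1.
Qed.

Lemma square_integrableZ f c : square_integrable f ->
  square_integrable (fun w => c * f w).
Proof.
move=> [mf lf]; split; first exact: measurable_funM.
by under eq_fun do rewrite exprMn; exact: integrable_rvZ.
Qed.

Lemma square_integrableD f g : square_integrable f -> square_integrable g ->
  square_integrable (fun w => f w + g w).
Proof.
move=> sf sg; have [[mf lf] [mg lg]] := (sf, sg).
split; first exact: measurable_funD.
under eq_fun do rewrite sqrrD -mulr_natl.
apply: integrable_rvD => //; apply: integrable_rvD => //.
exact/integrable_rvZ/square_integrableM.
Qed.

Lemma ev_mul_le f g : square_integrable f -> square_integrable g ->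
  ev (fun w => `|f w * g w|) <= ev (fun w => f w ^+ 2) + ev (fun w => g w ^+ 2).
Proof.
move=> sf sg; rewrite -evD; [|exact: sf.2|exact: sg.2].
apply: ler_ev.
- exact/integrable_rv_norm/square_integrableM.
- by apply: integrable_rvD; [exact: sf.2|exact: sg.2].
by move=> w; exact: ler_normM_sqr.
Qed.

(** Asked on the whole line; the processes of the model, measurable at nonnegative times, are
    clamped by [Num.max t 0] beforehand. *)
Definition jointly_measurable Z := measurable_fun setT
  (fun z : measurableTypeR R * Omega => Z z.1 z.2).

Lemma jointly_measurable_section Z t : jointly_measurable Z ->
  measurable_fun setT (Z t).
Proof. by move=> mZ; exact: (measurableT_comp mZ (pair1_measurable t)). Qed.

Lemma jointly_measurableD Y Z : jointly_measurable Y -> jointly_measurable Z ->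
  jointly_measurable (fun t w => Y t w + Z t w).
Proof. by move=> mY mZ; exact: measurable_funD. Qed.

Lemma jointly_measurableM Y Z : jointly_measurable Y -> jointly_measurable Z ->
  jointly_measurable (fun t w => Y t w * Z t w).
Proof. by move=> mY mZ; exact: measurable_funM. Qed.

Lemma jointly_measurable_time (a : R -> R) : measurable_fun setT a ->
  jointly_measurable (fun t _ => a t).
Proof. by move=> ma; exact: (measurableT_comp ma measurable_fst). Qed.

(** Tonelli gives measurability of the integrals of the positive and negative parts; subtraction in
    the extended reals and [fine] preserve it, also where these integrals are infinite. *)
Lemma measurable_fun_partial_integral d1 d2 (T1 : measurableType d1)
    (T2 : measurableType d2) (m2 : {sigma_finite_measure set T2 -> \bar R})
    (h : T1 * T2 -> R) : measurable_fun setT h ->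
  measurable_fun setT (fun x => \int[m2]_y h (x, y)).
Proof.
move=> mh; have mEh : measurable_fun setT (EFin \o h) by exact/measurable_EFinP.
apply: (@measurableT_comp _ _ _ _ _ _ fine) => //.
rewrite (_ : (fun _ => _) = fun x => (\int[m2]_y (EFin \o h)^\+%E (x, y) -
    \int[m2]_y (EFin \o h)^\-%E (x, y))%E).
  apply: emeasurable_funB.
    exact: (measurable_fun_fubini_tonelli_F _ (measurable_funepos mEh)).
  exact: (measurable_fun_fubini_tonelli_F _ (measurable_funeneg mEh)).
apply/funext => x; rewrite [LHS]integralE.
by congr (_ - _)%E; apply: eq_integral => y _; rewrite ?funeposE ?funenegE.
Qed.

Lemma jointly_measurable_time_integral Z : jointly_measurable Z ->
  jointly_measurable (fun t w => time_integral (fun s => Z s w) t).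
Proof.
(* The moving endpoint t becomes part of an indicator, so that the integral runs over a fixed space
   with (t, w) as parameter. *)
move=> mZ; pose h (z : (measurableTypeR R * Omega) * measurableTypeR R) :=
  if (0 <= z.2) && (z.2 <= z.1.1) then Z z.2 z.1.2 else 0.
have mh : measurable_fun setT h.
  apply: measurable_fun_ifT.
  - apply: measurable_and; apply: measurable_fun_ler.
    + exact: measurable_cst.
    + exact: measurable_snd.
    + exact: measurable_snd.
    + exact: (measurableT_comp measurable_fst measurable_fst).
  - have mg : measurable_fun setT
        (fun z : (measurableTypeR R * Omega) * measurableTypeR R => (z.2, z.1.2)).
      apply: measurable_fun_pair; first exact: measurable_snd.
      exact: (measurableT_comp measurable_snd measurable_fst).
    exact: (measurableT_comp mZ mg).
  - exact: measurable_cst.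
have := @measurable_fun_partial_integral _ _ _ _ mu _ mh.
congr (measurable_fun _ _); apply/funext => -[t w] /=.
rewrite /time_integral Rintegral_mkcond; apply: eq_Rintegral => s _.
rewrite /h patchE/=; case: ifPn => [|st].
  by move=> st; rewrite mem_set//= in_itv.
by rewrite memNset//= in_itv/=; exact/negP.
Qed.

(** Fubini for [F] cut off outside [0, t]. The uniform bound on E|F s| makes the cut-off function
    integrable for the product measure; continuity of the paths makes each time integral a finite
    number. *)
Lemma ev_time_integral F t : jointly_measurable F ->
  (forall w, continuous (fun s => F s w)) ->
  (exists C, forall s : R, 0 <= s <= t ->
    integrable_rv (F s) /\ ev (fun w => `|F s w|) <= C) -> 0 <= t ->
  integrable_rv (fun w => time_integral (fun s => F s w) t) /\
  ev (fun w => time_integral (fun s => F s w) t) =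
    time_integral (fun s => ev (F s)) t.
Proof.
move=> mF cF [C FC] t0.
pose G (z : measurableTypeR R * Omega) : \bar R :=
  (if (0 <= z.1) && (z.1 <= t) then F z.1 z.2 else 0)%:E.
have mG : measurable_fun setT G.
  apply/measurable_EFinP; apply: measurable_fun_ifT => //.
  apply: measurable_and; apply: measurable_fun_ler => //; exact: measurable_fst.
have itv (h : R -> \bar R) : (\int[mu]_(s in `[0%R, t]) h s =
    \int[mu]_s (if ((0 <= s) && (s <= t))%R then h s else 0))%E.
  rewrite integral_mkcond; apply: eq_integral => s _; rewrite patchE.
  case: ifPn => [|st].
    by move=> /set_mem /=; rewrite in_itv/= => ->.
  by case: ifPn => // h'; move: st; rewrite mem_set//= in_itv.
have GE s w : G (s, w) =
    (if ((0 <= s) && (s <= t))%R then (F s w)%:E else 0)%E.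
  by rewrite /G /=; case: ifP.
have fubG1 s : (\int[P]_w G (s, w))%E =
    (if ((0 <= s) && (s <= t))%R then (ev (F s))%:E else 0)%E.
  under eq_integral do rewrite GE.
  case: ifPn => [st|_]; last by rewrite integral0.
  by have [iF _] := FC s st; rewrite /ev /Rintegral fineK// integrable_fin_num.
have iG : (mu \x P)%E.-integrable setT G.
  apply/(integrable12ltyP mu P mG).
  apply: (@le_lt_trans _ _ (\int[mu]_(s in `[0%R, t]) (C%:E))%E); last first.
    rewrite integral_cst//= lebesgue_measure_itv/= lte_fin.
    by case: ifP => _; rewrite -?EFinD -?EFinM ?mule0 ltry.
  rewrite itv; apply: ge0_le_integral => //.
  - by move=> s _; exact: integral_ge0.
  - apply: (measurable_fun_fubini_tonelli_F (abse \o G)) => [|z].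
      exact: measurableT_comp.
    exact: abse_ge0.
  - apply: measurable_fun_ifT => //.
    by apply: measurable_and; apply: measurable_fun_ler.
  move=> s _; under eq_integral do rewrite GE.
  case: ifPn => [st|_]; last first.
    by under eq_integral do rewrite abse0; rewrite integral0.
  have [iF hC] := FC s st.
  move: hC; rewrite -lee_fin /ev /Rintegral fineK//.
  exact/integrable_fin_num/integrable_rv_norm.
have pathE w : (\int[mu]_s G (s, w))%E = (time_integral (fun s => F s w) t)%:E.
  under eq_integral do rewrite GE.
  rewrite -(itv (fun s => (F s w)%:E)) /time_integral /Rintegral fineK//.
  exact/integrable_fin_num/(cont_integrable_from0 (cF w)).
split.
  have iG' : P.-integrable setT (fun w => \int[mu]_s G (s, w))%E.
    have mI := @measurable_fubini_G _ _ _ _ _ mu P _ iG.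
    apply/integrableP; split => //.
    apply: le_lt_trans ((integrable21ltyP mu P mG).1 iG).
    apply: ge0_le_integral => //.
    - exact: measurableT_comp.
    - apply: (measurable_fun_fubini_tonelli_G (abse \o G)) => [|z].
        exact: measurableT_comp.
      exact: abse_ge0.
    move=> w _; apply: le_abse_integral => //.
    exact: (measurableT_comp mG (pair2_measurable w)).
  by move: iG'; congr (_.-integrable _ _); apply/funext => w; rewrite pathE.
rewrite /ev /time_integral /Rintegral; congr fine.
rewrite [RHS](itv (fun s => (ev (F s))%:E)).
transitivity (\int[mu]_s \int[P]_w G (s, w))%E; last exact: eq_integral.
by rewrite (Fubini iG); apply: eq_integral => w _; rewrite pathE.
Qed.

Lemma measurable_ev F : jointly_measurable F ->
  measurable_fun setT (fun s => ev (F s)).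
Proof. by move=> mF; exact: (@measurable_fun_partial_integral _ _ _ _ P _ mF). Qed.

End SquareIntegrable.

(** * Processes with locally bounded second moments *)

Section SquareIntegrableProcess.
Context (R : realType) (d : measure_display) (Omega : measurableType d).
Context (P : probability Omega R).
Implicit Types (Y Z : R -> Omega -> R) (xi : Omega -> R) (s t T : R).
Local Notation ev := (ev P).
Local Notation square_integrable := (square_integrable P).
Local Notation integrable_rv := (integrable_rv P).

Definition locally_square_integrable Z := forall T, exists2 C, 0 <= C &
  forall t, 0 <= t <= T ->
    square_integrable (Z t) /\ ev (fun w => Z t w ^+ 2) <= C.

(** A class closed under sums, continuous deterministic factors and time integration, in which
    expectations of products commute with time integrals. *)
Definition square_integrable_process Z :=
  [/\ jointly_measurable Z, forall w, continuous (fun t => Z t w)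
    & locally_square_integrable Z].

Local Notation sqp := square_integrable_process.

Lemma sqp_section Z t : sqp Z -> 0 <= t -> square_integrable (Z t).
Proof. by move=> [_ _ /(_ t)[C _ h]] t0; have [] := h t; rewrite ?t0 ?lexx. Qed.

Lemma sqpD Y Z : sqp Y -> sqp Z -> sqp (fun t w => Y t w + Z t w).
Proof.
move=> [mY cY bY] [mZ cZ bZ]; split.
- exact: jointly_measurableD.
- by move=> w; exact: continuousD_fun.
move=> T; have [C C0 hC] := bY T; have [D D0 hD] := bZ T.
exists (2 * C + 2 * D); first by lra.
move=> t tT; have [sY YC] := hC t tT; have [sZ ZD] := hD t tT.
split; first exact: square_integrableD.
have iY := sY.2; have iZ := sZ.2.
apply: (@le_trans _ _ (2 * ev (fun w => Y t w ^+ 2) + 2 * ev (fun w => Z t w ^+ 2))); last by lra.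
rewrite -!evZ// -evD; [|exact: integrable_rvZ..].
apply: ler_ev.
- by have [_] := square_integrableD sY sZ.
- by apply: integrable_rvD; exact: integrable_rvZ.
by move=> w; have := sqr_ge0 (Y t w - Z t w); lra.
Qed.

Lemma sqpM (a : R -> R) Z : continuous a -> sqp Z -> sqp (fun t w => a t * Z t w).
Proof.
move=> ca [mZ cZ bZ]; split.
- apply: jointly_measurableM => //; apply: jointly_measurable_time.
  exact: continuous_measurable.
- by move=> w; exact: continuousM_fun.
move=> T; have [C C0 hC] := bZ T; have [D D0 hD] := continuous_locally_bounded ca T.
exists (D ^+ 2 * C); first by rewrite mulr_ge0// sqr_ge0.
move=> t tT; have [sZ ZC] := hC t tT; split; first exact: square_integrableZ.
under eq_fun do rewrite exprMn.
rewrite evZ; last exact: sZ.2.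
apply: ler_pM => //; first exact: sqr_ge0.
- by apply: ev_ge0 => w; exact: sqr_ge0.
by rewrite -real_normK ?num_real// ler_pXn2r ?nnegrE ?hD.
Qed.

Lemma sqpZ c Z : sqp Z -> sqp (fun t w => c * Z t w).
Proof. by apply: sqpM; exact: continuous_cst_fun. Qed.

Lemma sqp0 : sqp (fun _ _ => 0).
Proof.
split; [exact: measurable_cst|by move=> w; exact: continuous_cst_fun|].
move=> T; exists 0 => // t _; split; first exact: square_integrable_cst.
by under eq_fun do rewrite expr0n; rewrite ev_cst.
Qed.

Lemma sqp_sum (I : Type) (r : seq I) (h : I -> R -> Omega -> R) :
  (forall i, sqp (h i)) -> sqp (fun t w => \sum_(i <- r) h i t w).
Proof.
move=> sh; elim: r => [|i r IH].
  rewrite (_ : (fun _ => _) = fun _ _ => 0); first exact: sqp0.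
  by apply/funext => t; apply/funext => w; rewrite big_nil.
rewrite (_ : (fun _ => _) = fun t w => h i t w + \sum_(j <- r) h j t w).
  exact: sqpD.
by apply/funext => t; apply/funext => w; rewrite big_cons.
Qed.

Lemma sqp_norm Z : sqp Z -> sqp (fun t w => `|Z t w|).
Proof.
move=> [mZ cZ bZ]; split.
- exact: (measurableT_comp _ mZ).
- by move=> w; exact: continuous_norm_fun.
move=> T; have [C C0 hC] := bZ T; exists C => // t /hC [[mZt iZt] ZC].
split; last by under eq_fun do rewrite real_normK ?num_real//.
split; first exact: (measurableT_comp _ mZt).
by under eq_fun do rewrite real_normK ?num_real//.
Qed.

(** Cauchy-Schwarz, from the nonnegativity of the integral of (f - m)^2, where m is the mean of [f]
    on [0, t]. *)
Lemma sqr_time_integral_le (f : R -> R) t : continuous f -> 0 <= t ->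
  time_integral f t ^+ 2 <= t * time_integral (fun s => f s ^+ 2) t.
Proof.
move=> cf; rewrite le_eqVlt => /predU1P[<-|t0].
  by rewrite time_integral0 expr0n mul0r.
have cf2 : continuous (fun s => f s ^+ 2) by exact: continuousX_fun.
pose m := time_integral f t / t.
have : 0 <= time_integral (fun s => f s ^+ 2 + (- 2 * m) * f s + m ^+ 2) t.
  by apply: time_integral_ge0 => s _; have := sqr_ge0 (f s - m); lra.
have l1 := cont_integrable_from0 cf2.
have l2 := integrable_from0Z (- 2 * m) (cont_integrable_from0 cf).
have l3 := cont_integrable_from0 (@continuous_cst_fun R (m ^+ 2)).
rewrite (time_integralD _ (integrable_from0D l1 l2) l3) (time_integralD _ l1 l2).
rewrite time_integralZ; last exact: cont_integrable_from0.
rewrite (time_integral_cst _ (ltW t0)).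
have IE : time_integral f t = m * t by rewrite /m divfK// lt0r_neq0.
clearbody m; rewrite IE => h.
by have := mulr_ge0 (ltW t0) h; lra.
Qed.

Lemma sqp_time_integral Z : sqp Z ->
  sqp (fun t w => time_integral (fun s => Z s w) t).
Proof.
move=> sZ; have [mZ cZ bZ] := sZ.
have mI := jointly_measurable_time_integral mZ.
split => //.
  by move=> w; exact/continuous_time_integral/cont_integrable_from0.
move=> T; have [C C0 hC] := bZ T; exists (T ^+ 2 * C); first by rewrite mulr_ge0// sqr_ge0.
move=> t /andP[t0 tT].
have [||||iI eI] := @ev_time_integral _ _ _ P (fun s w => Z s w ^+ 2) t.
- exact: (measurable_funX _ mZ).
- by move=> w; exact: continuousX_fun.
- exists C => s /andP[s0 st]; have sT : 0 <= s <= T by rewrite s0 (le_trans st).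
  have [[mZs iZs] ZC] := hC s sT.
  by split => //; under eq_fun do rewrite ger0_norm ?sqr_ge0//.
- exact: t0.
have mIt := jointly_measurable_section t mI.
have i2 : integrable_rv (fun w => time_integral (fun s => Z s w) t ^+ 2).
  apply: (@le_integrable_rv _ _ _ _ _ (fun w => t * time_integral (fun s => Z s w ^+ 2) t)).
  - exact: measurable_funX.
  - exact: integrable_rvZ.
  by move=> w; rewrite ger0_norm ?sqr_ge0// sqr_time_integral_le.
split; first by split.
apply: (@le_trans _ _ (t * (C * t))); last first.
  rewrite mulrCA -expr2 mulrC ler_wpM2r// ler_pXn2r// nnegrE//.
  exact: le_trans tT.
apply: (le_trans (ler_ev i2 (integrable_rvZ t iI) _)).
  by move=> w; rewrite sqr_time_integral_le.
rewrite evZ// ler_wpM2l// eI.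
have -> : C * t = time_integral (fun=> C) t by rewrite time_integral_cst.
have mE : measurable_fun setT (fun s => ev (fun w => Z s w ^+ 2)).
  by apply: measurable_ev; exact: (measurable_funX _ mZ).
have bE T' : exists2 C, 0 <= C &
    forall s, 0 <= s <= T' -> `|ev (fun w => Z s w ^+ 2)| <= C.
  have [D D0 hD] := bZ T'; exists D => // s sT; have [_] := hD s sT.
  by rewrite ger0_norm// ev_ge0// => w; exact: sqr_ge0.
apply: ler_time_integral.
- exact: bounded_integrable_from0.
- exact/cont_integrable_from0/continuous_cst_fun.
move=> s /andP[s0 st]; have sT : 0 <= s <= T by rewrite s0 (le_trans st).
by have [] := hC s sT.
Qed.

Lemma covariance_locally_bounded Y Z : sqp Y -> sqp Z ->
  locally_bounded (fun s => ev (fun w => Y s w * Z s w)).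
Proof.
move=> [_ _ bY] [_ _ bZ] T; have [C C0 hC] := bY T; have [D D0 hD] := bZ T.
exists (C + D); first by rewrite addr_ge0.
move=> s sT; have [sY YC] := hC s sT; have [sZ ZD] := hD s sT.
apply: (le_trans (ler_norm_ev (square_integrableM sY sZ))).
by apply: (le_trans (ev_mul_le sY sZ)); rewrite lerD.
Qed.

Lemma covariance_integrable_from0 Y Z : sqp Y -> sqp Z ->
  integrable_from0 (fun s => ev (fun w => Y s w * Z s w)).
Proof.
move=> sY sZ; apply: bounded_integrable_from0.
  by apply: measurable_ev; have [mY _ _] := sY; have [mZ _ _] := sZ;
    exact: jointly_measurableM.
exact: covariance_locally_bounded.
Qed.

Lemma sqp_cst xi : square_integrable xi -> sqp (fun _ => xi).
Proof.
move=> [mx ix]; split.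
- exact: (measurableT_comp mx measurable_snd).
- by move=> w; exact: continuous_cst_fun.
move=> T; exists (ev (fun w => xi w ^+ 2)); last by [].
by apply: ev_ge0 => w; exact: sqr_ge0.
Qed.

Lemma ev_time_integralM Z xi t : sqp Z -> square_integrable xi -> 0 <= t ->
  ev (fun w => time_integral (fun s => Z s w) t * xi w) =
  time_integral (fun s => ev (fun w => Z s w * xi w)) t.
Proof.
move=> sZ sx t0; have sX := sqp_cst sx.
have [mZ cZ bZ] := sZ; have [mX cX bX] := sX.
have [||||_ <-] := @ev_time_integral _ _ _ P (fun s w => Z s w * xi w) t.
- exact: (jointly_measurableM mZ mX).
- by move=> w; exact: continuousM_fun.
- have [C _ hC] := bZ t; exists (C + ev (fun w => xi w ^+ 2)) => s st.
  have [sZs ZC] := hC s st; split; first exact: square_integrableM.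
  by apply: (le_trans (ev_mul_le sZs sx)); rewrite lerD2r.
- exact: t0.
congr ev; apply/funext => w; rewrite mulrC -time_integralZ.
  by apply: eq_time_integral => s _; rewrite mulrC.
exact: cont_integrable_from0.
Qed.

(** The product of two time integrals is differentiated path by path, and Fubini then moves the
    expectation inside. *)
Lemma ev_time_integral_mul Y Z t : sqp Y -> sqp Z -> 0 <= t ->
  ev (fun w => time_integral (fun s => Y s w) t * time_integral (fun s => Z s w) t) =
  time_integral (fun s =>
    ev (fun w => Y s w * time_integral (fun r => Z r w) s) +
    ev (fun w => time_integral (fun r => Y r w) s * Z s w)) t.
Proof.
move=> sY sZ t0; have [mY cY bY] := sY; have [mZ cZ bZ] := sZ.
have sIY := sqp_time_integral sY; have sIZ := sqp_time_integral sZ.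
have [mIY cIY bIY] := sIY; have [mIZ cIZ bIZ] := sIZ.
have parts w : time_integral (fun s => Y s w) t * time_integral (fun s => Z s w) t =
   time_integral (fun s => Y s w * time_integral (fun r => Z r w) s +
     time_integral (fun r => Y r w) s * Z s w) t.
  have := @time_integral_by_parts R (fun s => Y s w) (fun s => Z s w)
    (fun t => time_integral (fun s => Y s w) t)
    (fun t => time_integral (fun s => Z s w) t) t (cY w) (cZ w) (cIY w) (cIZ w)
    (fun s h => @is_derive_time_integral R _ s (cY w) h)
    (fun s h => @is_derive_time_integral R _ s (cZ w) h) t0.
  rewrite !time_integral0 mulr0 subr0 => <-.
  by rewrite time_integralD//; apply: cont_integrable_from0; exact: continuousM_fun.
under eq_fun do rewrite parts.
have [||||_ ->] := @ev_time_integral _ _ _ P (fun s w =>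
     Y s w * time_integral (fun r => Z r w) s +
     time_integral (fun r => Y r w) s * Z s w) t.
- by apply: jointly_measurableD; exact: jointly_measurableM.
- by move=> w; apply: continuousD_fun; exact: continuousM_fun.
- have [C _ hC] := bY t; have [D _ hD] := bZ t.
  have [C' _ hC'] := bIY t; have [D' _ hD'] := bIZ t.
  exists ((C + D') + (C' + D)) => s st.
  have [sYs YC] := hC s st; have [sZs ZC] := hD s st.
  have [sYs' YC'] := hC' s st; have [sZs' ZC'] := hD' s st.
  have i1 := square_integrableM sYs sZs'; have i2 := square_integrableM sYs' sZs.
  split; first exact: integrable_rvD.
  apply: (@le_trans _ _ (ev (fun w => `|Y s w * time_integral (fun r => Z r w) s|) +
      ev (fun w => `|time_integral (fun r => Y r w) s * Z s w|))).
    rewrite -evD; [|exact: integrable_rv_norm..].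
    apply: ler_ev => [||w]; last exact: ler_normD.
      exact/integrable_rv_norm/integrable_rvD.
    by apply: integrable_rvD; exact: integrable_rv_norm.
  by apply: lerD; [apply: le_trans (ev_mul_le _ _) _|apply: le_trans (ev_mul_le _ _) _] => //;
    rewrite lerD.
- exact: t0.
apply: eq_time_integral => s /andP[s0 _]; rewrite evD//.
  exact: (square_integrableM (sqp_section sY s0) (sqp_section sIZ s0)).
exact: (square_integrableM (sqp_section sIY s0) (sqp_section sZ s0)).
Qed.

End SquareIntegrableProcess.

(** * The covariance equation of a linear system *)

Section LinearSystem.
Context (R : realType) (d : measure_display) (Omega : measurableType d).
Context (P : probability Omega R) (I : finType).
Variables (a : I -> I -> R -> R) (Z G : I -> R -> Omega -> R).
Variable q : I -> I -> R -> R.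
Local Notation ev := (ev P).
Local Notation sqp := (square_integrable_process P).

Hypothesis ca : forall i j, continuous (a i j).
Hypothesis mZ : forall i, jointly_measurable (Z i).
Hypothesis cZ : forall i w, continuous (fun t => Z i t w).
Hypothesis sG : forall i, sqp (G i).

Let A i t w := \sum_j a i j t * Z j t w.
Let U i t w := time_integral (fun s => A i s w) t.

Hypothesis ZE : forall i t w, 0 <= t -> Z i t w = U i t w + G i t w.
Hypothesis iq : forall i j, integrable_from0 (q i j).
(** The covariance depends on the earlier time only, that is, later increments of the noise are
    uncorrelated with its past. This second-order property stands in for adaptedness and the
    martingale property. *)
Hypothesis GE : forall i j (s t : R), 0 <= s -> s <= t ->
  ev (fun w => G i s w * G j t w) = time_integral (q i j) s.

Let cA i w : continuous (fun t => A i t w).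
Proof. by apply: continuous_sum_fun => j; exact: continuousM_fun. Qed.

Let mA i : jointly_measurable (A i).
Proof.
have m j : jointly_measurable (fun t w => a i j t * Z j t w).
  apply: jointly_measurableM => //.
  exact: (jointly_measurable_time (continuous_measurable (@ca i j))).
exact: (measurable_sum _ m).
Qed.

Let cU i w : continuous (fun t => U i t w).
Proof. exact/continuous_time_integral/cont_integrable_from0. Qed.

Let mU i : jointly_measurable (U i).
Proof. exact: jointly_measurable_time_integral. Qed.

Let bound_a (T : R) : exists2 K, 0 <= K &
  forall i j s, 0 <= s <= T -> `|a i j s| <= K.
Proof.
have /choice[C hC] : forall ij : I * I, exists C, 0 <= C /\
    forall s, 0 <= s <= T -> `|a ij.1 ij.2 s| <= C.
  by move=> ij; have [C C0 h] := continuous_locally_bounded (@ca ij.1 ij.2) T; exists C.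
exists (\sum_ij C ij); first by apply: sumr_ge0 => ij _; have [] := hC ij.
move=> i j s sT; have [_ h] := hC (i, j); apply: (le_trans (h s sT)).
by rewrite (bigD1 (i, j))//= lerDl sumr_ge0// => ij _; have [] := hC ij.
Qed.

Let sum_const (c : R) : \sum_(i in I) c = #|I|%:R * c.
Proof. by rewrite sumr_const mulr_natl. Qed.

(* Pathwise Gronwall: the integral part of the solution is dominated, on
   [0, T], by a multiple of [int_0^T sum_j |G_j|]. *)
Lemma linear_system_integral_bound (T : R) : 0 <= T -> exists2 M, 0 <= M &
  forall i t w, 0 <= t <= T ->
    `|U i t w| <= M * time_integral (fun s => \sum_j `|G j s w|) T.
Proof.
move=> T0; have [K K0 aK] := bound_a T.
pose C := #|I|%:R * K; have C0 : 0 <= C by rewrite mulr_ge0.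
exists (C * expR (C * T)); first by rewrite mulr_ge0// expR_ge0.
move=> i0 t0 w t0T.
pose f t := \sum_i `|U i t w|; pose g t := \sum_j `|G j t w|.
have cG j : continuous (fun t => G j t w) by have [] := sG j.
have cf : continuous f.
  by apply: continuous_sum_fun => i; exact: continuous_norm_fun.
have cg : continuous g.
  by apply: continuous_sum_fun => j; exact: continuous_norm_fun.
have N0 t : 0 <= time_integral g t.
  by apply: time_integral_ge0 => s _; exact: sumr_ge0.
have lf := cont_integrable_from0 cf.
have lg := cont_integrable_from0 cg.
have key t : 0 <= t <= T -> f t <= C * time_integral g T + C * time_integral f t.
  move=> /andP[t_ge0 tT].
  have bnd i : `|U i t w| <= K * (time_integral f t + time_integral g t).
    rewrite -(time_integralD _ lf lg) -time_integralZ; last exact: integrable_from0D.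
    have lA := cont_integrable_from0 (@cA i w).
    apply: (le_trans (ler_norm_time_integral _ lA)).
    apply: ler_time_integral; first exact: integrable_from0_norm.
      exact/integrable_from0Z/integrable_from0D.
    move=> s /andP[s0 st]; apply: (le_trans (ler_norm_sum _ _ _)).
    rewrite -big_split mulr_sumr; apply: ler_sum => j _.
    rewrite normrM ZE// ler_pM//; last exact: ler_normD.
    by rewrite aK// s0 (le_trans st).
  apply: (@le_trans _ _ (\sum_(i in I) K * (time_integral f t + time_integral g t))).
    by apply: ler_sum => i _.
  rewrite sum_const mulrA -/C mulrDr addrC lerD2r ler_wpM2l//.
  apply: ler_time_integral2 => //; last by rewrite t_ge0.
  by move=> x _; exact: sumr_ge0.
have := @gronwall R f (C * time_integral g T) C T cf C0 _ T0 key t0 t0T.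
move=> /(_ (mulr_ge0 C0 (N0 T))) ft.
apply: (@le_trans _ _ (f t0)).
  by rewrite /f (bigD1 i0)//= lerDl sumr_ge0.
apply: (le_trans ft); rewrite mulrAC ler_wpM2r//.
rewrite ler_wpM2l// ler_expR ler_wpM2l//.
by case/andP: t0T.
Qed.

(** No moment of [Z] is known beforehand, so Gronwall cannot be applied to expectations. The
    pathwise bound instead dominates [U] on [0, T] by one square integrable variable built from the
    noise. *)
Lemma sqp_linear_system_integral i : sqp (U i).
Proof.
split=> // T; have [T0|T0] := leP 0 T; last first.
  exists 0 => // t /andP[t0 tT]; move: (le_trans t0 tT).
  by rewrite leNgt T0.
have [M M0 hM] := linear_system_integral_bound T0.
pose N w := time_integral (fun s => \sum_j `|G j s w|) T.
have sN : square_integrable P N.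
  have sGn : sqp (fun s w => \sum_j `|G j s w|).
    by apply: sqp_sum => j; exact: sqp_norm.
  exact: (sqp_section (sqp_time_integral sGn) T0).
have sMN := square_integrableZ M sN.
have iMN := sMN.2.
exists (ev (fun w => (M * N w) ^+ 2)).
  by apply: ev_ge0 => w; exact: sqr_ge0.
move=> t tT; have mUt := jointly_measurable_section t (mU i).
have UN w : U i t w ^+ 2 <= (M * N w) ^+ 2.
  rewrite -real_normK ?num_real// ler_pXn2r ?nnegrE//; first exact: hM.
  by rewrite mulr_ge0//; apply: time_integral_ge0 => s _; exact: sumr_ge0.
have iU : integrable_rv P (fun w => U i t w ^+ 2).
  apply: (le_integrable_rv _ iMN); first exact: measurable_funX.
  by move=> w; rewrite ger0_norm ?sqr_ge0.
by split; [split|exact: ler_ev].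
Qed.

Let sU := sqp_linear_system_integral.

Let ext_sqp (Y Y' : R -> Omega -> R) : jointly_measurable Y' ->
  (forall w, continuous (fun t => Y' t w)) -> sqp Y ->
  (forall t w, 0 <= t -> Y' t w = Y t w) -> sqp Y'.
Proof.
move=> mY' cY' [mY cY bY] YE; split => // T.
have [C C0 hC] := bY T; exists C => // t tT.
have -> : Y' t = Y t by apply/funext => w; apply: YE; case/andP: tT.
exact: hC.
Qed.

Lemma sqp_linear_system i : sqp (Z i).
Proof. by apply: (ext_sqp _ _ (sqpD (sU i) (sG i))) => // t w; exact: ZE. Qed.

Let sZ := sqp_linear_system.

Let sA i : sqp (A i).
Proof. by apply: sqp_sum => j; exact: sqpM. Qed.

Lemma ev_drift i (xi : Omega -> R) t : square_integrable P xi -> 0 <= t ->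
  ev (fun w => A i t w * xi w) =
  \sum_j a i j t * ev (fun w => Z j t w * xi w).
Proof.
move=> sx t0; rewrite -[LHS]/(ev (fun w => (\sum_j a i j t * Z j t w) * xi w)).
under eq_fun do rewrite mulr_suml.
have iZx j : integrable_rv P (fun w => Z j t w * xi w).
  exact: (square_integrableM (sqp_section (sZ j) t0) sx).
rewrite ev_sum.
  by apply: eq_bigr => j _; rewrite -evZ//; congr ev; apply/funext => w; rewrite mulrA.
by move=> j; under eq_fun do rewrite -mulrA; exact: integrable_rvZ.
Qed.

(* The correlations of the solution up to time s with a later increment of the
   noise solve a homogeneous linear integral equation, hence vanish. *)
Lemma linear_system_nonanticipative i l (s t : R) : 0 <= s -> s <= t ->
  ev (fun w => Z i s w * G l t w) = ev (fun w => Z i s w * G l s w).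
Proof.
move=> s0 st; have t0 := le_trans s0 st.
have sGs := sqp_section (sG l) s0.
have sGt := sqp_section (sG l) t0.
pose xi w := G l t w + - 1 * G l s w.
have sx : square_integrable P xi.
  exact/square_integrableD/square_integrableZ.
pose phi j r := ev (fun w => A j r w * xi w).
pose k j r := time_integral (phi j) r.
have lphi j : integrable_from0 (phi j).
  exact: (covariance_integrable_from0 (sA j) (sqp_cst sx)).
have ck j : continuous (k j) by exact: continuous_time_integral.
have evG j r : 0 <= r <= s -> ev (fun w => G j r w * xi w) = 0.
  move=> /andP[r0 rs]; have sGr := sqp_section (sG j) r0.
  under eq_fun do rewrite mulrDr mulrCA.
  have i1 := square_integrableM sGr sGt; have i2 := square_integrableM sGr sGs.
  rewrite evD ?evZ//; last exact: integrable_rvZ.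
  by rewrite !GE// ?(le_trans rs)// mulN1r subrr.
have kE j r : 0 <= r -> ev (fun w => U j r w * xi w) = k j r.
  by move=> r0; exact: (ev_time_integralM (sA j) sx r0).
have ZkE j r : 0 <= r <= s -> ev (fun w => Z j r w * xi w) = k j r.
  move=> rs; have /andP[r0 _] := rs.
  under eq_fun do rewrite ZE// mulrDl.
  have i1 := square_integrableM (sqp_section (sU j) r0) sx.
  have i2 := square_integrableM (sqp_section (sG j) r0) sx.
  by rewrite evD// kE// evG// addr0.
have [K K0 aK] := bound_a s.
pose f r := \sum_j `|k j r|.
have cf : continuous f.
  by apply: continuous_sum_fun => j; exact: continuous_norm_fun.
have lf := cont_integrable_from0 cf.
pose C := #|I|%:R * K; have C0 : 0 <= C by rewrite mulr_ge0.
have key r : 0 <= r <= s -> f r <= 0 + C * time_integral f r.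
  move=> /andP[r0 rs]; rewrite add0r.
  apply: (@le_trans _ _ (\sum_(j in I) K * time_integral f r)); last first.
    by rewrite sum_const mulrA.
  apply: ler_sum => j _; rewrite -time_integralZ//.
  apply: (le_trans (ler_norm_time_integral _ (lphi j))).
  apply: ler_time_integral; [exact: integrable_from0_norm|exact: integrable_from0Z|].
  move=> x /andP[x0 xr]; have xs : 0 <= x <= s by rewrite x0 (le_trans xr).
  rewrite /phi ev_drift//; apply: (le_trans (ler_norm_sum _ _ _)).
  rewrite mulr_sumr; apply: ler_sum => m _.
  by rewrite normrM ZkE// ler_wpM2r// aK.
have fs : f s <= 0.
  have := @gronwall R f 0 C s cf C0 (lexx 0) s0 key s.
  by rewrite s0 lexx mul0r; apply.
have ki : k i s = 0.
  apply/eqP; rewrite -normr_le0; apply: le_trans fs.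
  by rewrite /f (bigD1 i)//= lerDl sumr_ge0.
have sZs := sqp_section (sZ i) s0.
have e : ev (fun w => Z i s w * xi w) = 0 by rewrite ZkE ?s0 ?lexx.
have i1 := square_integrableM sZs sGt; have i2 := square_integrableM sZs sGs.
move: e; under eq_fun do rewrite mulrDr mulrCA.
rewrite evD ?evZ//; last exact: integrable_rvZ.
by rewrite mulN1r => /eqP; rewrite subr_eq0 => /eqP.
Qed.

Let S i j t := ev (fun w => Z i t w * Z j t w).

(** Ito's product rule in expectation. Expand (U_i + G_i) (U_j + G_j): the first term is
    differentiated path by path, the mixed terms are brought to equal times by
    [linear_system_nonanticipative], and the pure noise term contributes q. At each time s the
    pieces reassemble by Z = U + G. *)
Lemma linear_system_covariance i j t : 0 <= t ->
  S i j t = time_integral (fun s =>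
    \sum_k a i k s * S k j s + \sum_k a j k s * S i k s + q i j s) t.
Proof.
move=> t0.
have comm (f g : Omega -> R) : (fun w => f w * g w) = fun w => g w * f w.
  by apply/funext => w; rewrite mulrC.
have L2 Y s : sqp Y -> 0 <= s -> square_integrable P (Y s).
  by move=> ? ?; exact: sqp_section.
have driftG m l s : 0 <= s -> s <= t ->
    ev (fun w => A m s w * G l t w) = ev (fun w => A m s w * G l s w).
  move=> s0 st; rewrite !ev_drift//; [|exact: L2..].
  by apply: eq_bigr => k _; rewrite linear_system_nonanticipative.
have UG m l : ev (fun w => U m t w * G l t w) =
    time_integral (fun s => ev (fun w => A m s w * G l s w)) t.
  rewrite (ev_time_integralM (sA m) (L2 _ _ (sG l) t0) t0).
  by apply: eq_time_integral => s /andP[s0 st]; exact: driftG.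
have i1 := square_integrableM (L2 _ _ (sU i) t0) (L2 _ _ (sU j) t0).
have i2 := square_integrableM (L2 _ _ (sU i) t0) (L2 _ _ (sG j) t0).
have i3 := square_integrableM (L2 _ _ (sU j) t0) (L2 _ _ (sG i) t0).
have i4 := square_integrableM (L2 _ _ (sG i) t0) (L2 _ _ (sG j) t0).
have -> : S i j t = ev (fun w => U i t w * U j t w) + ev (fun w => U i t w * G j t w) +
    ev (fun w => U j t w * G i t w) + ev (fun w => G i t w * G j t w).
  have i12 := integrable_rvD i1 i2; have i123 := integrable_rvD i12 i3.
  rewrite -(evD i1 i2) -(evD i12 i3) -(evD i123 i4).
  by congr ev; apply/funext => w; rewrite !ZE//; ring.
rewrite !UG GE// (ev_time_integral_mul (sA i) (sA j) t0).
have l1 := covariance_integrable_from0 (sA i) (sU j).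
have l2 := covariance_integrable_from0 (sU i) (sA j).
have l3 := covariance_integrable_from0 (sA i) (sG j).
have l4 := covariance_integrable_from0 (sA j) (sG i).
have l12 := integrable_from0D l1 l2; have l123 := integrable_from0D l12 l3.
have l1234 := integrable_from0D l123 l4.
rewrite -(time_integralD _ l12 l3) -(time_integralD _ l123 l4).
rewrite -(time_integralD _ l1234 (iq i j)).
apply: eq_time_integral => s /andP[s0 st].
have sZs m := L2 _ _ (sZ m) s0.
have -> : \sum_k a i k s * S k j s = ev (fun w => A i s w * U j s w) +
    ev (fun w => A i s w * G j s w).
  rewrite -ev_drift// -evD; [|exact: (square_integrableM (L2 _ _ (sA _) s0) (L2 _ _ (sU _) s0))|exact: (square_integrableM (L2 _ _ (sA _) s0) (L2 _ _ (sG _) s0))].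
  by congr ev; apply/funext => w; rewrite ZE// mulrDr.
have -> : \sum_k a j k s * S i k s = ev (fun w => U i s w * A j s w) +
    ev (fun w => A j s w * G i s w).
  transitivity (\sum_k a j k s * ev (fun w => Z k s w * Z i s w)).
    by apply: eq_bigr => k _; rewrite /S comm.
  rewrite -ev_drift// -evD; [|exact: (square_integrableM (L2 _ _ (sU _) s0) (L2 _ _ (sA _) s0))|exact: (square_integrableM (L2 _ _ (sA _) s0) (L2 _ _ (sG _) s0))].
  by congr ev; apply/funext => w; rewrite ZE// mulrDr mulrC.
ring.
Qed.

End LinearSystem.

(** * Moments of Brownian motion *)

Section Density.
Local Open Scope ereal_scope.
Context (d : measure_display) (T : measurableType d) (R : realType).
Variables (mu nu : {measure set T -> \bar R}) (p : T -> R).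
Hypothesis mp : measurable_fun [set: T] p.
Hypothesis p0 : forall x, (0 <= p x)%R.
Hypothesis nuE : forall A, measurable A -> nu A = \int[mu]_(x in A) (p x)%:E.

Import HBNNSimple.

Let integral_density_nnsfun (f : {nnsfun T >-> R}) :
  \int[nu]_x (f x)%:E = \int[mu]_x ((f x)%:E * (p x)%:E).
Proof.
under [LHS]eq_integral do rewrite fimfunE -fsumEFin//.
rewrite [LHS]ge0_integral_fsum//; last 2 first.
  - by move=> r; exact/measurable_EFinP/measurableT_comp.
  - by move=> n x _; rewrite EFinM nnfun_muleindic_ge0.
under [RHS]eq_integral.
  move=> x xD; rewrite fimfunE -fsumEFin// ge0_mule_fsuml; last first.
    by move=> r; rewrite EFinM nnfun_muleindic_ge0.
  over.
have mp' : measurable_fun setT (EFin \o p) by exact/measurable_EFinP.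
rewrite [RHS]ge0_integral_fsum//; last 2 first.
  - move=> r; apply: emeasurable_funM => //.
    by apply/measurable_EFinP; do 2 apply/measurableT_comp => //.
  - by move=> n x _; apply: mule_ge0; [rewrite EFinM nnfun_muleindic_ge0|rewrite lee_fin].
apply: eq_fsbigr => r _.
rewrite integralZl_indic_nnsfun//= integral_indic//= setIT nuE//.
rewrite integral_mkcond/=.
(* The finitely supported sum ranges over all reals r; a negative r is not a value of [f], and both
   sides are then 0. *)
have [r0|r0] := leP 0%R r; last first.
  have f0 : f @^-1` [set r] = set0.
    by apply/seteqP; split => // x /= fx; have : (0 <= f x)%R by []; rewrite fx leNgt r0.
  rewrite f0 integral0_eq ?mule0; last by move=> x _; rewrite patchE in_set0.
  by rewrite integral0_eq// => x _; rewrite indic0 mulr0 mul0e.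
rewrite -ge0_integralZl//.
- apply: eq_integral => x _; rewrite patchE indicE.
  by case: (x \in _); rewrite /= ?mulr1 ?mulr0 ?mul0e ?mule0.
- apply/(measurable_restrictT _ _).1 => //; exact: measurable_funTS.
- by move=> x _; apply: erestrict_ge0 => y _; rewrite lee_fin.
Qed.

(** From simple functions to nonnegative ones by monotone convergence on both sides. *)
Lemma ge0_integral_density (f : T -> \bar R) :
  measurable_fun [set: T] f -> (forall x, 0 <= f x) ->
  \int[nu]_x f x = \int[mu]_x (f x * (p x)%:E).
Proof.
move=> mf f0; pose f_ := nnsfun_approx measurableT mf.
have mp' : measurable_fun setT (EFin \o p) by exact/measurable_EFinP.
transitivity (lim (\int[nu]_x (f_ n x)%:E @[n --> \oo])).
  rewrite -monotone_convergence//=.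
  - apply: eq_integral => ? /[!inE] xD; apply/esym/cvg_lim => //=.
    exact: cvg_nnsfun_approx.
  - by move=> n; exact/measurable_EFinP/measurable_funTS.
  - by move=> n ? _; rewrite lee_fin.
  - by move=> ? _ ? ? mn; rewrite lee_fin; exact/lefP/nd_nnsfun_approx.
rewrite [RHS](_ : _ = lim (\int[mu]_x ((f_ n x)%:E * (p x)%:E) @[n --> \oo])).
  by apply: congr_lim; apply/funext => n; exact: integral_density_nnsfun.
rewrite -monotone_convergence//=.
- apply: eq_integral => x _; apply/esym/cvg_lim => //.
  apply: cvgeZr => //; exact: cvg_nnsfun_approx.
- by move=> n; apply: emeasurable_funM => //; exact/measurable_EFinP/measurable_funTS.
- by move=> n x _; rewrite mule_ge0 ?lee_fin.
- move=> x _ m n mn; rewrite lee_wpmul2r ?lee_fin//.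
  exact/lefP/nd_nnsfun_approx.
Qed.

End Density.


(** * Second moment of the centred normal law *)

Section NormalSecondMoment.
Context (R : realType) (sigma : R).
Hypothesis sigma_gt0 : 0 < sigma.
Local Notation mu := (@lebesgue_measure R).
Let p := normal_pdf 0 sigma.
Let f x := x ^+ 2 * p x.

Let s0 : sigma != 0. Proof. exact: lt0r_neq0. Qed.

Let pE x : p x = normal_peak sigma * expR (- x ^+ 2 / (sigma ^+ 2 *+ 2)).
Proof. by rewrite /p normal_pdfE// /normal_fun subr0. Qed.

Let cp : continuous p. Proof. exact: continuous_normal_pdf. Qed.

Let cf : continuous f.
Proof. by apply: continuousM_fun cp; exact/continuousX_fun/continuous_id_fun. Qed.

Let p0 x : 0 <= p x. Proof. exact: normal_pdf_ge0. Qed.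

Let f0 x : 0 <= f x. Proof. by rewrite mulr_ge0// sqr_ge0. Qed.

Let half : [set x : R | 0 <= x] = [set` `[0, +oo[].
Proof. by apply/seteqP; split => x/=; rewrite in_itv/= andbT. Qed.

Let int_p : (\int[mu]_(x in `[0%R, +oo[) (p x)%:E = (2^-1)%:E)%E.
Proof.
have := @ge0_symfun_integralT R p p0 cp.
have pN : p =1 p \o -%R by move=> x; rewrite /= !pE sqrrN.
rewrite integral_normal_pdf half => /(_ pN).
set I := (X in (_ * X)%E) => /esym e.
have : (I \is a fin_num)%E.
  rewrite ge0_fin_numE; last by apply: integral_ge0 => x _; rewrite lee_fin.
  rewrite ltey; apply/negP => /eqP Iy; move: e; rewrite Iy.
  by rewrite mulry gtr0_sg// mul1e.
move=> /fineK Ie; move: e; rewrite -Ie -EFinM => -[] e.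
by rewrite -/I -Ie; congr (_%:E); lra.
Qed.

(** From p' = - x p / sigma^2, the derivative of - sigma^2 x p is x^2 p - sigma^2 p. *)
Let by_parts (n : R) : 0 <= n -> time_integral f n =
  sigma ^+ 2 * time_integral p n - sigma ^+ 2 * (n * p n).
Proof.
move=> n0; have d (x : R) : is_derive x 1 p (- x / sigma ^+ 2 * p x).
  have -> : p = fun x => normal_peak sigma * expR (- x ^+ 2 / (sigma ^+ 2 *+ 2)).
    by apply/funext => y; exact: pE.
  by apply: is_derive_eq; rewrite /GRing.scale/=; field.
have cfp : continuous (fun x : R => f x - sigma ^+ 2 * p x).
  apply: continuousD_fun => //; apply: continuousN_fun.
  exact: continuousZ_fun.
have cF : continuous (fun x : R => - sigma ^+ 2 * (x * p x)).
  apply: continuousM_fun; first exact: continuous_cst_fun.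
  by apply: continuousM_fun => //; exact: continuous_id_fun.
have dF (x : R) : 0 < x -> is_derive x 1 (fun x : R => - sigma ^+ 2 * (x * p x))
    (f x - sigma ^+ 2 * p x).
  by move=> _; have dx := d x; apply: is_derive_eq; rewrite /GRing.scale/= /f; field.
have lf := cont_integrable_from0 cf; have lp := cont_integrable_from0 cp.
have := time_integral_FTC cF cfp dF n0.
rewrite (time_integralB _ lf (integrable_from0Z _ lp)) (time_integralZ _ _ lp).
by rewrite mul0r mulr0 subr0 mulNr => /eqP; rewrite subr_eq addrC => /eqP.
Qed.

Let cvg_tail : (fun n : nat => n%:R * p n%:R) @ \oo --> (0 : R).
Proof.
(* The bound exp y >= y at y = n^2 / (2 sigma^2) turns n p(n) into at most c / n. *)
pose c := normal_peak sigma * (sigma ^+ 2 *+ 2).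
have s2 : 0 < sigma ^+ 2 *+ 2 by rewrite mulrn_wgt0// exprn_gt0.
have h : (fun n : nat => c * n%:R^-1) @ \oo --> (0 : R).
  rewrite -(mulr0 c); apply: cvgM; first exact: cvg_cst.
  by apply/gtr0_cvgV0; [near=> n; rewrite ltr0n; near: n; exact: nbhs_infty_gt|exact: cvgr_idn].
apply: (squeeze_cvgr _ _ h); last exact: (cvg_cst (0 : R)).
near=> n; have n0 : (0 < n%:R :> R) by rewrite ltr0n; near: n; exact: nbhs_infty_gt.
rewrite mulr_ge0 ?ler0n//= pE /c mulNr expRN.
rewrite ler_pdivlMr// mulrCA -!mulrA ler_wpM2l ?normal_peak_ge0//.
rewrite mulrCA ler_pdivrMl ?expR_gt0// -expr2.
rewrite -ler_pdivrMr//; apply: le_trans (expR_ge1Dx _).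
by rewrite mulrA -expr2 lerDr.
Unshelve. all: by end_near. Qed.

Lemma integral_sqr_normal_pdf :
  (\int[mu]_x ((x ^+ 2)%:E * (normal_pdf 0 sigma x)%:E) = (sigma ^+ 2)%:E)%E.
Proof.
under eq_integral do rewrite -EFinM.
rewrite (@ge0_symfun_integralT R f)//; last first.
  by move=> x; rewrite /f /= sqrrN !pE sqrrN.
rewrite half.
have h1 : (fun n : nat => time_integral p n%:R) @ \oo --> (2^-1 : R).
  have := @ge0_cvgn_integral R mu p p0 (measurable_normal_pdf 0 sigma).
  rewrite int_p => /fine_cvg; apply: cvg_trans.
  by apply: near_eq_cvg; apply: nearW => n.
have h2 : (fun n : nat => time_integral f n%:R) @ \oo --> (sigma ^+ 2 * 2^-1 : R).
  rewrite -[X in _ --> X]subr0 -[X in _ - X](mulr0 (sigma ^+ 2)).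
  under eq_fun do rewrite by_parts//.
  by apply: cvgB; apply: cvgM => //; exact: cvg_cst.
have mf : measurable_fun setT f by exact: continuous_measurable.
have := @ge0_cvgn_integral R mu f f0 mf.
have e : (fun n : nat => (\int[mu]_(x in `[0%R, n%:R]) (f x)%:E)%E) =
    EFin \o (fun n : nat => time_integral f n%:R).
  apply/funext => n; rewrite /= /time_integral /Rintegral fineK//.
  exact/integrable_fin_num/cont_integrable_from0.
rewrite e => /cvg_lim <-//.
have /cvg_lim -> // : (EFin \o (fun n : nat => time_integral f n%:R)) @ \oo -->
    (sigma ^+ 2 * 2^-1)%:E by apply: cvg_EFin => //; apply: nearW.
by rewrite -EFinM; congr EFin; lra.
Qed.

End NormalSecondMoment.

Section Laws.
Context (R : realType) (d : measure_display) (Omega : measurableType d).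
Context (P : probability Omega R).
Implicit Types (X Y U V : Omega -> R).
Local Notation ev := (ev P).

Lemma ae_square_integrable X Y : measurable_fun setT X ->
  square_integrable P Y -> {ae P, forall w, X w = Y w} -> square_integrable P X.
Proof.
move=> mX [mY iY] XY; split => //.
have mX2 : measurable_fun setT (fun w => X w ^+ 2) by exact: measurable_funX.
apply/integrableP; split; first exact/measurable_EFinP.
move/integrableP : iY => [mY2]; apply: le_lt_trans.
rewrite le_eqVlt; apply/orP; left; apply/eqP.
apply: ge0_ae_eq_integral => //.
- by apply: measurableT_comp => //; exact/measurable_EFinP.
- exact: measurableT_comp.
by move: XY; apply: filterS => w /= XYw _; rewrite XYw.
Qed.

Lemma ae_ev X Y : measurable_fun setT X -> measurable_fun setT Y ->
  {ae P, forall w, X w = Y w} -> ev X = ev Y.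
Proof.
move=> mX mY XY; congr fine; apply: ae_eq_integral => //.
- exact/measurable_EFinP.
- exact/measurable_EFinP.
by move: XY; apply: filterS => w /= XYw _; rewrite XYw.
Qed.

Let mfun_of d' (T : measurableType d') (X : Omega -> T)
  (mX : measurable_fun setT X) : {mfun Omega >-> T} :=
  HB.pack X (isMeasurableFun.Build _ _ _ _ X mX).

Lemma normal_law_second_moment X (sigma : R) : 0 < sigma ->
  measurable_fun setT X ->
  (forall B, measurable B -> P [set w | B (X w)] = normal_prob 0 sigma B) ->
  square_integrable P X /\ ev (fun w => X w ^+ 2) = sigma ^+ 2.
Proof.
move=> s0 mX law.
have h : (\int[P]_w (X w ^+ 2)%:E = (sigma ^+ 2)%:E)%E.
  pose DX := distribution P (@mfun_of _ (measurableTypeR R) X mX).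
  have mf : measurable_fun setT (fun x : measurableTypeR R => (x ^+ 2)%:E).
    exact/measurable_EFinP/measurable_funX.
  have f0 (x : measurableTypeR R) : (0 <= (x ^+ 2)%:E)%E by rewrite lee_fin sqr_ge0.
  rewrite -(integral_sqr_normal_pdf s0).
  rewrite -[RHS](@ge0_integral_density _ _ R lebesgue_measure DX)//.
  - by rewrite ge0_integral_distribution.
  - exact: measurable_normal_pdf.
  - by move=> x; exact: normal_pdf_ge0.
split; last by rewrite /ev /Rintegral h.
split => //; apply/integrableP; split.
  exact/measurable_EFinP/measurable_funX.
under eq_integral do rewrite /= ger0_norm ?sqr_ge0//.
by rewrite h ltry.
Qed.

Lemma ev_same_law X Y : measurable_fun setT X -> measurable_fun setT Y ->
  integrable_rv P X -> integrable_rv P Y ->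
  (forall B, measurable B -> P [set w | B (X w)] = P [set w | B (Y w)]) ->
  ev X = ev Y.
Proof.
move=> mX mY iX iY law; congr fine.
have <- := @integral_distribution _ _ _ _ _ P (mfun_of mX) EFin.
- have <- := @integral_distribution _ _ _ _ _ P (mfun_of mY) EFin.
  + by apply: eq_measure_integral => A mA _; exact: law.
  + exact/measurable_EFinP.
  + exact: iY.
- exact/measurable_EFinP.
- exact: iX.
Qed.

(** Agreement on rectangles makes the law of (U, V) the product of the marginal laws; in the
    iterated integral of x y the inner one is x times the mean of V, which is 0. *)
Lemma ev_independent_centered U V : square_integrable P U ->
  square_integrable P V ->
  (forall A B, measurable A -> measurable B ->
    P ([set w | A (U w)] `&` [set w | B (V w)]) =
    (P [set w | A (U w)] * P [set w | B (V w)])%E) ->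
  ev V = 0 -> ev (fun w => U w * V w) = 0.
Proof.
move=> sU sV ind V0; have [mU _] := sU; have [mV _] := sV.
have mUV : measurable_fun setT (fun w => (U w, V w)) by exact: measurable_fun_pair.
pose DU := distribution P (mfun_of mU); pose DV := distribution P (mfun_of mV).
pose DUV := distribution P (mfun_of mUV).
pose f (z : R * R) := (z.1 * z.2)%:E.
have mf : measurable_fun setT f.
  apply/measurable_EFinP; apply: measurable_funM.
    exact: measurable_fst.
  exact: measurable_snd.
have iUV := square_integrableM sU sV.
have prodE A : measurable A -> (DU \x DV)%E A = DUV A.
  apply: product_measure_unique => A1 A2 mA1 mA2.
  exact: ind.
have e1 : (\int[P]_w (U w * V w)%:E = \int[DUV]_z f z)%E.
  by rewrite integral_distribution.
have e2 : (\int[DUV]_z f z = \int[(DU \x DV)%E]_z f z)%E.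
  by apply: eq_measure_integral => A mA _; apply/esym; exact: prodE.
have iD : (DU \x DV)%E.-integrable setT f.
  apply/integrableP; split => //.
  rewrite (_ : (\int[(DU \x DV)%E]_z `|f z|)%E = \int[DUV]_z `|f z|)%E; last first.
    by apply: eq_measure_integral => A mA _; exact: prodE.
  rewrite ge0_integral_distribution//; last exact: measurableT_comp.
  by move/integrableP : iUV => [].
have iV := square_integrable_integrable sV.
have evV : (\int[DV]_y y%:E = 0)%E.
  rewrite integral_distribution//.
  by rewrite -[RHS]/(0%R%:E) -V0 /ev /Rintegral fineK// integrable_fin_num.
have iDV : DV.-integrable setT (EFin : R -> \bar R).
  exact: (@integrable_pushforward _ _ _ _ _ _ mV P setT).
rewrite /ev /Rintegral e1 e2 -integral12_prod_meas1//.
rewrite integral0_eq// => x _.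
transitivity (x%:E * \int[DV]_y y%:E)%E; last by rewrite evV mule0.
by rewrite -integralZl.
Qed.

End Laws.

(** * Mean and covariance of Brownian motion *)

Section BrownianMoments.
Context (R : realType) (d : measure_display) (Omega : measurableType d).
Context (P : probability Omega R).
Implicit Types (W : R -> Omega -> R) (s t : R).
Local Notation ev := (ev P).

Section OneBrownianMotion.
Variable W : R -> Omega -> R.
Hypothesis bW : standard_brownian_motion P W.

Let mW t : 0 <= t -> measurable_fun setT (W t).
Proof. by have [h _ _ _ _] := bW; exact: h. Qed.

Let mincr s t : 0 <= s -> s <= t -> measurable_fun setT (fun w => W t w - W s w).
Proof.
by move=> s0 st; apply: measurable_funB; apply: mW => //; exact: le_trans st.
Qed.

Lemma brownian_increment_moment s t : 0 <= s -> s <= t ->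
  square_integrable P (fun w => W t w - W s w) /\
  ev (fun w => (W t w - W s w) ^+ 2) = t - s.
Proof.
move=> s0; rewrite le_eqVlt => /predU1P[<-|st].
  under eq_fun do rewrite subrr; split; first exact: square_integrable_cst.
  by under eq_fun do rewrite subrr expr0n; rewrite ev_cst subrr.
have [_ _ _ law _] := bW.
have ts : 0 < t - s by rewrite subr_gt0.
have [] := @normal_law_second_moment R d Omega P (fun w => W t w - W s w)
  (Num.sqrt (t - s)).
- by rewrite sqrtr_gt0.
- exact/mincr/ltW.
- by move=> B mB; exact: law.
by rewrite sqr_sqrtr ?ltW.
Qed.

Let incr_int s t : 0 <= s -> s <= t -> integrable_rv P (fun w => W t w - W s w).
Proof.
move=> s0 st; apply: square_integrable_integrable.
by have [] := brownian_increment_moment s0 st.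
Qed.

(** Consecutive increments of length t share one law, hence one mean, and they telescope. *)
Lemma ev_brownian_increment_nat t (n : nat) : 0 <= t ->
  ev (fun w => W (n%:R * t) w - W 0 w) = n%:R * ev (fun w => W t w - W 0 w).
Proof.
rewrite le_eqVlt => /predU1P[<-|t0].
  by rewrite mulr0; under eq_fun do rewrite subrr; rewrite ev_cst mulr0.
have [_ _ _ law _] := bW.
elim: n => [|n IH].
  by rewrite !mul0r; under eq_fun do rewrite subrr; rewrite ev_cst.
have nt0 : 0 <= n%:R * t by rewrite mulr_ge0// ltW.
have ntS : n%:R * t < n.+1%:R * t by rewrite ltr_pM2r// ltr_nat.
have e : ev (fun w => W (n.+1%:R * t) w - W (n%:R * t) w) =
    ev (fun w => W t w - W 0 w).
  apply: ev_same_law.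
  - exact/mincr/ltW.
  - exact/mincr/ltW.
  - exact/incr_int/ltW.
  - exact/incr_int/ltW.
  move=> B mB; rewrite (law _ _ B nt0 ntS mB) (law _ _ B (lexx 0) t0 mB).
  have e0 : n.+1%:R * t - n%:R * t = t - 0 by rewrite -addn1 natrD; ring.
  by rewrite e0.
rewrite -[in RHS]addn1 natrD mulrDl mul1r -IH -[in RHS]e -evD.
- by congr ev; apply/funext => w; ring.
- exact: incr_int.
- exact/incr_int/ltW.
Qed.

(* The mean of [W_t - W_0] is additive in t, while its square is at most t. *)
Lemma ev_brownian_increment t : 0 <= t -> ev (fun w => W t w - W 0 w) = 0.
Proof.
move=> t0; set m := ev _.
have bound (n : nat) : (0 < n)%N -> n%:R * m ^+ 2 <= t.
  move=> n0; have nt0 : 0 <= n%:R * t by rewrite mulr_ge0.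
  have [sq e] := brownian_increment_moment (lexx 0) nt0.
  have := @ev_ge0 _ _ _ P (fun w => (W (n%:R * t) w - W 0 w - n%:R * m) ^+ 2)
    (fun w => sqr_ge0 _).
  have -> : (fun w => (W (n%:R * t) w - W 0 w - n%:R * m) ^+ 2) =
      fun w => (W (n%:R * t) w - W 0 w) ^+ 2 +
        ((- 2 * (n%:R * m)) * (W (n%:R * t) w - W 0 w) + (n%:R * m) ^+ 2).
    by apply/funext => w; ring.
  have i1 := incr_int (lexx 0) nt0.
  have i2 := integrable_rvZ (- 2 * (n%:R * m)) i1.
  have i3 := @integrable_rv_cst _ _ _ P ((n%:R * m) ^+ 2).
  rewrite (evD sq.2 (integrable_rvD i2 i3)) (evD i2 i3) (evZ _ i1) ev_cst e.
  rewrite ev_brownian_increment_nat// -/m subr0 => h.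
  have n1 : 0 < n%:R :> R by rewrite ltr0n.
  rewrite -(ler_pM2l n1); move: h; rewrite exprMn; lra.
apply/eqP; rewrite -sqrf_eq0; apply/eqP/le_anti; rewrite sqr_ge0 andbT leNgt.
apply/negP => m0.
have := bound (Num.trunc (t / m ^+ 2)).+1 isT.
by rewrite leNgt -ltr_pdivrMr// truncnS_gt.
Qed.

(** The covariance comes from polarizing E[(W_t - W_s)^2] = t - s. Since W_0 vanishes only almost
    surely, the moments of W_t are transported from those of W_t - W_0. *)
Lemma brownian_moments : [/\ forall t, 0 <= t -> square_integrable P (W t),
  forall t, 0 <= t -> ev (W t) = 0
  & forall s t, 0 <= s -> s <= t -> ev (fun w => W s w * W t w) = s].
Proof.
have [_ W0 _ _ _] := bW.
have ae t : {ae P, forall w, W t w = W t w - W 0 w}.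
  by move: W0; apply: filterS => w ->; rewrite subr0.
have sq t : 0 <= t -> square_integrable P (W t).
  move=> t0; have [h _] := brownian_increment_moment (lexx 0) t0.
  exact: (ae_square_integrable (mW t0) h (ae t)).
have ev2 t : 0 <= t -> ev (fun w => W t w ^+ 2) = t.
  move=> t0; have [[m i] e] := brownian_increment_moment (lexx 0) t0.
  rewrite -[RHS]subr0 -e; apply: ae_ev.
  - exact/measurable_funX/mW.
  - exact/measurable_funX.
  by move: (ae t); apply: filterS => w <-.
split => // [t t0|s t s0 st].
  rewrite -(ev_brownian_increment t0); apply: ae_ev => //; first exact: mW.
  exact: mincr.
have t0 := le_trans s0 st.
have [_] := brownian_increment_moment s0 st.
have -> : (fun w => (W t w - W s w) ^+ 2) =
    fun w => W t w ^+ 2 + ((- 2) * (W s w * W t w) + W s w ^+ 2).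
  by apply/funext => w; ring.
have i1 := square_integrableM (sq s s0) (sq t t0).
rewrite (evD (sq t t0).2 (integrable_rvD (integrable_rvZ (- 2) i1) (sq s s0).2)).
rewrite (evD (integrable_rvZ (- 2) i1) (sq s s0).2) (evZ _ i1) !ev2//.
lra.
Qed.

End OneBrownianMotion.

Lemma ev_independent_brownian V W s t : standard_brownian_motion P V ->
  standard_brownian_motion P W -> independent_processes P V W ->
  0 <= s -> 0 <= t -> ev (fun w => V s w * W t w) = 0.
Proof.
move=> bV bW ind s0 t0.
have [sqV _ _] := brownian_moments bV; have [sqW mW _] := brownian_moments bW.
apply: ev_independent_centered (sqV s s0) (sqW t t0) _ (mW t t0) => A B mA mB.
have := ind 1%N 1%N (fun=> s) (fun=> t) (fun=> A) (fun=> B)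
  (fun=> s0) (fun=> t0) (fun=> mA) (fun=> mB).
have e (C : set R) (x : Omega -> R) :
    [set w | 'I_1 -> C (x w)] = [set w | C (x w)].
  by apply/seteqP; split => w /=; [apply; exact: ord0|].
by rewrite !e.
Qed.

End BrownianMoments.

(** * Ito integrals of smooth deterministic integrands *)

Section WienerIntegral.
Context (R : realType).
Implicit Types (f g h H K V : R -> R) (s t u : R).
Local Notation mu := (@lebesgue_measure R).

(* The Ito integral of a continuously differentiable deterministic [H], with
   derivative [H'], against a continuous path [V] started at 0, written by
   parts. *)
Definition wiener H (H' : R -> R) V t := H t * V t - time_integral (fun s => H' s * V s) t.

Lemma ler_time_integral_increment f g u t : continuous f -> continuous g ->
  0 <= u -> u <= t -> (forall s, u <= s <= t -> `|f s| <= g s) ->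
  `|time_integral f t - time_integral f u| <=
  time_integral g t - time_integral g u.
Proof.
move=> cf cg u0 ut fg; have utb : 0 <= u <= t by rewrite u0.
have lf := cont_integrable_from0 cf; have lg := cont_integrable_from0 cg.
rewrite (time_integral_split lf utb) (time_integral_split lg utb).
rewrite [_ + _ - _]addrAC subrr add0r [X in _ <= X]addrAC subrr add0r.
have sub (k : R -> R) : continuous k -> mu.-integrable `]u, t] (EFin \o k).
  move=> ck; apply: (integrableS _ _ _ (cont_integrable_from0 ck t)) => //.
  by move=> x /=; rewrite !in_itv/= => /andP[ux ->]; rewrite (le_trans u0 (ltW ux)).
apply: (le_trans (le_normr_Rintegral _ (sub f cf))) => //.
apply: le_Rintegral => //.
- by have := integrable_abse (sub f cf).
- exact: sub.
by move=> x /=; rewrite in_itv/= => /andP[ux xt]; rewrite fg// (ltW ux).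
Qed.

Lemma eq_time_integral_increment f g u t : continuous f -> continuous g ->
  0 <= u -> u <= t -> (forall s, u <= s <= t -> f s = g s) ->
  time_integral f t - time_integral f u = time_integral g t - time_integral g u.
Proof.
move=> cf cg u0 ut fg; apply/eqP; rewrite -subr_eq0 -normr_le0.
have cfg : continuous (fun s => f s - g s).
  exact: continuousB_fun.
have lf := cont_integrable_from0 cf; have lg := cont_integrable_from0 cg.
have := @ler_time_integral_increment _ (fun=> 0) u t cfg (@continuous_cst_fun R 0) u0 ut.
rewrite !(time_integralB _ lf lg) !time_integral_cst ?(le_trans u0)// !mul0r subr0 => h.
rewrite (_ : _ - _ - _ = time_integral f t - time_integral g t -
    (time_integral f u - time_integral g u)); last by ring.
by apply: h => s /fg ->; rewrite subrr normr0.
Qed.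

Section OneIntegrand.
Variables (H H' : R -> R).
Hypothesis cH' : continuous H'.
Hypothesis dH : forall s, is_derive s 1 H (H' s).

Lemma continuous_integrand : continuous H.
Proof.
by move=> x; have [d _] := dH x; exact/differentiable_continuous/derivable1_diffP.
Qed.

Let cH := continuous_integrand.

Lemma time_integral_deriveE s : 0 <= s -> time_integral H' s = H s - H 0.
Proof. by move=> s0; exact: time_integral_FTC. Qed.

Lemma continuous_wiener V : continuous V -> continuous (wiener H H' V).
Proof.
move=> cV; apply: continuousD_fun; first exact: continuousM_fun.
by apply/continuousN_fun/continuous_time_integral/cont_integrable_from0/continuousM_fun.
Qed.

Lemma wienerD V W t : continuous V -> continuous W ->
  wiener H H' (fun s => V s + W s) t = wiener H H' V t + wiener H H' W t.
Proof.
move=> cV cW; rewrite /wiener.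
have -> : time_integral (fun s => H' s * (V s + W s)) t =
    time_integral (fun s => H' s * V s + H' s * W s) t.
  by apply: eq_time_integral => s _; rewrite mulrDr.
rewrite time_integralD; [ring|exact/cont_integrable_from0/continuousM_fun..].
Qed.

Lemma wienerZ V c t : continuous V ->
  wiener H H' (fun s => c * V s) t = c * wiener H H' V t.
Proof.
move=> cV; rewrite /wiener.
have -> : time_integral (fun s => H' s * (c * V s)) t =
    time_integral (fun s => c * (H' s * V s)) t.
  by apply: eq_time_integral => s _; rewrite mulrCA.
rewrite time_integralZ; [ring|exact/cont_integrable_from0/continuousM_fun].
Qed.

Lemma wiener_time_integral f t : continuous f -> 0 <= t ->
  wiener H H' (time_integral f) t = time_integral (fun s => H s * f s) t.
Proof.
move=> cf t0.
have cI : continuous (time_integral f).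
  exact/continuous_time_integral/cont_integrable_from0.
have := @time_integral_by_parts R H' f H (time_integral f) t cH' cf cH cI
  (fun s _ => dH s) (fun s pos => @is_derive_time_integral R f s cf pos) t0.
by rewrite time_integral0 mulr0 subr0 /wiener => <-; rewrite addrAC subrr add0r.
Qed.

(** Beyond s the minimum freezes phi at phi(s), and the remaining integral of H' is an increment of
    H. The minimum is the one in the Brownian covariance. *)
Lemma time_integral_derive_min (phi : R -> R) s t : continuous phi ->
  0 <= s -> s <= t ->
  time_integral (fun u => H' u * phi (Num.min s u)) t =
  time_integral (fun u => H' u * phi u) s + phi s * (H t - H s).
Proof.
move=> cphi s0 st; have t0 := le_trans s0 st.
have cm : continuous (fun u : R => phi (Num.min s u)).
  move=> x; apply: (@continuous_comp _ _ _ (fun u : R => Num.min s u) phi); last exact: cphi.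
  apply: (@continuous_min R R (fun=> s) id); first exact: cvg_cst.
  exact: cvg_id.
have c1 := continuousM_fun cH' cm.
have c2 : continuous (fun u => phi s * H' u).
  exact: continuousZ_fun.
have := eq_time_integral_increment c1 c2 s0 st.
have lH' := cont_integrable_from0 cH'.
rewrite !(time_integralZ _ _ lH') !time_integral_deriveE// => h.
have <- : time_integral (fun u => H' u * phi (Num.min s u)) s =
    time_integral (fun u => H' u * phi u) s.
  by apply: eq_time_integral => u /andP[_ us]; rewrite min_r.
have := h _; rewrite -mulrBr opprB addrA subrK => h'.
rewrite -h'; first by rewrite addrC subrK.
by move=> u /andP[su _]; rewrite min_l// mulrC.
Qed.

Lemma summation_by_parts (V : R -> R) (u : nat -> R) (n : nat) :
  \sum_(i < n) H (u i) * (V (u i.+1) - V (u i)) =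
  H (u n) * V (u n) - H (u 0%N) * V (u 0%N) -
  \sum_(i < n) V (u i.+1) * (H (u i.+1) - H (u i)).
Proof.
elim: n => [|n IH]; first by rewrite !big_ord0; ring.
by rewrite !big_ord_recr/= IH; ring.
Qed.

(** V(v) (H(v) - H(u)) is the integral of V(v) H' over the cell, so the error is the oscillation of
    V there, weighted by the variation of H. *)
Lemma cell_error V (u v e : R) : continuous V -> 0 <= u -> u <= v -> 0 <= e ->
  (forall s, u <= s <= v -> `|V v - V s| <= e) ->
  `|V v * (H v - H u) - (time_integral (fun s => H' s * V s) v -
      time_integral (fun s => H' s * V s) u)| <=
  e * (time_integral (fun s => `|H' s|) v - time_integral (fun s => `|H' s|) u).
Proof.
move=> cV u0 uv e0 osc; have v0 := le_trans u0 uv.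
have cHV : continuous (fun s => H' s * V s) by exact: continuousM_fun.
have cVH : continuous (fun s => V v * H' s).
  exact: continuousZ_fun.
have cf : continuous (fun s => V v * H' s - H' s * V s).
  exact: continuousB_fun.
have cn : continuous (fun s => `|H' s|) by exact: continuous_norm_fun.
have cg : continuous (fun s => e * `|H' s|).
  exact: continuousZ_fun.
have lH' := cont_integrable_from0 cH'.
have := ler_time_integral_increment cf cg u0 uv.
rewrite !(time_integralB _ (cont_integrable_from0 cVH) (cont_integrable_from0 cHV)).
rewrite !(time_integralZ _ _ lH') !(time_integralZ _ _ (cont_integrable_from0 cn)).
rewrite !time_integral_deriveE// => h.
rewrite [X in _ <= X]mulrBr (_ : _ - (_ - _) =
    V v * (H v - H 0) - time_integral (fun s => H' s * V s) v -
    (V v * (H u - H 0) - time_integral (fun s => H' s * V s) u)); last by ring.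
apply: h => s /osc osc_s.
by rewrite [H' s * V s]mulrC -mulrBl normrM ler_wpM2r.
Qed.

Lemma uniform_continuity V (t e : R) : continuous V -> 0 < e ->
  exists2 delta, 0 < delta & forall x y, 0 <= x <= t -> `|y - x| < delta ->
    `|V y - V x| < e.
Proof.
move=> cV e0.
have cover (x : R) : [set` `[0, t]] x -> \forall x' \near x & delta \near (0 : R)^'+,
    forall y, `|y - x'| < delta -> `|V y - V x'| < e.
  move=> _; have e2 : 0 < e / 2 by rewrite divr_gt0.
  have /cvgrPdist_lt/(_ _ e2) := cV x.
  move=> /nbhs_ballP[eta /= eta0 near_x].
  have eta2 : 0 < eta / 2 by rewrite divr_gt0.
  exists (ball x (eta / 2), [set delta | delta < eta / 2]) => /=.
    split; first by exists (eta / 2).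
    exact: nbhs_right_lt.
  move=> [x' delta] [/= xx' de] y yx'.
  have hx' : `|V x - V x'| < e / 2.
    by apply: near_x; apply: (lt_trans xx'); lra.
  have hy : `|V x - V y| < e / 2.
    apply: near_x; rewrite /ball /= in xx' *.
    have := ler_distD x' x y; rewrite [`|x' - y|]distrC; lra.
  have := ler_distD (V x) (V y) (V x'); rewrite [`|V y - V x|]distrC; lra.
have /compact_near_coveringP/(_ R (0 : R)^'+ _ _ cover) := @segment_compact R 0 t.
move=> [delta /= delta0 hd]; exists (delta / 2); first by rewrite divr_gt0.
move=> x y xt; apply: (hd (delta / 2)) => //=.
- by rewrite sub0r normrN gtr0_norm; lra.
- by rewrite divr_gt0.
Qed.

Definition uniform_partition t (n i : nat) : R := t * i%:R / n.+1%:R.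

Lemma uniform_partitionP t n : 0 <= t ->
  is_partition t n.+1 (uniform_partition t n).
Proof.
move=> t0; split; first by rewrite /uniform_partition mulr0 mul0r.
  by rewrite /uniform_partition mulfK// pnatr_eq0.
move=> i _; rewrite /uniform_partition ler_pM2r ?invr_gt0 ?ltr0n//.
by rewrite ler_wpM2l// ler_nat.
Qed.

Lemma uniform_partition_step t n i :
  uniform_partition t n i.+1 - uniform_partition t n i = t / n.+1%:R.
Proof. by rewrite /uniform_partition -mulrBl -mulrBr -natrB// subSnn mulr1. Qed.

Lemma cvg_uniform_step t : (fun n : nat => t / n.+1%:R) @ \oo --> (0 : R).
Proof. by rewrite -(mulr0 t); apply: cvgM; [exact: cvg_cst|exact: cvg_harmonic]. Qed.

Lemma cvg_mesh_uniform_partition t : 0 <= t ->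
  mesh n.+1 (uniform_partition t n) @[n --> \oo] --> (0 : R).
Proof.
move=> t0; apply: cvg_trans (cvg_uniform_step t).
apply: near_eq_cvg; apply: nearW => n; apply/esym.
have s0 : 0 <= t / n.+1%:R by rewrite divr_ge0.
rewrite /mesh; under eq_bigr do rewrite uniform_partition_step.
move: (t / _) s0 => c c0; elim: n => [|n IH]; first by rewrite big_ord_recl big_ord0 max_l.
by rewrite big_ord_recl IH maxxx.
Qed.

(* Summation by parts, then uniform continuity of [V]. *)
Lemma cvg_riemann_wiener V t : continuous V -> V 0 = 0 -> 0 <= t ->
  (fun n => \sum_(i < n.+1) H (uniform_partition t n i) *
     (V (uniform_partition t n i.+1) - V (uniform_partition t n i))) @ \oo -->
  wiener H H' V t.
Proof.
move=> cV V0 t0; apply/cvgrPdist_lt => e e0.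
pose A := time_integral (fun s => `|H' s|).
have A0 : 0 <= A t by exact: time_integral_ge0.
(* The cell errors add up to at most e' times the total variation A(t) of H; adding 1 keeps the
   quotient defined and the final inequality strict. *)
pose e' := e / (A t + 1).
have e'0 : 0 < e' by rewrite divr_gt0// ltr_wpDl.
have [delta delta0 osc] := @uniform_continuity V t e' cV e'0.
have := cvg_uniform_step t => /cvgr0Pnorm_lt/(_ _ delta0).
apply: filterS => n; rewrite ger0_norm ?divr_ge0// => step.
have [u0 ut umon] := uniform_partitionP n t0.
set u := uniform_partition t n in u0 ut umon *.
rewrite summation_by_parts ut u0 V0 mulr0 subr0 /wiener.
set Phi := time_integral (fun s => H' s * V s).
have tele (F : R -> R) : F t - F 0 = \sum_(i < n.+1) (F (u i.+1) - F (u i)).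
  rewrite -(big_mkord xpredT (fun i => F (u i.+1) - F (u i))).
  by rewrite telescope_sumr// ut u0.
rewrite (_ : _ - _ - _ = \sum_(i < n.+1) V (u i.+1) * (H (u i.+1) - H (u i)) - Phi t);
  last by ring.
have -> : Phi t = \sum_(i < n.+1) (Phi (u i.+1) - Phi (u i)).
  by rewrite -tele /Phi time_integral0 subr0.
rewrite -sumrB; apply: (le_lt_trans (ler_norm_sum _ _ _)).
have ui (i : 'I_n.+1) : 0 <= u i.
  by rewrite /u /uniform_partition divr_ge0// mulr_ge0.
have uit (i : nat) : (i <= n.+1)%N -> u i <= t.
  move=> i_n; rewrite /u /uniform_partition ler_pdivrMr ?ltr0n//.
  by rewrite ler_wpM2l// ler_nat.
apply: (@le_lt_trans _ _ (\sum_(i < n.+1) e' * (A (u i.+1) - A (u i)))); last first.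
  rewrite -mulr_sumr -tele /A time_integral0 subr0 -/A /e'.
  rewrite mulrAC -mulrA gtr_pMr// ltr_pdivrMr ?mul1r ?ltrDl//.
  by rewrite ltr_wpDl.
apply: ler_sum => i _; apply: cell_error => //.
- exact: umon.
- exact: ltW.
move=> s /andP[us su]; apply/ltW/osc.
  by rewrite (le_trans (ui i))//= (le_trans su)// uit.
rewrite ger0_norm ?subr_ge0//; apply: le_lt_trans step.
by rewrite -(uniform_partition_step t n i) lerD2l lerN2.
Qed.

End OneIntegrand.

End WienerIntegral.

(** * Ito's isometry for the integral defined by parts *)

Section WienerIsometry.
Context (R : realType) (d : measure_display) (Omega : measurableType d).
Context (P : probability Omega R).
Implicit Types (s t u : R).
Local Notation ev := (ev P).
Local Notation sqp := (square_integrable_process P).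

Definition wiener_process (H H' : R -> R) (B : R -> Omega -> R) t w :=
  wiener H H' (fun s => B s w) t.

Lemma sqp_wiener_process (H H' : R -> R) B : continuous H' ->
  (forall s, is_derive s 1 H (H' s)) -> sqp B -> sqp (wiener_process H H' B).
Proof.
move=> cH' dH sB; have cH := continuous_integrand dH.
have h1 := sqpM cH sB; have h2 := sqp_time_integral (sqpM cH' sB).
have := sqpD h1 (sqpZ (- 1) h2); congr square_integrable_process.
by apply/funext => t; apply/funext => w; rewrite /wiener_process /wiener mulN1r.
Qed.

Lemma ev_wiener_processM (H H' : R -> R) B (xi : Omega -> R) t : continuous H' ->
  (forall s, is_derive s 1 H (H' s)) -> sqp B -> square_integrable P xi -> 0 <= t ->
  ev (fun w => wiener_process H H' B t w * xi w) =
  wiener H H' (fun s => ev (fun w => B s w * xi w)) t.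
Proof.
move=> cH' dH sB sx t0; have sB' := sqpM cH' sB.
have sBt := sqp_section sB t0.
have sIt := sqp_section (sqp_time_integral sB') t0.
have i1 := square_integrableM sBt sx; have i2 := square_integrableM sIt sx.
have -> : (fun w => wiener_process H H' B t w * xi w) =
    fun w => H t * (B t w * xi w) +
      - 1 * (time_integral (fun s => H' s * B s w) t * xi w).
  by apply/funext => w; rewrite /wiener_process /wiener; ring.
rewrite evD; [|exact: integrable_rvZ..].
rewrite (evZ _ i1) (evZ _ i2) (ev_time_integralM sB' sx t0) mulN1r.
congr (_ - _); apply: eq_time_integral => s /andP[s0 _].
have i := square_integrableM (sqp_section sB s0) sx.
by rewrite -(evZ _ i); congr ev; apply/funext => w; rewrite mulrA.
Qed.

Variable B : R -> Omega -> R.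
Hypothesis sB : sqp B.
Hypothesis evB : forall s t, 0 <= s -> s <= t -> ev (fun w => B s w * B t w) = s.

Section OneIntegrand.
Variables (H H' : R -> R).
Hypothesis cH' : continuous H'.
Hypothesis dH : forall s, is_derive s 1 H (H' s).

Let cH := continuous_integrand dH.

Lemma wiener_id s : 0 <= s -> wiener H H' id s = time_integral H s.
Proof.
move=> s0; have c1 := @continuous_cst_fun R 1.
have := time_integral_by_parts cH' c1 cH (@continuous_id_fun R)
  (fun s _ => dH s) (fun s _ => is_derive_id s 1) s0.
rewrite mulr0 subr0 /wiener => <-; rewrite addrAC subrr add0r.
by apply: eq_time_integral => x _; rewrite mulr1.
Qed.

Lemma ev_wiener_brownian s u : 0 <= s -> 0 <= u ->
  ev (fun w => wiener_process H H' B s w * B u w) =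
  time_integral H (Num.min s u).
Proof.
move=> s0 u0; rewrite (ev_wiener_processM cH' dH sB (sqp_section sB u0) s0).
have evBm r : 0 <= r -> ev (fun w => B r w * B u w) = Num.min r u.
  move=> r0; have [ru|ur] := leP r u; first exact: evB.
  by under eq_fun do rewrite mulrC; rewrite evB// ltW.
rewrite /wiener evBm//.
rewrite (_ : time_integral _ s = time_integral (fun r => H' r * Num.min u r) s);
  last by apply: eq_time_integral => r /andP[r0 _]; rewrite evBm// minC.
have [su|us] := leP s u.
  rewrite -(wiener_id s0) /wiener; congr (_ - _).
  by apply: eq_time_integral => r /andP[_ rs]; rewrite min_r// (le_trans rs).
rewrite (time_integral_derive_min cH' dH (@continuous_id_fun R) u0 (ltW us)).
by rewrite -(wiener_id u0) /wiener; ring.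
Qed.

End OneIntegrand.

(** Expectation passes through the by-parts formula, so each integral acts on a deterministic
    covariance: the first turns min(r, u) into the integral of H up to min(s, u), the second turns
    the latter into the integral of H K up to s. *)
Lemma wiener_isometry (H H' K K' : R -> R) s t : continuous H' ->
  (forall s, is_derive s 1 H (H' s)) -> continuous K' ->
  (forall s, is_derive s 1 K (K' s)) -> 0 <= s -> s <= t ->
  ev (fun w => wiener_process H H' B s w * wiener_process K K' B t w) =
  time_integral (fun r => H r * K r) s.
Proof.
move=> cH' dH cK' dK s0 st; have t0 := le_trans s0 st.
have cH := continuous_integrand dH.
have sH := sqp_section (sqp_wiener_process cH' dH sB) s0.
under eq_fun do rewrite mulrC.
rewrite (ev_wiener_processM cK' dK sB sH t0) /wiener.
have e u : 0 <= u -> ev (fun w => B u w * wiener_process H H' B s w) =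
    time_integral H (Num.min s u).
  by move=> u0; under eq_fun do rewrite mulrC; exact: ev_wiener_brownian.
rewrite e// min_l//.
rewrite (_ : time_integral _ t =
    time_integral (fun r => K' r * time_integral H (Num.min s r)) t);
  last by apply: eq_time_integral => r /andP[r0 _]; rewrite e.
have cP : continuous (time_integral H).
  exact/continuous_time_integral/cont_integrable_from0.
rewrite (time_integral_derive_min cK' dK cP s0 st).
have := wiener_time_integral cK' dK cH s0; rewrite /wiener => h.
rewrite (_ : _ - _ = K s * time_integral H s -
  time_integral (fun u => K' u * time_integral H u) s); last by ring.
by rewrite h; apply: eq_time_integral => r _; rewrite mulrC.
Qed.

End WienerIsometry.

(** * Almost sure identification of limits and of paths *)

Section AlmostSure.
Context (R : realType) (d : measure_display) (Omega : measurableType d).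
Context (P : probability Omega R).

(** Where the pointwise limit J' differs from J, |S_n - J| stays above some 1 / (k + 1) from some
    index N on. For fixed k and N this event lies in events of probability tending to 0, and there
    are countably many pairs (k, N). *)
Lemma cvg_in_probability_unique (S : nat -> Omega -> R) (J J' : Omega -> R) :
  (forall n, measurable_fun setT (S n)) -> measurable_fun setT J ->
  cvg_in_probability P S J ->
  {ae P, forall w, S n w @[n --> \oo] --> J' w} ->
  {ae P, forall w, J w = J' w}.
Proof.
move=> mS mJ SJ SJ'.
pose A k n : set Omega := [set w | k.+1%:R^-1 <= `|S n w - J w|].
have mA k n : measurable (A k n).
  rewrite -[A k n]setTI; apply: measurable_fun_le => //.
  by apply: (measurableT_comp (@normr_measurable _ _)) => //; exact: measurable_funB.
pose L k N : set Omega := \bigcap_(n in [set n | (N <= n)%N]) A k n.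
have nL k N : P.-negligible (L k N).
  have mL : measurable (L k N) by apply: bigcap_measurable => //; exists N => /=.
  apply/negligibleP => //; apply/eqP; rewrite eq_le measure_ge0 andbT.
  have k0 : 0 < k.+1%:R^-1 :> R by rewrite invr_gt0.
  have cA := SJ _ k0; rewrite -(cvg_lim _ cA)//.
  apply: lime_ge; first by apply/cvg_ex; exists 0%E.
  near=> n; apply: le_measure; rewrite ?inE//; first exact: mA.
  by move=> w; apply; near: n; exact: nbhs_infty_ge.
have [N [mN N0 hN]] := SJ'.
have nN : P.-negligible N by apply/negligibleP.
have nU : P.-negligible (N `|` \bigcup_k \bigcup_N L k N).
  apply: negligibleU => //; apply: negligible_bigcup => k.
  exact: negligible_bigcup.
apply: negligibleS nU => w /= Jw.
have [cw|ncw] := pselect (S n w @[n --> \oo] --> J' w); last by left; exact: hN.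
right; have e0 : 0 < `|J' w - J w| by rewrite normr_gt0 subr_eq0 eq_sym; exact/eqP.
have e2 : 0 < `|J' w - J w| / 2 by rewrite divr_gt0.
pose k := Num.trunc (`|J' w - J w| / 2)^-1.
have hk : k.+1%:R^-1 < `|J' w - J w| / 2.
  rewrite -[ltRHS]invrK ltf_pV2 ?posrE ?ltr0n ?invr_gt0//; exact: truncnS_gt.
move/cvgrPdist_lt : cw => /(_ _ e2) [n0 _ hn0].
exists k => //; exists n0 => // n /= n0n; rewrite /A /=.
have := hn0 n n0n => /= h1.
by have := ler_distD (S n w) (J' w) (J w); move: (k.+1%:R^-1) hk h1 => kk; lra.
Unshelve. all: by end_near. Qed.

(** The exceptional sets at nonnegative rational times form a countable union; path continuity then
    extends the equality to every t, approached by floor(t (k + 1)) / (k + 1). *)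
Lemma ae_forall_time (f g : R -> Omega -> R) :
  (forall t, 0 <= t -> {ae P, forall w, f t w = g t w}) ->
  {ae P, forall w, continuous (fun t => f t w)} ->
  {ae P, forall w, continuous (fun t => g t w)} ->
  {ae P, forall w, forall t, 0 <= t -> f t w = g t w}.
Proof.
move=> fg cf cg.
have rat : {ae P, forall w, forall k n : nat,
    f (n%:R / k.+1%:R) w = g (n%:R / k.+1%:R) w}.
  apply: ae_foralln => k; apply: ae_foralln => n; apply: fg.
  by rewrite divr_ge0.
move: rat cf cg; apply: filterS3 => w rat cfw cgw t t0.
pose r (k : nat) : R := (Num.trunc (t * k.+1%:R))%:R / k.+1%:R.
have cr : r k @[k --> \oo] --> t.
  apply/cvgrPdist_lt => e e0.
  have := @cvg_harmonic R => /cvgrPdist_lt/(_ _ e0).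
  apply: filterS => k; rewrite sub0r normrN ger0_norm ?invr_ge0// => hk.
  apply: le_lt_trans hk; rewrite /r.
  have /truncn_itv/andP[h1 h2] : 0 <= t * k.+1%:R by rewrite mulr_ge0.
  have k0 : 0 < k.+1%:R :> R by rewrite ltr0n.
  have -> : t - (Num.trunc (t * k.+1%:R))%:R / k.+1%:R =
      (t * k.+1%:R - (Num.trunc (t * k.+1%:R))%:R) / k.+1%:R.
    by rewrite mulrBl mulfK ?lt0r_neq0.
  rewrite normrM [`|_^-1|]gtr0_norm ?invr_gt0// ler_piMl ?invr_ge0//.
  by rewrite ger0_norm ?subr_ge0// lerBlDr addrC natr1 ltW.
have c1 := cvg_comp _ _ cr (cfw t); have c2 := cvg_comp _ _ cr (cgw t).
have e : (f ^~ w) \o r = (g ^~ w) \o r by apply/funext => k /=; exact: rat.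
by rewrite e in c1; exact: (cvg_unique _ c1 c2).
Qed.

End AlmostSure.

(** * The filter *)

Section PathwiseFilter.
Context (R : realType).
Variables (a b c th : R) (X Y m n : R -> R) (Hm Hm' Hn Hn' : R -> R).
Hypotheses (cX : continuous X) (cY : continuous Y).
Hypotheses (cm : continuous m) (cn : continuous n).
Hypotheses (cHm' : continuous Hm') (cHn' : continuous Hn').
Hypothesis dHm : forall s : R, is_derive s 1 Hm (Hm' s).
Hypothesis dHn : forall s : R, is_derive s 1 Hn (Hn' s).

Let cHm := continuous_integrand dHm.
Let cHn := continuous_integrand dHn.

Let e t := Y t - m t.
Let q t := m t + th * n t.
Let nu t := X t - time_integral (fun s => th * m s + a * X s) t.
Let BX t := X t - time_integral (fun s => a * X s + th * Y s) t.
Let BY t := Y t - time_integral (fun s => b * X s + c * Y s) t.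

Let ce : continuous e. Proof. exact: continuousB_fun. Qed.

Let cBX : continuous BX.
Proof.
apply: continuousB_fun => //.
apply/continuous_time_integral/cont_integrable_from0.
by apply: continuousD_fun; exact: continuousZ_fun.
Qed.

(** The innovation is the observation noise with the extra drift th e, since X is driven by th Y
    while the filter predicts th m. *)
Let innovationE t : 0 <= t -> nu t = BX t + th * time_integral e t.
Proof.
move=> t0; have c1 := @continuousZ_fun R th _ cm; have c2 := @continuousZ_fun R a _ cX.
have c3 := @continuousZ_fun R th _ cY.
have l1 := cont_integrable_from0 c1; have l2 := cont_integrable_from0 c2.
have l3 := cont_integrable_from0 c3.
rewrite /nu /BX /e (time_integralD _ l1 l2) (time_integralD _ l2 l3).
rewrite (time_integralB _ (cont_integrable_from0 cY) (cont_integrable_from0 cm)).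
rewrite (time_integralZ _ _ (cont_integrable_from0 cY)).
rewrite (time_integralZ _ _ (cont_integrable_from0 cm)).
ring.
Qed.

Lemma wiener_innovation (H H' : R -> R) t : continuous H' ->
  (forall s : R, is_derive s 1 H (H' s)) -> 0 <= t ->
  wiener H H' nu t =
  wiener H H' BX t + th * time_integral (fun s => H s * e s) t.
Proof.
move=> cH' dH t0.
have cI : continuous (time_integral e).
  exact/continuous_time_integral/cont_integrable_from0.
have cI' := @continuousZ_fun R th _ cI.
have eZ : wiener H H' (fun s => th * time_integral e s) t =
  th * wiener H H' (time_integral e) t by exact: wienerZ.
have eD : wiener H H' (fun s => BX s + th * time_integral e s) t =
  wiener H H' BX t + wiener H H' (fun s => th * time_integral e s) t.
  exact: wienerD.
rewrite -(wiener_time_integral cH' dH ce t0) -eZ -eD /wiener innovationE//.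
congr (_ - _).
by apply: eq_time_integral => s /andP[s0 _]; rewrite innovationE.
Qed.

Hypothesis m_eq : forall t, 0 <= t ->
  m t - time_integral (fun s => c * m s + b * X s) t = wiener Hm Hm' nu t.
Hypothesis n_eq : forall t, 0 <= t ->
  n t - time_integral (fun s => (c - th * Hm s) * n s - Hm s * m s) t =
  wiener Hn Hn' nu t.

(** The drift b X is common to Y and m and cancels, while the innovation feeds th e back through the
    gain, so the equation for e is closed. *)
Lemma filter_error_path t : 0 <= t ->
  e t = time_integral (fun s => (c - th * Hm s) * e s) t + BY t -
    wiener Hm Hm' BX t.
Proof.
move=> t0; have := m_eq t0; rewrite wiener_innovation// => /eqP.
rewrite subr_eq => /eqP m1; rewrite {1}/e m1 /BY.
have lHe := cont_integrable_from0 (continuousM_fun cHm ce).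
have le := cont_integrable_from0 ce.
have lY := cont_integrable_from0 cY; have lm := cont_integrable_from0 cm.
have lX := cont_integrable_from0 cX.
have -> : time_integral (fun s => (c - th * Hm s) * e s) t =
    time_integral (fun s => c * e s - th * (Hm s * e s)) t.
  by apply: eq_time_integral => s _; ring.
rewrite (time_integralB _ (integrable_from0Z c le) (integrable_from0Z th lHe)).
rewrite (time_integralZ _ _ le) (time_integralZ _ _ lHe).
rewrite (time_integralD _ (integrable_from0Z b lX) (integrable_from0Z c lY)).
rewrite (time_integralD _ (integrable_from0Z c lm) (integrable_from0Z b lX)).
rewrite (time_integralZ _ _ lX) (time_integralZ _ _ lY) (time_integralZ _ _ lm).
rewrite (time_integralB _ lY lm).
ring.
Qed.

(** The drifts combine because c m + th ((c - th Hm) n - Hm m) = (c - th Hm) (m + th n); apart from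
    the noise, only X and e remain as inputs of q. *)
Lemma filter_score_path t : 0 <= t ->
  q t = time_integral (fun s => b * X s + th * (Hm s + th * Hn s) * e s +
      (c - th * Hm s) * q s) t +
    wiener (fun s => Hm s + th * Hn s) (fun s => Hm' s + th * Hn' s) BX t.
Proof.
move=> t0; have := m_eq t0; rewrite wiener_innovation// => /eqP.
rewrite subr_eq => /eqP m1; have := n_eq t0; rewrite wiener_innovation// => /eqP.
rewrite subr_eq => /eqP n1; rewrite {1}/q m1 n1.
have lX := cont_integrable_from0 cX.
have lm := cont_integrable_from0 cm.
have lHe := cont_integrable_from0 (continuousM_fun cHm ce).
have lHne := cont_integrable_from0 (continuousM_fun cHn ce).
have cHm2 : continuous (fun s => c - th * Hm s).
  by apply: continuousB_fun; [exact: continuous_cst_fun|exact: continuousZ_fun].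
have ln := cont_integrable_from0 (continuousM_fun cHm2 cn).
have lHmm := cont_integrable_from0 (continuousM_fun cHm cm).
have lb := cont_integrable_from0 (continuousM_fun cHm' cBX).
have lb' := cont_integrable_from0 (continuousM_fun cHn' cBX).
have -> : time_integral (fun s => b * X s + th * (Hm s + th * Hn s) * e s +
      (c - th * Hm s) * q s) t =
    time_integral (fun s => (c * m s + b * X s) +
      (th * (Hm s * e s) + ((th * th) * (Hn s * e s) +
        th * ((c - th * Hm s) * n s - Hm s * m s)))) t.
  by apply: eq_time_integral => s _; rewrite /q; ring.
have l1 := integrable_from0D (integrable_from0Z c lm) (integrable_from0Z b lX).
have l2 : integrable_from0 (fun s => (c - th * Hm s) * n s - Hm s * m s).
  move=> u; have := integrable_from0D ln (integrable_from0Z (- 1) lHmm) u.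
  by congr (_.-integrable _ _); apply/funext => s /=; rewrite mulN1r.
have l3 := integrable_from0D (integrable_from0Z (th * th) lHne) (integrable_from0Z th l2).
have l4 := integrable_from0D (integrable_from0Z th lHe) l3.
rewrite (time_integralD _ l1 l4) (time_integralD _ (integrable_from0Z th lHe) l3).
rewrite (time_integralD _ (integrable_from0Z (th * th) lHne) (integrable_from0Z th l2)).
rewrite (time_integralZ th t lHe) (time_integralZ _ t lHne) (time_integralZ th t l2).
rewrite /wiener.
have -> : time_integral (fun s => (Hm' s + th * Hn' s) * BX s) t =
   time_integral (fun s => Hm' s * BX s + th * (Hn' s * BX s)) t.
  by apply: eq_time_integral => s _; ring.
rewrite (time_integralD _ lb (integrable_from0Z th lb')) (time_integralZ _ _ lb').
ring.
Qed.

End PathwiseFilter.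

(** * From limits in probability to pathwise integrals *)

Section ItoIntegral.
Context (R : realType) (d : measure_display) (Omega : measurableType d).
Context (P : probability Omega R).
Implicit Types (Z V D : R -> Omega -> R) (t : R).

Lemma clamp_jointly_measurable Z : continuous_process P Z ->
  jointly_measurable (fun t w => Z (Num.max t 0) w).
Proof.
move=> [mZ _].
have mm : measurable_fun setT (fun t : measurableTypeR R => Num.max t 0).
  exact: (continuous_measurable (@continuous_maxr0 R)).
have mphi : measurable_fun setT (fun z : measurableTypeR R * Omega =>
    ((Num.max z.1 0 : measurableTypeR R), z.2)).
  apply: measurable_fun_pair; last exact: measurable_snd.
  exact: (measurableT_comp mm measurable_fst).
apply: (measurable_comp _ _ mZ mphi).
  apply: measurableX => //.
  have -> : [set t : measurableTypeR R | 0 <= t] = [set` `[0%R, +oo[].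
    by apply/seteqP; split => x/=; rewrite in_itv/= andbT.
  exact: measurable_itv.
move=> _ [z _ <-]; split => //=.
by rewrite le_max lexx orbT.
Qed.

Lemma clamp_continuous_ae Z : continuous_process P Z ->
  {ae P, forall w, continuous (fun t => Z (Num.max t 0) w)}.
Proof. by move=> [_]; apply: filterS => w; exact: continuous_clamp. Qed.

(* [V], [J], [h] are only known at nonnegative times, where they agree with
   [nu], [D], [H]. *)
Lemma ae_ito_wiener (h H H' : R -> R) V (J : R -> Omega -> R) nu D :
  continuous H' -> (forall s : R, is_derive s 1 H (H' s)) ->
  (forall t, 0 <= t -> h t = H t) ->
  jointly_measurable nu -> {ae P, forall w, continuous (fun t => nu t w)} ->
  {ae P, forall w, nu 0 w = 0} -> (forall t w, 0 <= t -> V t w = nu t w) ->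
  jointly_measurable D -> {ae P, forall w, continuous (fun t => D t w)} ->
  (forall t w, 0 <= t -> J t w = D t w) ->
  (forall t, 0 <= t -> is_ito_integral P h V t (J t)) ->
  {ae P, forall w, forall t, 0 <= t ->
     D t w = wiener H H' (fun s => nu s w) t}.
Proof.
move=> cH' dH hH mnu cnu nu0 Vnu mD cD JD ito.
have cw : {ae P, forall w, continuous (fun t => wiener H H' (fun s => nu s w) t)}.
  by move: cnu; apply: filterS => w; exact: continuous_wiener.
apply: (@ae_forall_time _ _ _ P D
  (fun t w => wiener H H' (fun s => nu s w) t) _ cD cw) => t t0.
pose u := uniform_partition t.
have u0 n i : 0 <= u n i by rewrite /u /uniform_partition divr_ge0// mulr_ge0.
pose S n w := \sum_(i < n.+1) H (u n i) * (nu (u n i.+1) w - nu (u n i) w).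
have SE n : ito_sum h V n.+1 (u n) = S n.
  by apply/funext => w; apply: eq_bigr => i _; rewrite hH// !Vnu.
have JE : J t = D t by apply/funext => w; exact: JD.
apply: (@cvg_in_probability_unique _ _ _ P S (D t)).
- move=> n; apply: measurable_sum => i; apply: measurable_funM => //.
  by apply: measurable_funB; exact: jointly_measurable_section.
- exact: jointly_measurable_section.
- rewrite -JE (_ : S = fun n => ito_sum h V n.+1 (u n)); last by apply/funext => n; rewrite SE.
  apply: ito => // [n|]; first exact: uniform_partitionP.
  exact: cvg_mesh_uniform_partition.
move: cnu nu0; apply: filterS2 => w cnuw nu0w.
exact: (cvg_riemann_wiener cH' dH cnuw nu0w t0).
Qed.

Lemma brownian_version W B : standard_brownian_motion P W ->
  jointly_measurable B -> (forall w, continuous (fun t => B t w)) ->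
  {ae P, forall w, forall t, 0 <= t -> B t w = W t w} ->
  square_integrable_process P B /\
  forall s t, 0 <= s -> s <= t -> ev P (fun w => B s w * B t w) = s.
Proof.
move=> bW mB cB BW; have [sW mW covW] := brownian_moments bW.
have BWt t : 0 <= t -> {ae P, forall w, B t w = W t w}.
  by move=> t0; move: BW; apply: filterS => w; apply.
have mBt t : measurable_fun setT (B t) by exact: jointly_measurable_section.
have sB t : 0 <= t -> square_integrable P (B t).
  by move=> t0; exact: (ae_square_integrable (mBt t) (sW t t0) (BWt t t0)).
have covB s t : 0 <= s -> s <= t -> ev P (fun w => B s w * B t w) = s.
  move=> s0 st; have t0 := le_trans s0 st.
  rewrite -[RHS](covW s t s0 st); apply: ae_ev.
  - exact: measurable_funM.
  - apply: measurable_funM; [exact: (sW s s0).1|exact: (sW t t0).1].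
  by move: (BWt s s0) (BWt t t0); apply: filterS2 => w -> ->.
split => //; split => // T; exists `|T| => // t /andP[t0 tT].
split; first exact: sB.
have -> : (fun w => B t w ^+ 2) = fun w => B t w * B t w by [].
by rewrite covB// (le_trans tT)// ler_norm.
Qed.

Lemma independent_brownian_version V W BV BW : standard_brownian_motion P V ->
  standard_brownian_motion P W -> independent_processes P V W ->
  jointly_measurable BV -> jointly_measurable BW ->
  {ae P, forall w, forall t, 0 <= t -> BV t w = V t w} ->
  {ae P, forall w, forall t, 0 <= t -> BW t w = W t w} ->
  forall s t, 0 <= s -> 0 <= t -> ev P (fun w => BV s w * BW t w) = 0.
Proof.
move=> bV bW ind mBV mBW BVE BWE s t s0 t0.
have [sV _ _] := brownian_moments bV; have [sW _ _] := brownian_moments bW.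
rewrite -(ev_independent_brownian bV bW ind s0 t0); apply: ae_ev.
- by apply: measurable_funM; exact: jointly_measurable_section.
- by apply: measurable_funM; [exact: (sV s s0).1|exact: (sW t t0).1].
by move: BVE BWE; apply: filterS2 => w -> // ->.
Qed.

End ItoIntegral.

(** * Covariances of the model *)

Section ModelCovariance.
Context (R : realType).
Implicit Types (p : params R) (s t : R).

Lemma params_nondegenerate p : (pc p != 0) || (pth p != 0).
Proof.
have := det_gt0 p; have [-> /=|//] := eqVneq (pc p) 0.
by have [->|//] := eqVneq (pth p) 0; rewrite !mulr0 subrr ltxx.
Qed.

(** For th = 0 the determinant is a c, and a c > 0 with a + c < 0 forces c < 0. *)
Lemma params_stable p : (pc p < 0) || (pth p != 0).
Proof.
have := det_gt0 p; have := trace_lt0 p.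
have [->|_] := eqVneq (pth p) 0; last by rewrite orbT.
rewrite mulr0 subr0 orbF => h1 h2; rewrite ltNge; apply/negP => c0.
have a0 : pa p < 0 by lra.
by have := mulr_le0_ge0 (ltW a0) c0; rewrite leNgt h2.
Qed.

Definition param_kappa p := kappa (pc p) (pth p).

Lemma param_kappa_gt0 p : 0 < param_kappa p.
Proof. exact/kappa_gt0/params_nondegenerate. Qed.

Lemma param_kappa_gt p : pc p < param_kappa p.
Proof. exact/ltr_kappa/params_stable. Qed.

Lemma ler_norm_param_kappa p : `|pc p| <= param_kappa p.
Proof. exact: ler_norm_kappa. Qed.

Lemma param_kappa_sqr p : param_kappa p ^+ 2 = pc p ^+ 2 + pth p ^+ 2.
Proof. exact: kappa_sqr. Qed.

(** The gains are built on the explicit formula, differentiable at every real time, because [wiener]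
    integrands need a derivative everywhere, whereas [gamma] is only determined for t >= 0. *)
Definition gam_t p := riccati_sol (pc p) (param_kappa p).

Definition gam_t' p t := 2 * pc p * gam_t p t + 1 -
  (param_kappa p ^+ 2 - pc p ^+ 2) * gam_t p t ^+ 2.

Definition dgam_t p t :=
  riccati_dsol (pc p) (param_kappa p) t * (pth p / param_kappa p).

Definition dgam_t' p t := (2 * pc p * riccati_dsol (pc p) (param_kappa p) t -
   2 * param_kappa p * gam_t p t ^+ 2 -
   2 * (param_kappa p ^+ 2 - pc p ^+ 2) * gam_t p t *
     riccati_dsol (pc p) (param_kappa p) t) * (pth p / param_kappa p).

(* Coefficients of the innovation in the equations of [m], of its
   theta-derivative, and of [m + theta * dm]. *)
Definition gain_m p t := pth p * gam_t p t.
Definition gain_m' p t := pth p * gam_t' p t.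
Definition gain_dm p t := gam_t p t + pth p * dgam_t p t.
Definition gain_dm' p t := gam_t' p t + pth p * dgam_t' p t.
Definition gain p t := gain_m p t + pth p * gain_dm p t.
Definition gain' p t := gain_m' p t + pth p * gain_dm' p t.

Lemma is_derive_gam_t p s : is_derive s 1 (gam_t p) (gam_t' p s).
Proof. exact: is_derive_riccati_sol (param_kappa_gt0 p) (ler_norm_param_kappa p). Qed.

Lemma is_derive_dgam_t p s : is_derive s 1 (dgam_t p) (dgam_t' p s).
Proof.
have dr := is_derive_riccati_dsol s (param_kappa_gt0 p) (ler_norm_param_kappa p).
by apply: is_derive_eq; rewrite /GRing.scale/= /dgam_t' /gam_t; ring.
Qed.

Lemma is_derive_gain_m p s : is_derive s 1 (gain_m p) (gain_m' p s).
Proof.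
have dg := is_derive_gam_t p s.
by apply: is_derive_eq; rewrite /GRing.scale/= /gain_m'; ring.
Qed.

Lemma is_derive_gain_dm p s : is_derive s 1 (gain_dm p) (gain_dm' p s).
Proof.
have dg := is_derive_gam_t p s; have ddg := is_derive_dgam_t p s.
by apply: is_derive_eq; rewrite /GRing.scale/= /gain_dm'; ring.
Qed.

Lemma is_derive_gain p s : is_derive s 1 (gain p) (gain' p s).
Proof.
have dg := is_derive_gain_m p s; have ddg := is_derive_gain_dm p s.
by apply: is_derive_eq; rewrite /GRing.scale/= /gain'; ring.
Qed.

Lemma continuous_gam_t p : continuous (gam_t p).
Proof. exact: continuous_riccati_sol (param_kappa_gt0 p) (ler_norm_param_kappa p). Qed.

Lemma continuous_gam_t' p : continuous (gam_t' p).
Proof.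
apply: continuousD_fun; last first.
  by apply/continuousN_fun/continuousZ_fun/continuousX_fun/continuous_gam_t.
apply: continuousD_fun; last exact: continuous_cst_fun.
exact/continuousZ_fun/continuous_gam_t.
Qed.

Lemma continuous_dgam_t' p : continuous (dgam_t' p).
Proof.
have cd := continuous_riccati_dsol (param_kappa_gt0 p) (ler_norm_param_kappa p).
have cg := @continuous_gam_t p.
apply: continuousM_fun; last exact: continuous_cst_fun.
apply: continuousD_fun; last first.
  by apply/continuousN_fun/continuousM_fun => //; exact: continuousZ_fun.
apply: continuousD_fun; first exact: continuousZ_fun.
exact/continuousN_fun/continuousZ_fun/continuousX_fun.
Qed.

Lemma continuous_gain_m' p : continuous (gain_m' p).
Proof. exact/continuousZ_fun/continuous_gam_t'. Qed.

Lemma continuous_gain_dm' p : continuous (gain_dm' p).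
Proof.
apply: continuousD_fun; first exact: continuous_gam_t'.
exact/continuousZ_fun/continuous_dgam_t'.
Qed.

Lemma continuous_gain' p : continuous (gain' p).
Proof.
apply: continuousD_fun; first exact: continuous_gain_m'.
exact/continuousZ_fun/continuous_gain_dm'.
Qed.

Lemma continuous_gain p : continuous (gain p).
Proof. exact: continuous_integrand (is_derive_gain p). Qed.

Lemma continuous_gain_m p : continuous (gain_m p).
Proof. exact: continuous_integrand (is_derive_gain_m p). Qed.

(* The system is indexed by X, Y, the filtering error e = Y - m, and
   q = m + theta * dm, in this order. *)
Definition sys_drift p (i j : 'I_4) t : R := nth 0 (nth [::]
  [:: [:: pa p; pth p; 0; 0];
      [:: pb p; pc p; 0; 0];
      [:: 0; 0; pc p - pth p * gain_m p t; 0];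
      [:: pb p; 0; pth p * gain p t; pc p - pth p * gain_m p t]] i) j.

Definition sys_noiseX p (i : 'I_4) t : R := nth 0 [:: 1; 0; - gain_m p t; gain p t] i.
Definition sys_noiseX' p (i : 'I_4) t : R := nth 0 [:: 0; 0; - gain_m' p t; gain' p t] i.
Definition sys_noiseY (i : 'I_4) : R := nth 0 [:: 0; 1; 1; 0] i.

Definition sys_noise_cov p (i j : 'I_4) t :=
  sys_noiseY i * sys_noiseY j + sys_noiseX p i t * sys_noiseX p j t.

Lemma continuous_sys_drift p i j : continuous (sys_drift p i j).
Proof.
have cg := @continuous_gain p; have cm := @continuous_gain_m p.
have c0 (x : R) := @continuous_cst_fun R x.
have ck : continuous (fun t => pc p - pth p * gain_m p t).
  by apply: continuousD_fun; [exact: c0|exact/continuousN_fun/continuousZ_fun].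
case: i => [[|[|[|[|i]]]] hi] //; case: j => [[|[|[|[|j]]]] hj] //;
  by [exact: c0 | exact: ck | exact: (continuousZ_fun cg)].
Qed.

Lemma is_derive_sys_noiseX p i s :
  is_derive s 1 (sys_noiseX p i) (sys_noiseX' p i s).
Proof.
case: i => [[|[|[|[|i]]]] hi]; last by exfalso; move: hi.
- exact: (is_derive_cst (1 : R)).
- exact: (is_derive_cst (0 : R)).
- have dg := is_derive_gain_m p s; exact: (is_deriveN (f := gain_m p)).
- exact: is_derive_gain.
Qed.

Lemma continuous_sys_noiseX' p i : continuous (sys_noiseX' p i).
Proof.
case: i => [[|[|[|[|i]]]] hi]; last by exfalso; move: hi.
- exact: (@continuous_cst_fun R 0).
- exact: (@continuous_cst_fun R 0).
- exact/continuousN_fun/continuous_gain_m'.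
- exact: continuous_gain'.
Qed.

Lemma continuous_sys_noise_cov p i j : continuous (sys_noise_cov p i j).
Proof.
apply: continuousD_fun; first exact: continuous_cst_fun.
by apply: continuousM_fun; exact: continuous_integrand (is_derive_sys_noiseX _ _).
Qed.

End ModelCovariance.

Definition idx0 : 'I_4 := @Ordinal 4 0 isT.
Definition idx1 : 'I_4 := @Ordinal 4 1 isT.
Definition idx2 : 'I_4 := @Ordinal 4 2 isT.
Definition idx3 : 'I_4 := @Ordinal 4 3 isT.

Lemma sum_idx4 (V : nmodType) (F : 'I_4 -> V) :
  \sum_(k < 4) F k = F idx0 + (F idx1 + (F idx2 + F idx3)).
Proof.
rewrite !big_ord_recl big_ord0 addr0.
by congr (F _ + (F _ + (F _ + F _))); apply: val_inj.
Qed.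

(** All that the long-time analysis takes from probability. Positivity of the variance of each
    combination x Z_i + y Z_j is the only inequality it retains. *)
Definition covariance_system (R : realType) (p : params R)
    (S : 'I_4 -> 'I_4 -> R -> R) :=
  [/\ forall i j t, S i j t = S j i t,
      forall i j (x y t : R), 0 <= t ->
        0 <= x ^+ 2 * S i i t + 2 * (x * y) * S i j t + y ^+ 2 * S j j t,
      forall i j, integrable_from0 (S i j)
    & forall i j (t : R), 0 <= t -> S i j t = time_integral (fun s =>
        \sum_k sys_drift p i k s * S k j s + \sum_k sys_drift p j k s * S i k s +
        sys_noise_cov p i j s) t].

Section ModelProcesses.
Context (R : realType) (gamma : R -> R -> R -> R).
Hypothesis hgamma : forall c th : R, riccati_solution c th (gamma c th).
Variables (p : params R) (M : model gamma p).
Local Notation P := (prob M).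
Local Notation a := (pa p).
Local Notation b := (pb p).
Local Notation c := (pc p).
Local Notation th := (pth p).
Local Notation clamp Z := (fun (t : R) (w : Omega M) => Z (Num.max t 0) w).

Let Xc : R -> Omega M -> R := clamp (@Xp _ _ _ M).
Let Yc : R -> Omega M -> R := clamp (@Yp _ _ _ M).
Let mc : R -> Omega M -> R := clamp (@mp _ _ _ M).
Let nc : R -> Omega M -> R := clamp (@dmp _ _ _ M).

Let nu (t : R) w := Xc t w - time_integral (fun s => th * mc s w + a * Xc s w) t.
Let Dm (t : R) w := mc t w - time_integral (fun s => c * mc s w + b * Xc s w) t.
Let Dn (t : R) w := nc t w -
  time_integral (fun s => (c - th * gain_m p s) * nc s w - gain_m p s * mc s w) t.

Let mX : jointly_measurable Xc. Proof. exact: (clamp_jointly_measurable (X_process M)). Qed.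
Let mY : jointly_measurable Yc. Proof. exact: (clamp_jointly_measurable (Y_process M)). Qed.
Let mm : jointly_measurable mc. Proof. exact: (clamp_jointly_measurable (m_process M)). Qed.
Let mn : jointly_measurable nc. Proof. exact: (clamp_jointly_measurable (dm_process M)). Qed.

Let mcst (f : R -> R) : continuous f -> jointly_measurable (fun t (_ : Omega M) => f t).
Proof. by move=> cf; exact: (jointly_measurable_time (continuous_measurable cf)). Qed.

Let mlin (f g : R -> R) (U V : R -> Omega M -> R) : continuous f -> continuous g ->
  jointly_measurable U -> jointly_measurable V ->
  jointly_measurable (fun t w => f t * U t w + g t * V t w).
Proof.
move=> cf cg mU mV.
by apply: jointly_measurableD; apply: jointly_measurableM => //; exact: mcst.
Qed.

Let mdrift (f g : R -> R) (Z U V : R -> Omega M -> R) : continuous f -> continuous g ->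
  jointly_measurable Z -> jointly_measurable U -> jointly_measurable V ->
  jointly_measurable (fun t w => Z t w -
    time_integral (fun s => f s * U s w + g s * V s w) t).
Proof.
move=> cf cg mZ mU mV; have mI := jointly_measurable_time_integral (mlin cf cg mU mV).
exact: measurable_funB mZ mI.
Qed.

Let cdrift (f g z u v : R -> R) : continuous f -> continuous g -> continuous z ->
  continuous u -> continuous v ->
  continuous (fun t => z t - time_integral (fun s => f s * u s + g s * v s) t).
Proof.
move=> cf cg cz cu cv; apply: continuousB_fun => //.
apply/continuous_time_integral/cont_integrable_from0.
by apply: continuousD_fun; exact: continuousM_fun.
Qed.

Let cc (x : R) := @continuous_cst_fun R x.

Let cgm : continuous (fun s => - gain_m p s).
Proof. exact/continuousN_fun/continuous_gain_m. Qed.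

Let ckap : continuous (fun s => c - th * gain_m p s).
Proof.
apply: continuousD_fun; first exact: cc.
exact/continuousN_fun/continuousZ_fun/continuous_gain_m.
Qed.

Let DnE t w : Dn t w = nc t w - time_integral (fun s =>
  (c - th * gain_m p s) * nc s w + - gain_m p s * mc s w) t.
Proof.
by rewrite /Dn; congr (_ - _); apply: eq_time_integral => s _; rewrite mulNr.
Qed.

Let mnu : jointly_measurable nu. Proof. exact: mdrift. Qed.
Let mDm : jointly_measurable Dm. Proof. exact: mdrift. Qed.
Let mDn : jointly_measurable Dn.
Proof.
have := mdrift ckap cgm mn mn mm; congr jointly_measurable.
by apply/funext => t; apply/funext => w; rewrite DnE.
Qed.

Let cae : {ae P, forall w, [/\ continuous (fun t => Xc t w),
  continuous (fun t => Yc t w), continuous (fun t => mc t w) &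
  continuous (fun t => nc t w)]}.
Proof.
have h1 := clamp_continuous_ae (X_process M); have h2 := clamp_continuous_ae (Y_process M).
have h3 := clamp_continuous_ae (m_process M); have h4 := clamp_continuous_ae (dm_process M).
have h12 : {ae P, forall w, continuous (fun t => Xc t w) /\
  continuous (fun t => Yc t w)} by move: h1 h2; apply: filterS2.
by move: h12 h3 h4; apply: filterS3 => w [].
Qed.

Let cnu : {ae P, forall w, continuous (fun t => nu t w)}.
Proof. by move: cae; apply: filterS => w [? ? ? ?]; exact: cdrift. Qed.
Let cDm : {ae P, forall w, continuous (fun t => Dm t w)}.
Proof. by move: cae; apply: filterS => w [? ? ? ?]; exact: cdrift. Qed.
Let cDn : {ae P, forall w, continuous (fun t => Dn t w)}.
Proof.
move: cae; apply: filterS => w [? ? ? ?].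
by under eq_fun do rewrite DnE; exact: cdrift.
Qed.

Let clampE (t : R) : 0 <= t -> Num.max t 0 = t. Proof. by move=> ?; rewrite max_l. Qed.

Let nu0 : {ae P, forall w, nu 0 w = 0}.
Proof.
have [_ W0 _ _ _] := WX_brownian M.
move: W0 (X_sde M); apply: filterS2 => w W0 /(_ 0 (lexx 0)).
by rewrite W0 addr0 time_integral0 /nu time_integral0 subr0 /Xc maxxx.
Qed.

Let gamE (s : R) : 0 <= s -> gam M s = gam_t p s.
Proof. by move=> s0; rewrite /gam (gammaE hgamma (params_nondegenerate p) s0). Qed.

Let dgamE (s : R) : 0 <= s -> dgam M s = dgam_t p s.
Proof. by move=> s0; rewrite /dgam (derive_gammaE hgamma (params_nondegenerate p) s0). Qed.

Let innovationE (t : R) w : 0 <= t -> innovation t w = nu t w.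
Proof.
move=> t0; rewrite /innovation /nu /Xc clampE//; congr (_ - _).
by apply: eq_time_integral => s /andP[s0 _]; rewrite /mc clampE.
Qed.

Let m_ae : {ae P, forall w, forall t, 0 <= t ->
  Dm t w = wiener (gain_m p) (gain_m' p) (fun s => nu s w) t}.
Proof.
apply: (ae_ito_wiener (@continuous_gain_m' R p) (@is_derive_gain_m R p) _
  mnu cnu nu0 innovationE mDm cDm _ (m_sde M)) => [t t0|t w t0].
- by rewrite gamE.
- rewrite /Dm /mc clampE//; congr (_ - _).
  by apply: eq_time_integral => s /andP[s0 _]; rewrite /Xc clampE.
Qed.

Let n_ae : {ae P, forall w, forall t, 0 <= t ->
  Dn t w = wiener (gain_dm p) (gain_dm' p) (fun s => nu s w) t}.
Proof.
apply: (ae_ito_wiener (@continuous_gain_dm' R p) (@is_derive_gain_dm R p) _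
  mnu cnu nu0 innovationE mDn cDn _ (dm_sde M)) => [t t0|t w t0].
- by rewrite gamE// dgamE.
- rewrite /Dn /nc clampE//; congr (_ - _).
  apply: eq_time_integral => s /andP[s0 _]; rewrite /mc clampE// gamE// /gain_m.
  ring.
Qed.

Let regular_path w :=
  [/\ continuous (fun t => Xc t w), continuous (fun t => Yc t w),
      continuous (fun t => mc t w) & continuous (fun t => nc t w)] /\
  [/\ forall t, 0 <= t ->
        Xc t w - time_integral (fun s => a * Xc s w + th * Yc s w) t = WX t w,
      forall t, 0 <= t ->
        Yc t w - time_integral (fun s => b * Xc s w + c * Yc s w) t = WY t w,
      forall t, 0 <= t -> Dm t w = wiener (gain_m p) (gain_m' p) (fun s => nu s w) t
    & forall t, 0 <= t -> Dn t w = wiener (gain_dm p) (gain_dm' p) (fun s => nu s w) t].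

Let all_ae : {ae P, forall w, regular_path w}.
Proof.
have h1 := X_sde M; have h2 := Y_sde M.
have h12 : {ae P, forall w,
  (forall t, 0 <= t -> Xp t w =
    time_integral (fun s => a * Xp s w + th * Yp s w) t + WX t w) /\
  (forall t, 0 <= t -> Yp t w =
    time_integral (fun s => b * Xp s w + c * Yp s w) t + WY t w)}.
  by move: h1 h2; apply: filterS2.
have h34 : {ae P, forall w,
  (forall t, 0 <= t -> Dm t w = wiener (gain_m p) (gain_m' p) (fun s => nu s w) t) /\
  (forall t, 0 <= t -> Dn t w = wiener (gain_dm p) (gain_dm' p) (fun s => nu s w) t)}.
  by move: m_ae n_ae; apply: filterS2.
move: cae h12 h34; apply: filterS3 => w hc [x_eq y_eq] [m_eq n_eq].
split => //; split => // t t0.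
- have e : time_integral (fun s => a * Xc s w + th * Yc s w) t =
      time_integral (fun s => a * Xp s w + th * Yp s w) t.
    by apply: eq_time_integral => s /andP[s0 _]; rewrite /Xc /Yc clampE.
  by rewrite e -[Xc t w]/(Xp (Num.max t 0) w) clampE// x_eq// addrAC subrr add0r.
- have e : time_integral (fun s => b * Xc s w + c * Yc s w) t =
      time_integral (fun s => b * Xp s w + c * Yp s w) t.
    by apply: eq_time_integral => s /andP[s0 _]; rewrite /Xc /Yc clampE.
  by rewrite e -[Yc t w]/(Yp (Num.max t 0) w) clampE// y_eq// addrAC subrr add0r.
Qed.

(* Everything is set to 0 on a null set outside of which all the almost sure
   properties hold. *)
Lemma model_covariance : exists2 S, covariance_system p S &
  forall T : R, 0 <= T ->
    fisher_XY M T = (time_integral (S idx1 idx1) T)%:E /\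
    fisher_X M T = (time_integral (S idx3 idx3) T)%:E.
Proof.
have [N [mN N0 hN]] := all_ae.
have good w : w \notin N -> regular_path w.
  by rewrite notin_setE => nw; apply: contrapT => h; apply: nw; exact: hN.
pose cl (Z : R -> Omega M -> R) (t : R) w : R := \1_(~` N) w * Z t w.
have clE Z t w : w \notin N -> cl Z t w = Z t w.
  by move=> nw; rewrite /cl indicE in_setC nw mul1r.
have cl0 Z t w : w \in N -> cl Z t w = 0.
  by move=> nw; rewrite /cl indicE in_setC nw mul0r.
have mcl Z : jointly_measurable Z -> jointly_measurable (cl Z).
  move=> mZ; have mI : measurable_fun setT (\1_(~` N) : Omega M -> R).
    by apply: measurable_indic; exact: measurableC.
  exact: jointly_measurableM (measurableT_comp mI measurable_snd) mZ.
have aeN : {ae P, forall w, w \notin N}.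
  exists N; split => // w /= /negP; rewrite negbK => wN; exact: set_mem.
pose X := cl Xc; pose Y := cl Yc; pose m := cl mc; pose n := cl nc.
have ccl w : [/\ continuous (fun t => X t w), continuous (fun t => Y t w),
    continuous (fun t => m t w) & continuous (fun t => n t w)].
  rewrite /X /Y /m /n; have [wN|wN] := boolP (w \in N).
    have e Z : (fun t => cl Z t w) = fun=> 0 by apply/funext => t; exact: cl0.
    by rewrite !e; split; exact: cc.
  have e Z : (fun t => cl Z t w) = fun t => Z t w by apply/funext => t; exact: clE.
  by rewrite !e; have [] := good w wN.
have cX w : continuous (fun t => X t w) by have [] := ccl w.
have cY w : continuous (fun t => Y t w) by have [] := ccl w.
have cm w : continuous (fun t => m t w) by have [] := ccl w.
have cn w : continuous (fun t => n t w) by have [] := ccl w.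
pose BX (t : R) w := X t w - time_integral (fun s => a * X s w + th * Y s w) t.
pose BY (t : R) w := Y t w - time_integral (fun s => b * X s w + c * Y s w) t.
have BXE : {ae P, forall w, forall t, 0 <= t -> BX t w = WX t w}.
  move: aeN; apply: filterS => w wN t t0; have [_ [<-//  _ _ _]] := good w wN.
  rewrite /BX /X /Y clE//; congr (_ - _).
  by apply: eq_time_integral => s _; rewrite !clE.
have BYE : {ae P, forall w, forall t, 0 <= t -> BY t w = WY t w}.
  move: aeN; apply: filterS => w wN t t0; have [_ [_ <-//  _ _]] := good w wN.
  rewrite /BY /X /Y clE//; congr (_ - _).
  by apply: eq_time_integral => s _; rewrite !clE.
have mX' := mcl _ mX; have mY' := mcl _ mY; have mm' := mcl _ mm; have mn' := mcl _ mn.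
have mBX : jointly_measurable BX by exact: mdrift.
have mBY : jointly_measurable BY by exact: mdrift.
have cBX w : continuous (fun t => BX t w) by exact: cdrift.
have cBY w : continuous (fun t => BY t w) by exact: cdrift.
have [sBX evBX] := brownian_version (WX_brownian M) mBX cBX BXE.
have [sBY evBY] := brownian_version (WY_brownian M) mBY cBY BYE.
have evXY := independent_brownian_version (WX_brownian M) (WY_brownian M)
  (WX_WY_independent M) mBX mBY BXE BYE.
have ti0 x y U V t w : w \in N -> 0 <= t ->
    time_integral (fun s => x s * cl U s w + y s * cl V s w) t = 0.
  move=> wN t0; rewrite -[RHS](mul0r t) -(time_integral_cst 0 t0).
  by apply: eq_time_integral => s _; rewrite !cl0// !mulr0 addr0.
have wiener0 (H H' V : R -> R) t : 0 <= t -> (forall s, 0 <= s -> V s = 0) ->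
    wiener H H' V t = 0.
  move=> t0 V0; rewrite /wiener V0// mulr0 sub0r; apply/eqP; rewrite oppr_eq0.
  rewrite -[X in _ == X](mul0r t) -(time_integral_cst 0 t0); apply/eqP.
  by apply: eq_time_integral => s /andP[s0 _]; rewrite V0// mulr0.
pose nu' w (t : R) := X t w - time_integral (fun s => th * m s w + a * X s w) t.
have nu'E w : w \notin N -> nu' w = fun t => nu t w.
  move=> wN; apply/funext => t; rewrite /nu' /nu /X clE//; congr (_ - _).
  by apply: eq_time_integral => s _; rewrite /m !clE.
have nu'0 w s : w \in N -> 0 <= s -> nu' w s = 0.
  by move=> wN s0; rewrite /nu' /X cl0// (ti0 (fun=> th) (fun=> a))// subrr.
(* On the null set every process is 0 and both sides vanish; off it the almost sure equation is
   available. The equation thus holds for every w. *)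
have m_eq w t : 0 <= t -> m t w - time_integral (fun s => c * m s w + b * X s w) t =
    wiener (gain_m p) (gain_m' p) (nu' w) t.
  move=> t0; have [wN|wN] := boolP (w \in N).
    rewrite wiener0// => [|s s0]; last exact: nu'0.
    by rewrite /m cl0// (ti0 (fun=> c) (fun=> b))// subrr.
  rewrite nu'E//; have [_ [_ _ <-// _]] := good w wN.
  rewrite /m /X clE//; congr (_ - _).
  by apply: eq_time_integral => s _; rewrite !clE.
have n_eq w t : 0 <= t -> n t w - time_integral (fun s =>
      (c - th * gain_m p s) * n s w - gain_m p s * m s w) t =
    wiener (gain_dm p) (gain_dm' p) (nu' w) t.
  move=> t0; have [wN|wN] := boolP (w \in N).
    rewrite wiener0// => [|s s0]; last exact: nu'0.
    rewrite /n /m cl0// sub0r; apply/eqP; rewrite oppr_eq0; apply/eqP.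
    rewrite -[RHS](ti0 (fun s => c - th * gain_m p s) (fun s => - gain_m p s) nc mc t w wN t0).
    by apply: eq_time_integral => s _; rewrite mulNr.
  rewrite nu'E//; have [_ [_ _ _ <-//]] := good w wN.
  rewrite /n /m clE//; congr (_ - _).
  by apply: eq_time_integral => s _; rewrite !clE.
pose Z (i : 'I_4) (t : R) w := nth 0 [:: X t w; Y t w; Y t w - m t w; m t w + th * n t w] i.
pose G (i : 'I_4) (t : R) w := sys_noiseY R i * BY t w +
  wiener_process (sys_noiseX p i) (sys_noiseX' p i) BX t w.
have sI i := sqp_wiener_process (@continuous_sys_noiseX' R p i)
  (@is_derive_sys_noiseX R p i) sBX.
have sG i : square_integrable_process P (G i) by exact: (sqpD (sqpZ _ sBY) (sI i)).
have mZ i : jointly_measurable (Z i).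
  case: i => [[|[|[|[|i]]]] hi]; last by exfalso; move: hi.
  - exact: mX'.
  - exact: mY'.
  - exact: measurable_funB mY' mm'.
  - have := mlin (@cc 1) (@cc th) mm' mn'; congr jointly_measurable.
    by apply/funext => t; apply/funext => w; rewrite mul1r.
have cZ i w : continuous (fun t => Z i t w).
  case: i => [[|[|[|[|i]]]] hi]; last by exfalso; move: hi.
  - exact: cX.
  - exact: cY.
  - by apply: continuousD_fun; [exact: cY|exact/continuousN_fun/cm].
  - by apply: continuousD_fun; [exact: cm|exact/continuousZ_fun/cn].
have ZE i t w : 0 <= t -> Z i t w =
    time_integral (fun s => \sum_j sys_drift p i j s * Z j s w) t + G i t w.
  move=> t0; under [X in time_integral X]eq_fun do rewrite sum_idx4.
  have noX : time_integral (fun s => 0 * BX s w) t = 0.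
    by under eq_fun do rewrite mul0r; rewrite time_integral_cst// mul0r.
  case: i => [[|[|[|[|i]]]] hi]; last by exfalso; move: hi.
  - rewrite /G /wiener_process /wiener /sys_noiseY /sys_noiseX /sys_noiseX' /=.
    rewrite mul0r add0r mul1r noX subr0 /BX addrC -[LHS](subrK (time_integral (fun s => a * X s w + th * Y s w) t)).
    congr (_ + _); apply: eq_time_integral => s _.
    by rewrite /sys_drift /Z /=; ring.
  - rewrite /G /wiener_process /wiener /sys_noiseY /sys_noiseX /sys_noiseX' /=.
    rewrite mul0r add0r mul1r noX subr0 /BY addrC -[LHS](subrK (time_integral (fun s => b * X s w + c * Y s w) t)).
    congr (_ + _); apply: eq_time_integral => s _.
    by rewrite /sys_drift /Z /=; ring.
  - have := @filter_error_path R a b c th _ _ _ _ _ (cX w) (cY w) (cm w)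
      (@continuous_gain_m' R p) (@is_derive_gain_m R p) (m_eq w) t t0.
    rewrite /= => e; rewrite [LHS]e /G /wiener_process /wiener /sys_noiseY /sys_noiseX /sys_noiseX' /=.
    have cgB := continuousM_fun (@continuous_gain_m' R p) (cBX w).
    rewrite (_ : time_integral (fun s => - gain_m' p s * BX s w) t =
      - time_integral (fun s => gain_m' p s * BX s w) t); last first.
      rewrite -mulN1r -(time_integralZ _ _ (cont_integrable_from0 cgB)).
      by apply: eq_time_integral => s _; ring.
    rewrite -addrA; congr (_ + _); last by rewrite /BX /BY; ring.
    by apply: eq_time_integral => s _; rewrite /sys_drift /Z /=; ring.
  - have := @filter_score_path R a b c th _ _ _ _ _ _ _ _ (cX w) (cY w) (cm w) (cn w)
      (@continuous_gain_m' R p) (@continuous_gain_dm' R p) (@is_derive_gain_m R p)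
      (@is_derive_gain_dm R p) (m_eq w) (n_eq w) t t0.
    rewrite /= => e; rewrite [LHS]e /G /wiener_process /sys_noiseY /= mul0r add0r.
    congr (_ + _).
    by apply: eq_time_integral => s _; rewrite /sys_drift /Z /= /gain; ring.
have GE i j (s t : R) : 0 <= s -> s <= t ->
    ev P (fun w => G i s w * G j t w) = time_integral (sys_noise_cov p i j) s.
  move=> s0 st; have t0 := le_trans s0 st.
  (* Independence of the two Brownian motions is used here, in the form of vanishing covariances. *)
  have cross k u v : 0 <= u -> 0 <= v ->
      ev P (fun w => wiener_process (sys_noiseX p k) (sys_noiseX' p k) BX u w * BY v w) = 0.
    move=> u0 v0; rewrite (ev_wiener_processM (@continuous_sys_noiseX' R p k)
      (@is_derive_sys_noiseX R p k) sBX (sqp_section sBY v0) u0).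
    by apply: wiener0 => // x x0; exact: evXY.
  have sBs := sqp_section sBY s0; have sBt := sqp_section sBY t0.
  have sIs := sqp_section (sI i) s0; have sIt := sqp_section (sI j) t0.
  have i1 := integrable_rvZ (sys_noiseY R i * sys_noiseY R j) (square_integrableM sBs sBt).
  have i2 := integrable_rvZ (sys_noiseY R i) (square_integrableM sIt sBs).
  have i3 := integrable_rvZ (sys_noiseY R j) (square_integrableM sIs sBt).
  have i4 := square_integrableM sIs sIt.
  transitivity (ev P (fun w => sys_noiseY R i * sys_noiseY R j * (BY s w * BY t w) +
    sys_noiseY R i * (wiener_process (sys_noiseX p j) (sys_noiseX' p j) BX t w * BY s w) +
    sys_noiseY R j * (wiener_process (sys_noiseX p i) (sys_noiseX' p i) BX s w * BY t w) +
    wiener_process (sys_noiseX p i) (sys_noiseX' p i) BX s w *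
    wiener_process (sys_noiseX p j) (sys_noiseX' p j) BX t w)).
    by congr ev; apply/funext => w; rewrite /G; ring.
  have i12 := integrable_rvD i1 i2; have i123 := integrable_rvD i12 i3.
  rewrite (evD i123 i4) (evD i12 i3) (evD i1 i2).
  rewrite (evZ _ (square_integrableM sBs sBt)) (evZ _ (square_integrableM sIt sBs)).
  rewrite (evZ _ (square_integrableM sIs sBt)) !cross// evBY// !mulr0 !addr0.
  rewrite (wiener_isometry sBX evBX (@continuous_sys_noiseX' R p i)
    (@is_derive_sys_noiseX R p i) (@continuous_sys_noiseX' R p j)
    (@is_derive_sys_noiseX R p j) s0 st).
  have cN k : continuous (sys_noiseX p k) := continuous_integrand (@is_derive_sys_noiseX R p k).
  have lN := cont_integrable_from0 (continuousM_fun (cN i) (cN j)).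
  have l1 := cont_integrable_from0 (@cc (sys_noiseY R i * sys_noiseY R j)).
  by rewrite -(time_integral_cst _ s0) -(time_integralD _ l1 lN).
have sZ i : square_integrable_process P (Z i).
  exact: (sqp_linear_system (@continuous_sys_drift R p) mZ cZ sG ZE).
exists (fun i j t => ev P (fun w => Z i t w * Z j t w)).
  split.
  - by move=> i j t; congr ev; apply/funext => w; rewrite mulrC.
  - move=> i j x y t t0.
    have sZi := sqp_section (sZ i) t0; have sZj := sqp_section (sZ j) t0.
    have i1 := square_integrableM sZi sZi; have i2 := square_integrableM sZi sZj.
    have i3 := square_integrableM sZj sZj.
    rewrite -(evZ (x ^+ 2) i1) -(evZ (2 * (x * y)) i2) -(evZ (y ^+ 2) i3).
    have i12 := integrable_rvD (integrable_rvZ (x ^+ 2) i1) (integrable_rvZ (2 * (x * y)) i2).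
    rewrite -(evD (integrable_rvZ (x ^+ 2) i1) (integrable_rvZ (2 * (x * y)) i2)).
    rewrite -(evD i12 (integrable_rvZ (y ^+ 2) i3)).
    by apply: ev_ge0 => w; have := sqr_ge0 (x * Z i t w + y * Z j t w); lra.
  - by move=> i j; exact: covariance_integrable_from0.
  - move=> i j t t0.
    apply: (linear_system_covariance (@continuous_sys_drift R p) mZ cZ sG ZE) => //.
    by move=> k l; exact/cont_integrable_from0/continuous_sys_noise_cov.
(* The Fisher informations refer to the original processes: pass to the clamped ones, equal at
   nonnegative times, then to [Z], equal almost surely, and apply Fubini. *)
have fisherE (U Uc : R -> Omega M -> R) i T : jointly_measurable Uc ->
    (forall t w, 0 <= t -> U t w = Uc t w) ->
    (forall t w, 0 <= t -> w \notin N -> Uc t w = Z i t w) -> 0 <= T ->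
    ('E_P[fun w => (time_integral (fun t => U t w ^+ 2) T)%R] =
     (time_integral (fun t => ev P (fun w => Z i t w * Z i t w)) T)%:E)%E.
  move=> mU UUc UZ T0; rewrite unlock.
  have mUc2 : jointly_measurable (fun t w => Uc t w ^+ 2) by exact: measurable_funX mU.
  have mZ2 : jointly_measurable (fun t w => Z i t w ^+ 2) by exact: measurable_funX (mZ i).
  have mIU := jointly_measurable_section T (jointly_measurable_time_integral mUc2).
  have mIZ := jointly_measurable_section T (jointly_measurable_time_integral mZ2).
  transitivity (\int[P]_w (time_integral (fun t => Uc t w ^+ 2) T)%:E)%E.
    apply: eq_integral => w _; congr (_%:E).
    by apply: eq_time_integral => s /andP[s0 _]; rewrite UUc.
  transitivity (\int[P]_w (time_integral (fun t => Z i t w ^+ 2) T)%:E)%E.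
    apply: ae_eq_integral => //.
    - exact/measurable_EFinP.
    - exact/measurable_EFinP.
    move: aeN; apply: filterS => w wN _; congr (_%:E).
    by apply: eq_time_integral => s /andP[s0 _]; rewrite UZ.
  have [_ _ bZ] := sZ i; have [C C0 hC] := bZ T.
  have [||||iI eI] := @ev_time_integral _ _ _ P (fun s w => Z i s w ^+ 2) T.
  - exact: mZ2.
  - by move=> w; exact: continuousX_fun.
  - exists C => s sT; have [[_ iZs] ZC] := hC s sT.
    by split => //; under eq_fun do rewrite ger0_norm ?sqr_ge0//.
  - exact: T0.
  by rewrite -[RHS]/((time_integral (fun t => ev P (fun w => Z i t w ^+ 2)) T)%:E) -eI
    /ev /Rintegral fineK// integrable_fin_num.
move=> T T0; split.
- by apply: (fisherE _ Yc idx1) => // t w t0 => [|wN]; [rewrite /Yc clampE|rewrite /Z /= /Y clE].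
- apply: (fisherE _ (fun t w => mc t w + th * nc t w) idx3) => // [|t w t0|t w t0 wN].
  + have := mlin (@cc 1) (@cc th) mm mn; congr jointly_measurable.
    by apply/funext => t; apply/funext => w; rewrite mul1r.
  + by rewrite /mc /nc clampE.
  + by rewrite /Z /= /m /n !clE.
Qed.

End ModelProcesses.

(** * Long-time averages *)

Section LongTime.
Context (R : realType).
Implicit Types (f g F : R -> R) (s t T : R).

Lemma integrable_from0M f g : continuous f -> integrable_from0 g ->
  integrable_from0 (fun s => f s * g s).
Proof.
move=> cf ig t; have [C C0 fC] := continuous_locally_bounded cf t.
have bf : [bounded f x | x in (`[0, t]%classic : set R)].
  exists C; split; first by rewrite num_real.
  move=> M CM s /=; rewrite in_itv/= => st.
  by rewrite (le_trans (fC s st)) ?ltW.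
suff -> : EFin \o (fun s => f s * g s) = ((EFin \o f) \* (EFin \o g))%E.
  apply: integrableMr; [by []| |exact: bf|exact: ig].
  by apply: measurable_funTS; exact: continuous_measurable.
by apply/funext => s; rewrite /= EFinM.
Qed.

Lemma is_derive_shift F f T : (forall s : R, 0 < s -> is_derive s 1 F (f s)) ->
  0 <= T -> forall s : R, 0 < s -> is_derive s 1 (fun s => F (T + s)) (f (T + s)).
Proof.
move=> dF T0 s s0; have Ts : 0 < T + s by rewrite ltr_wpDl.
have dFs := dF _ Ts.
have dsh : is_derive s 1 (fun s : R => T + s) (1 : R).
  have := @is_deriveD R R R (cst T) id s 1 0 1 (is_derive_cst T s 1) (is_derive_id s 1).
  by rewrite add0r.
have := @is_derive1_comp R F (fun s : R => T + s) s (f (T + s)) 1 dFs dsh.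
by rewrite mulr1.
Qed.

Lemma continuous_shift F T : continuous F -> continuous (fun s => F (T + s)).
Proof.
move=> cF s; apply: (@continuous_comp _ _ _ (fun s => T + s) F); last exact: cF.
by apply: continuousD_fun; [exact: continuous_cst_fun|exact: continuous_id_fun].
Qed.

(** After time T the function decreases wherever it exceeds C / lam, so it cannot cross upwards the
    larger of that level and its bound on [0, T]. *)
Lemma derive_dissipative_bounded F f (lam C T : R) : continuous F ->
  (forall s : R, 0 < s -> is_derive s 1 F (f s)) -> 0 < lam -> 0 <= T ->
  (forall s, T <= s -> f s <= C - lam * F s) ->
  exists B : R, forall t, 0 <= t -> F t <= B.
Proof.
move=> cF dF lam0 T0 fF.
have [B0 B00 FB0] := continuous_locally_bounded cF T.
pose B : R := Num.max B0 (C / lam).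
have B0B : B0 <= B by rewrite le_max lexx.
have CB : C <= lam * B.
  by rewrite mulrC -ler_pdivrMr// le_max lexx orbT.
exists B => t t0; have [tT|/ltW Tt] := leP t T.
  by apply: le_trans B0B; apply: le_trans (FB0 t _); rewrite ?ler_norm// t0.
rewrite -subr_le0.
have tT0 : 0 <= t - T by rewrite subr_ge0.
have -> : F t - B = (fun s => F (T + s) - B) (t - T) by rewrite /= [T + _]addrC subrK.
apply: (@derive_le_linear R (fun s => F (T + s) - B) (fun s => f (T + s)) (- lam)) => //.
- apply: continuous_subspaceT.
  exact: (continuousD_fun (@continuous_shift F T cF) (@continuous_cst_fun R (- B))).
- move=> s s0; have d := is_derive_shift dF T0 s0.
  by apply: is_derive_eq; rewrite subr0.
- move=> s /andP[s0 _].
  have := fF (T + s); rewrite lerDl (ltW s0) => /(_ isT).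
  by rewrite mulrBr mulNr mulNr; lra.
- by rewrite addr0 subr_le0 (le_trans _ B0B)// (le_trans (ler_norm _))// FB0// lexx T0.
Qed.

Lemma planar_linear_ode0 f g (k11 k12 k21 k22 : R -> R) :
  continuous f -> continuous g -> continuous k11 -> continuous k12 ->
  continuous k21 -> continuous k22 ->
  (forall s : R, 0 < s -> is_derive s 1 f (k11 s * f s + k12 s * g s)) ->
  (forall s : R, 0 < s -> is_derive s 1 g (k21 s * f s + k22 s * g s)) ->
  f 0 = 0 -> g 0 = 0 -> forall t, 0 <= t -> f t = 0 /\ g t = 0.
Proof.
move=> cf cg c11 c12 c21 c22 df dg f0 g0 T T0.
have [C1 C10 h1] := continuous_locally_bounded c11 T.
have [C2 C20 h2] := continuous_locally_bounded c12 T.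
have [C3 C30 h3] := continuous_locally_bounded c21 T.
have [C4 C40 h4] := continuous_locally_bounded c22 T.
pose C := C1 + C2 + C3 + C4.
have : f T ^+ 2 + g T ^+ 2 <= 0.
  apply: (@derive_le_linear R (fun s => f s ^+ 2 + g s ^+ 2)
    (fun s => 2 * (f s * (k11 s * f s + k12 s * g s)) +
              2 * (g s * (k21 s * f s + k22 s * g s))) (4 * C)) => //.
  - by apply: continuous_subspaceT; apply: continuousD_fun; exact: continuousX_fun.
  - move=> s s0; have dfs := df s s0; have dgs := dg s s0.
    by apply: is_derive_eq; rewrite /GRing.scale/= ?expr1; ring.
  - move=> s /andP[s0 sT]; have sT' : 0 <= s <= T by rewrite ltW.
    move: (h1 s sT') (h2 s sT') (h3 s sT') (h4 s sT').
    rewrite !ler_norml => /andP[? ?] /andP[? ?] /andP[? ?] /andP[? ?].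
    have sq (x y : R) : 0 <= x -> 0 <= x * y ^+ 2 by move=> x0; rewrite mulr_ge0 ?sqr_ge0.
    have p1 : 0 <= (C - k11 s) * f s ^+ 2 by apply: sq; rewrite /C; lra.
    (* Adding the two inequalities for a coefficient gives 2 k12 f g <= C (f^2 + g^2). The two mixed
       terms and the two diagonal ones add up to the constant 4 C. *)
    have p2 : 0 <= (C - k12 s) * (f s + g s) ^+ 2 by apply: sq; rewrite /C; lra.
    have p2' : 0 <= (C + k12 s) * (f s - g s) ^+ 2 by apply: sq; rewrite /C; lra.
    have p3 : 0 <= (C - k21 s) * (f s + g s) ^+ 2 by apply: sq; rewrite /C; lra.
    have p3' : 0 <= (C + k21 s) * (f s - g s) ^+ 2 by apply: sq; rewrite /C; lra.
    have p4 : 0 <= (C - k22 s) * g s ^+ 2 by apply: sq; rewrite /C; lra.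
    by lra.
  - by rewrite f0 g0 expr0n addr0.
move=> le0; have f2 := sqr_ge0 (f T); have g2 := sqr_ge0 (g T).
by split; apply/eqP; rewrite -sqrf_eq0 eq_le; apply/andP; split; lra.
Qed.

(** Cesaro: after T1 the deviation is at most e / 2, and the fixed contribution K of [0, T1] is
    below e T / 2 once T > 2 K / e. *)
Lemma cvg_time_average g (L : R) : continuous g -> g t @[t --> +oo] --> L ->
  T^-1 * time_integral g T @[T --> +oo] --> L.
Proof.
move=> cg gL; apply/cvgrPdist_le => e e0.
have e20 : 0 < e / 2 by rewrite divr_gt0.
have [T0 [_ hT0]] := (cvgrPdist_le _ _).1 gL _ e20.
pose T1 : R := Num.max (T0 + 1) 0.
have T10 : 0 <= T1 by rewrite le_max lexx orbT.
have T01 : T0 < T1 by rewrite lt_max ltrDl ltr01.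
have ch : continuous (fun s => `|g s - L|).
  by apply/continuous_norm_fun/continuousD_fun => //; exact: continuous_cst_fun.
have cI := continuous_time_integral (cont_integrable_from0 ch).
pose h (s : R) : R := `|g s - L|.
have bound T : T1 <= T ->
    time_integral h T <= time_integral h T1 + e / 2 * (T - T1).
  move=> T1T.
  have := @nonincreasing_of_derive R
    (fun s => time_integral h (T1 + s) - e / 2 * s) (fun s => h (T1 + s) - e / 2) (T - T1).
  rewrite [T1 + (T - T1)]addrC subrK addr0 mulr0 subr0 => hn.
  rewrite -lerBlDr; apply: hn.
  - apply: continuous_subspaceT.
    exact: (continuousD_fun (@continuous_shift _ T1 cI)
      (continuousN_fun (@continuousZ_fun R (e / 2) _ (@continuous_id_fun R)))).
  - move=> s s0.
    have d := is_derive_shift (fun s => is_derive_time_integral ch) T10 s0.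
    have d2 : is_derive s 1 (fun s : R => e / 2 * s) (e / 2).
      by apply: is_derive_eq; rewrite /GRing.scale/= mulr1.
    exact: is_deriveB.
  - move=> s /andP[s0 _]; rewrite subr_le0 /h distrC; apply: hT0.
    by rewrite (lt_trans T01)// ltrDl.
  - by rewrite subr_ge0.
pose K := time_integral h T1.
have K0 : 0 <= K by apply: time_integral_ge0 => s _; exact: normr_ge0.
exists (Num.max T1 (2 * K / e)); split; first by rewrite num_real.
move=> T; rewrite gt_max => /andP[T1T KT].
have T_gt0 : 0 < T by apply: le_lt_trans T1T.
have -> : L - T^-1 * time_integral g T = - (T^-1 * time_integral (fun s => g s - L) T).
  rewrite time_integralB; [|exact: cont_integrable_from0|]; last first.
    exact/cont_integrable_from0/continuous_cst_fun.
  by rewrite time_integral_cst ?ltW//; field; rewrite gt_eqF.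
rewrite normrN normrM gtr0_norm ?invr_gt0// mulrC ler_pdivrMr//.
have lh : integrable_from0 (fun s => g s - L).
  by apply/cont_integrable_from0/continuousD_fun => //; exact: continuous_cst_fun.
apply: le_trans (ler_norm_time_integral T lh) _.
apply: le_trans (bound T (ltW T1T)) _.
have h1 : 2 * K < T * e by rewrite -ltr_pdivrMr.
have h2 : 0 <= e / 2 * T1 by rewrite mulr_ge0// ltW.
by rewrite -/K; lra.
Qed.

(* Along a bounded solution of Phi' + lam * f = C + o(1), the time average of
   Phi' vanishes. *)
Lemma cvg_time_average_dissipation F (phi f : R -> R) (lam C B : R) :
  continuous F -> continuous phi -> continuous f ->
  (forall s : R, 0 < s -> is_derive s 1 F (phi s)) ->
  (forall t, 0 <= t -> `|F t| <= B) -> lam != 0 ->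
  phi t + lam * f t @[t --> +oo] --> C ->
  T^-1 * time_integral f T @[T --> +oo] --> C / lam.
Proof.
move=> cF cphi cf dF FB lam0 hC.
have clf : continuous (fun t => lam * f t).
  exact: continuousZ_fun.
have csum : continuous (fun t => phi t + lam * f t) by exact: continuousD_fun.
have avg := cvg_time_average csum hC.
have FT : T^-1 * (F T - F 0) @[T --> +oo] --> (0 : R).
  apply/cvgr0Pnorm_le => e e0.
  have B0 : 0 <= B := le_trans (normr_ge0 _) (FB 0 (lexx 0)).
  exists (2 * B / e); split; first by rewrite num_real.
  move=> T /= hT.
  have T0 : 0 < T by apply: le_lt_trans hT; rewrite divr_ge0 ?mulr_ge0// ltW.
  rewrite normrM gtr0_norm ?invr_gt0// mulrC ler_pdivrMr//.
  have := FB T (ltW T0); have := FB 0 (lexx 0).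
  move: hT; rewrite ltr_pdivrMr// => hT h1 h2.
  by apply: le_trans (ler_normB _ _) _; lra.
have key : lam^-1 * (T^-1 * time_integral (fun t => phi t + lam * f t) T -
    T^-1 * (F T - F 0)) @[T --> +oo] --> lam^-1 * (C - 0).
  by apply: cvgM; [exact: cvg_cst|exact: cvgB].
rewrite subr0 in key; rewrite mulrC; apply: cvg_trans key.
apply: near_eq_cvg; near=> T.
have T0 : 0 < T by near: T; exact: nbhs_pinfty_gt.
rewrite time_integralD; [|exact: cont_integrable_from0..].
rewrite (time_integralZ _ _ (cont_integrable_from0 cf)).
rewrite (time_integral_FTC cF cphi dF (ltW T0)).
by field; rewrite lam0 gt_eqF.
Unshelve. all: by end_near. Qed.

End LongTime.


(** * Fisher information rates *)

Section CovarianceOde.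
Context (R : realType) (p : params R).
Implicit Types (s t x y : R) (i j : 'I_4).
Local Notation a := (pa p).
Local Notation b := (pb p).
Local Notation c := (pc p).
Local Notation th := (pth p).

Definition covariance_rhs (S : 'I_4 -> 'I_4 -> R -> R) i j s :=
  \sum_k sys_drift p i k s * S k j s + \sum_k sys_drift p j k s * S i k s +
  sys_noise_cov p i j s.

Definition covariance_ode (S : 'I_4 -> 'I_4 -> R -> R) :=
  [/\ forall i j, continuous (S i j),
      forall i j, S i j 0 = 0,
      forall i j (s : R), 0 < s -> is_derive s 1 (S i j) (covariance_rhs S i j s),
      forall i j t, S i j t = S j i t
    & forall i j (x y t : R), 0 <= t ->
        0 <= x ^+ 2 * S i i t + 2 * (x * y) * S i j t + y ^+ 2 * S j j t].

Local Ltac expand_rhs := rewrite /covariance_rhs !sum_idx4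
  /sys_drift /sys_noise_cov /sys_noiseX /sys_noiseY /=.

(** Regularity is bootstrapped: the covariances are only known to be integrable, but they equal time
    integrals, hence are continuous, hence those integrals are differentiable. Redefining them as
    integrals also fixes their values at negative times. *)
Lemma covariance_system_ode S : covariance_system p S ->
  exists2 S', covariance_ode S' & forall i j t, 0 <= t -> S' i j t = S i j t.
Proof.
move=> [sym psd lS SE].
pose S' i j := time_integral (covariance_rhs S i j).
have irhs i j : integrable_from0 (covariance_rhs S i j).
  have l1 k : integrable_from0 (fun s => sys_drift p i k s * S k j s).
    by apply: integrable_from0M => //; exact: continuous_sys_drift.
  have l2 k : integrable_from0 (fun s => sys_drift p j k s * S i k s).
    by apply: integrable_from0M => //; exact: continuous_sys_drift.
  apply: integrable_from0D; last exact/cont_integrable_from0/continuous_sys_noise_cov.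
  by apply: integrable_from0D; apply: integrable_from0_sum.
have S'E i j t : 0 <= t -> S' i j t = S i j t by move=> t0; rewrite SE.
have cS i j : continuous (S' i j) by exact: continuous_time_integral.
have crhs i j : continuous (covariance_rhs S' i j).
  apply: continuousD_fun; last exact: continuous_sys_noise_cov.
  by apply: continuousD_fun; apply: continuous_sum_fun => k; apply: continuousM_fun => //;
    exact: continuous_sys_drift.
have S'I i j : S' i j = time_integral (covariance_rhs S' i j).
  apply/funext => t; apply: eq_time_integral => s /andP[s0 _]; rewrite /covariance_rhs.
  by congr (_ + _ + _); apply: eq_bigr => k _; rewrite S'E.
exists S' => //; split => //.
- by move=> i j; exact: time_integral0.
- by move=> i j s s0; rewrite S'I; exact: is_derive_time_integral.
- move=> i j t; have [t0|t0] := leP 0 t; first by rewrite !S'E.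
  by rewrite /S' !time_integral_le0// ltW.
- by move=> i j x y t t0; rewrite !S'E//; exact: psd.
Qed.

Variable S : 'I_4 -> 'I_4 -> R -> R.
Hypothesis odeS : covariance_ode S.

Let cS i j : continuous (S i j). Proof. by case: odeS. Qed.
Let S0 i j : S i j 0 = 0. Proof. by case: odeS. Qed.
Let dS i j (s : R) : 0 < s -> is_derive s 1 (S i j) (covariance_rhs S i j s).
Proof. by case: odeS => _ _ + _ _ => /[apply]. Qed.
Let symS i j t : S i j t = S j i t. Proof. by case: odeS. Qed.

Lemma covariance_psd i j (x y t : R) : 0 <= t ->
  0 <= x ^+ 2 * S i i t + 2 * (x * y) * S i j t + y ^+ 2 * S j j t.
Proof. by case: odeS => _ _ _ _; exact. Qed.

Lemma covariance_diag_ge0 i t : 0 <= t -> 0 <= S i i t.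
Proof.
move=> /(covariance_psd i i 1 0).
by rewrite expr1n mul1r !mulr0 mul0r expr0n mul0r !addr0.
Qed.

Definition error_drift t := c - th * gain_m p t.

Lemma continuous_error_drift : continuous error_drift.
Proof.
exact: (continuousD_fun (@continuous_cst_fun R c)
  (continuousN_fun (@continuousZ_fun R th _ (@continuous_gain_m R p)))).
Qed.

(* The filter is exact: the error e = Y - m has variance gamma and is
   uncorrelated with X and with m + theta * dm. *)
Lemma filter_error_covariance t : 0 <= t ->
  [/\ S idx0 idx2 t = 0, S idx1 idx2 t = gam_t p t & S idx2 idx3 t = 0].
Proof.
have ck := continuous_error_drift.
have cz := @continuous_cst_fun R 0.
have cgam := @continuous_gam_t R p.
have csub (f : R -> R) : continuous f -> continuous (fun s => f s - gam_t p s).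
  by move=> cf; apply: continuousD_fun => //; exact: continuousN_fun.
have cadd x (f : R -> R) : continuous f -> continuous (fun s => x + f s).
  by move=> cf; apply: continuousD_fun => //; exact: continuous_cst_fun.
have g0 : gam_t p 0 = 0 by rewrite /gam_t /riccati_sol mulr0 expR0 subrr mul0r.
have k2 := param_kappa_sqr p.
(* By the Riccati equation, Cov(X, e) and Cov(Y, e) - gamma solve a homogeneous planar system with
   zero initial values. *)
have xy := @planar_linear_ode0 R (S idx0 idx2) (fun s => S idx1 idx2 s - gam_t p s)
  (fun s => a + error_drift s) (fun=> th) (fun=> b) (fun s => c + error_drift s)
  (@cS idx0 idx2) (csub _ (@cS idx1 idx2)) (cadd a _ ck) (@continuous_cst_fun R th)
  (@continuous_cst_fun R b) (cadd c _ ck).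
have {}xy t' : 0 <= t' -> S idx0 idx2 t' = 0 /\ S idx1 idx2 t' = gam_t p t'.
  move=> t'0; have [||||x y] := xy _ _ _ _ t' t'0.
  - move=> s s0; apply: (is_derive_eq (dS idx0 idx2 s0)).
    expand_rhs.
    by rewrite /error_drift /gain_m; ring.
  - move=> s s0; have d1 := dS idx1 idx2 s0; have d2 := is_derive_gam_t p s.
    apply: is_derive_eq.
    expand_rhs.
    by rewrite /error_drift /gam_t' k2 /gain_m; ring.
  - exact: S0.
  - by rewrite S0 g0 subrr.
  by split => //; apply/eqP; rewrite -subr_eq0 y.
(* The same for Var e - gamma and Cov(e, q): the noise covariance - gain * th * gamma cancels the
   drift th * gain * Var e exactly when Var e = gamma, and the input b Cov(X, e) is already 0. *)
have zw := @planar_linear_ode0 R (fun s => S idx2 idx2 s - gam_t p s) (S idx2 idx3)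
  (fun s => 2 * error_drift s) (fun=> 0) (fun s => th * gain p s)
  (fun s => 2 * error_drift s) (csub _ (@cS idx2 idx2)) (@cS idx2 idx3)
  (@continuousZ_fun R 2 _ ck) cz (@continuousZ_fun R th _ (@continuous_gain R p))
  (@continuousZ_fun R 2 _ ck).
move=> t0; have [x y] := xy t t0; split => //.
have [||||//] := zw _ _ _ _ t t0.
- move=> s s0; have d1 := dS idx2 idx2 s0; have d2 := is_derive_gam_t p s.
  apply: is_derive_eq.
  expand_rhs.
  by rewrite /error_drift /gam_t' k2 /gain_m; ring.
- move=> s s0; apply: (is_derive_eq (dS idx2 idx3 s0)).
  expand_rhs.
  by rewrite (symS idx2 idx0) (xy s (ltW s0)).1 /error_drift /gain_m; ring.
- by rewrite S0 g0 subrr.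
- exact: S0.
Qed.

Lemma is_derive_covariance (s : R) : 0 < s ->
  [/\ is_derive s 1 (S idx0 idx0) (2 * a * S idx0 idx0 s + 2 * th * S idx0 idx1 s + 1),
      is_derive s 1 (S idx0 idx1)
        ((a + c) * S idx0 idx1 s + b * S idx0 idx0 s + th * S idx1 idx1 s) &
      is_derive s 1 (S idx1 idx1)
        (2 * c * S idx1 idx1 s + 2 * b * S idx0 idx1 s + 1)].
Proof.
move=> s0; split.
- apply: (is_derive_eq (dS idx0 idx0 s0)).
  expand_rhs.
  by rewrite (symS idx1 idx0); ring.
- apply: (is_derive_eq (dS idx0 idx1 s0)).
  expand_rhs.
  by ring.
- apply: (is_derive_eq (dS idx1 idx1 s0)).
  expand_rhs.
  by rewrite (symS idx1 idx0); ring.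
Qed.

(** The error drops out, so the equations close on X, Y and q. Its only trace is th * gain * Cov(Y,
    e) = gain * gain_m. *)
Lemma is_derive_score_covariance (s : R) : 0 < s ->
  [/\ is_derive s 1 (S idx0 idx3) ((a + error_drift s) * S idx0 idx3 s +
        th * S idx1 idx3 s + b * S idx0 idx0 s + gain p s),
      is_derive s 1 (S idx1 idx3) ((c + error_drift s) * S idx1 idx3 s +
        b * S idx0 idx3 s + b * S idx0 idx1 s + gain p s * gain_m p s) &
      is_derive s 1 (S idx3 idx3)
        (2 * error_drift s * S idx3 idx3 s + 2 * b * S idx0 idx3 s + gain p s ^+ 2)].
Proof.
move=> s0; have [x y w] := filter_error_covariance (ltW s0); split.
- apply: (is_derive_eq (dS idx0 idx3 s0)).
  expand_rhs.
  by rewrite x /error_drift; ring.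
- apply: (is_derive_eq (dS idx1 idx3 s0)).
  expand_rhs.
  by rewrite (symS idx1 idx0) y /error_drift /gain_m; ring.
- apply: (is_derive_eq (dS idx3 idx3 s0)).
  expand_rhs.
  by rewrite (symS idx3 idx2) (symS idx3 idx0) w /error_drift; ring.
Qed.

End CovarianceOde.


Lemma bounded_mul_cvg0 (R : realType) (f g : R -> R) (B : R) :
  (forall t, 0 <= t -> `|f t| <= B) -> g t @[t --> +oo] --> 0 ->
  f t * g t @[t --> +oo] --> 0.
Proof.
move=> fB g0; have B0 : 0 <= B := le_trans (normr_ge0 _) (fB 0 (lexx 0)).
have Bg : B * `|g t| @[t --> +oo] --> (0 : R).
  rewrite -[X in _ --> X](mulr0 B) -(@normr0 R R).
  by apply: cvgM; [exact: cvg_cst|exact: cvg_norm].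
apply: (@squeeze_cvgr _ _ _ _ (fun t => - (B * `|g t|)) (fun t => B * `|g t|)).
- near=> t; rewrite -ler_norml normrM ler_wpM2r//; apply: fB.
  by near: t; exact: nbhs_pinfty_ge.
- by rewrite -[X in _ --> X]oppr0; exact: cvgN.
- exact: Bg.
Unshelve. all: by end_near. Qed.

(** * Limits of the time averages *)

Section FisherRates.
Context (R : realType) (p : params R).
Implicit Types (s t x y : R) (i j : 'I_4).
Local Notation a := (pa p).
Local Notation b := (pb p).
Local Notation c := (pc p).
Local Notation th := (pth p).
Local Notation k := (param_kappa p).

Definition param_tau := - (a + c).
Definition param_det := a * c - b * th.

Lemma param_tau_gt0 : 0 < param_tau.
Proof. by rewrite /param_tau oppr_gt0 trace_lt0. Qed.

Lemma param_det_gt0 : 0 < param_det.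
Proof. exact: det_gt0. Qed.

(** The characteristic polynomial of the drift matrix of (X, Y) at k, that is (k - a) (k - c) - b
    th. *)
Definition rate_den := k ^+ 2 + param_tau * k + param_det.

Lemma rate_den_gt0 : 0 < rate_den.
Proof.
have k0 := param_kappa_gt0 p.
rewrite /rate_den addr_gt0 ?param_det_gt0// addr_gt0 ?exprn_gt0//.
by rewrite mulr_gt0// param_tau_gt0.
Qed.

Definition rate_XY := (param_det + a ^+ 2 + b ^+ 2) / (2 * param_tau * param_det).

Definition rate_X := b ^+ 2 / (2 * param_tau * param_det) +
  2 * b * th / (k * rate_den) + th ^+ 2 / (2 * k ^+ 3).

Lemma param_kappa_neq : k - c != 0.
Proof. by rewrite subr_eq0 gt_eqF// param_kappa_gt. Qed.

Lemma cvg_gam_t : gam_t p t @[t --> +oo] --> (k - c)^-1.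
Proof. exact: cvg_riccati_sol (param_kappa_gt0 p) (param_kappa_gt p). Qed.

Lemma cvg_gain_m : gain_m p t @[t --> +oo] --> th / (k - c).
Proof. by apply: cvgM; [exact: cvg_cst|exact: cvg_gam_t]. Qed.

(** As th^2 = (k - c) (k + c), the limit c - th^2 / (k - c) is c - (k + c). *)
Lemma cvg_error_drift : error_drift p t @[t --> +oo] --> - k.
Proof.
have -> : - k = c - th * (th / (k - c)).
  have kc := param_kappa_neq; have k2 := param_kappa_sqr p.
  apply: (mulIf kc); rewrite mulrBl -!mulrA mulVf// mulr1.
  have -> : th * th = k ^+ 2 - c ^+ 2 by rewrite k2; ring.
  by ring.
apply: cvgB; first exact: cvg_cst.
by apply: cvgM; [exact: cvg_cst|exact: cvg_gain_m].
Qed.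

(** [gain] is the th-derivative of th^2 gamma, which tends to k + c, and th / k is the th-derivative
    of k. *)
Lemma cvg_gain : gain p t @[t --> +oo] --> th / k.
Proof.
have k0 : k != 0 by rewrite gt_eqF// param_kappa_gt0.
have -> : th / k = th / (k - c) + th * ((k - c)^-1 + th * (- (k - c) ^- 2 * (th / k))).
  have kc := param_kappa_neq; have k2 := param_kappa_sqr p.
  have th2 : th ^+ 2 = (k - c) * (k + c) by rewrite -[LHS](addKr (c ^+ 2)) -k2; ring.
  rewrite [RHS](_ : _ = th / (k - c) * (2 - th ^+ 2 / (k - c) / k)); last first.
    by field; rewrite k0 kc.
  by rewrite th2; field; rewrite k0 kc.
apply: cvgD; first exact: cvg_gain_m.
apply: cvgM; first exact: cvg_cst.
apply: cvgD; first exact: cvg_gam_t.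
apply: cvgM; first exact: cvg_cst.
apply: cvgM; last exact: cvg_cst.
exact: cvg_riccati_dsol (param_kappa_gt0 p) (param_kappa_gt p).
Qed.

Variable S : 'I_4 -> 'I_4 -> R -> R.
Hypothesis odeS : covariance_ode p S.

Let cS i j : continuous (S i j). Proof. by case: odeS. Qed.
Let continuous_state_form x y z : continuous (fun t =>
  x * S idx0 idx0 t + y * S idx0 idx1 t + z * S idx1 idx1 t).
Proof. by do ![apply: continuousD_fun]; exact: continuousZ_fun. Qed.
Let dS := is_derive_covariance odeS.
Let dSq := is_derive_score_covariance odeS.
Let psd := covariance_psd odeS.

Lemma ler_norm_covariance i j t : 0 <= t -> `|S i j t| <= S i i t + S j j t.
Proof.
move=> t0; have h1 := psd i j 1 1 t0; have h2 := psd i j 1 (-1) t0.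
have := covariance_diag_ge0 odeS i t0; have := covariance_diag_ge0 odeS j t0.
by rewrite ler_norml; move=> *; apply/andP; split; lra.
Qed.

(* Lyapunov function of the (X, Y) system: twice [param_tau * param_det] times
   the solution of A^T P + P A = -1, paired with the covariance. *)
Lemma state_variance_bounded : exists B : R, forall t, 0 <= t ->
  S idx0 idx0 t + S idx1 idx1 t <= B.
Proof.
pose D := param_det; pose N := a ^+ 2 + b ^+ 2 + c ^+ 2 + th ^+ 2.
have D0 : 0 < D by exact: param_det_gt0.
have tau0 := param_tau_gt0.
have N0 : 0 <= N by rewrite !addr_ge0 ?sqr_ge0.
have DN0 : 0 < D + N by rewrite ltr_wpDr.
pose W t := (D + b ^+ 2 + c ^+ 2) * S idx0 idx0 t +
  (- 2 * (c * th + a * b)) * S idx0 idx1 t + (D + a ^+ 2 + th ^+ 2) * S idx1 idx1 t.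
pose lam : R := 2 * param_tau * D / (D + N).
have [||||B WB] := @derive_dissipative_bounded R W
  (fun t => (2 * D + N) - 2 * param_tau * D * (S idx0 idx0 t + S idx1 idx1 t))
  lam (2 * D + N) 0 _ _ _ (lexx 0).
- exact: continuous_state_form.
- move=> s s0; have [d0 d1 d2] := dS s0.
  by apply: is_derive_eq; rewrite /GRing.scale/= /D /N /param_det /param_tau; ring.
- by rewrite divr_gt0// !mulr_gt0.
- move=> s s0; rewrite lerD2l lerN2.
  have -> : lam * W s = 2 * param_tau * D * (W s / (D + N)) by rewrite /lam mulrAC mulrA.
  rewrite ler_pM2l ?mulr_gt0// ler_pdivrMr//.
  (* (D + N) (Var X + Var Y) - W = Var(th X + c Y) + Var(a X + b Y). *)
  have h1 := psd idx0 idx1 th c s0; have h2 := psd idx0 idx1 a b s0.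
  by rewrite /W /N; lra.
exists (B / D) => t t0; rewrite ler_pdivlMr//.
apply: le_trans (WB t t0); rewrite /W.
(* W = D (Var X + Var Y) + Var(c X - th Y) + Var(b X - a Y), so W controls both variances. *)
have h1 := psd idx0 idx1 c (- th) t0; have h2 := psd idx0 idx1 b (- a) t0.
by lra.
Qed.

Lemma score_variance_bounded : exists B : R, forall t, 0 <= t -> S idx3 idx3 t <= B.
Proof.
have k0 := param_kappa_gt0 p.
have [Bs sB] := state_variance_bounded.
have nk : \forall t \near +oo, error_drift p t <= - (3 / 4 * k).
  have : - k < - (3 / 4 * k) by lra.
  by move=> /(cvgr_lt _ cvg_error_drift); apply: filterS => t /ltW.
have hg : \forall t \near +oo, gain p t ^+ 2 <= (th / k) ^+ 2 + 1.
  have cg2 : gain p t ^+ 2 @[t --> +oo] --> (th / k) ^+ 2 by exact: cvgM cvg_gain cvg_gain.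
  have : (th / k) ^+ 2 < (th / k) ^+ 2 + 1 by rewrite ltrDl.
  by move=> /(cvgr_lt _ cg2); apply: filterS => t /ltW.
have [T0 [_ hT]] : \forall t \near +oo, error_drift p t <= - (3 / 4 * k) /\
    gain p t ^+ 2 <= (th / k) ^+ 2 + 1 by apply: filterS2 nk hg.
pose T : R := Num.max (T0 + 1) 0.
have TT0 : T0 < T by rewrite lt_max ltrDl ltr01.
have T_ge0 : 0 <= T by rewrite le_max lexx orbT.
apply: (@derive_dissipative_bounded R (S idx3 idx3) (fun s =>
    2 * error_drift p s * S idx3 idx3 s + 2 * b * S idx0 idx3 s + gain p s ^+ 2)
  (k / 2) (b ^+ 2 * Bs / k + ((th / k) ^+ 2 + 1)) T) => //.
- by move=> s s0; have [] := dSq s0.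
- by rewrite divr_gt0.
- move=> s Ts; have [h1 h2] := hT s (lt_le_trans TT0 Ts).
  have s0 := le_trans T_ge0 Ts.
  have r0 := covariance_diag_ge0 odeS idx3 s0.
  have y0 := covariance_diag_ge0 odeS idx1 s0.
  have q1 : 0 <= (- (3 / 4 * k) - error_drift p s) * S idx3 idx3 s.
    by rewrite mulr_ge0// subr_ge0.
  (* Young's inequality, from Var(b X - k q) >= 0. It spends k of the eventual dissipation rate 3 k
     / 2 and leaves k / 2. *)
  have q2 : 2 * b * S idx0 idx3 s <= b ^+ 2 * Bs / k + k * S idx3 idx3 s.
    rewrite -(ler_pM2r k0) [X in _ <= X]mulrDl divfK ?gt_eqF//.
    have h := psd idx0 idx3 b (- k) s0.
    have : 0 <= b ^+ 2 * (Bs - S idx0 idx0 s).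
      by rewrite mulr_ge0 ?sqr_ge0// subr_ge0 (le_trans _ (sB s s0))// lerDl.
    by lra.
  by lra.
Qed.

Lemma covariance_bounded : exists B : R, forall i j, i != idx2 -> j != idx2 ->
  forall t, 0 <= t -> `|S i j t| <= B.
Proof.
have [B1 h1] := state_variance_bounded; have [B2 h2] := score_variance_bounded.
have B10 : 0 <= B1.
  by apply: le_trans (h1 0 (lexx 0)); rewrite addr_ge0 ?(covariance_diag_ge0 odeS).
have B20 : 0 <= B2.
  by apply: le_trans (h2 0 (lexx 0)); rewrite ?(covariance_diag_ge0 odeS).
have diag i : i != idx2 -> forall t, 0 <= t -> S i i t <= B1 + B2.
  move=> i2 t t0; have := h1 t t0; have := h2 t t0.
  have := covariance_diag_ge0 odeS idx0 t0; have := covariance_diag_ge0 odeS idx1 t0.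
  have : [|| i == idx0, i == idx1 | i == idx3].
    by case: i i2 => [[|[|[|[|i]]]] hi].
  by case/or3P => /eqP -> *; lra.
exists ((B1 + B2) + (B1 + B2)) => i j hi hj t t0.
apply: le_trans (ler_norm_covariance i j t0) _.
by apply: lerD; exact: diag.
Qed.

(** The form D y^2 + (b x - a y)^2 solves the Lyapunov equation of the drift with right-hand side a
    multiple of y^2, so the derivative of its expectation involves only Var Y and a constant. *)
Lemma cvg_average_Y :
  T^-1 * time_integral (S idx1 idx1) T @[T --> +oo] --> rate_XY.
Proof.
have [B SB] := covariance_bounded.
have B0 : 0 <= B := le_trans (normr_ge0 _) (SB idx0 idx0 isT isT 0 (lexx 0)).
have l0 : 2 * param_tau * param_det != 0.
  by rewrite gt_eqF// !mulr_gt0 ?param_tau_gt0 ?param_det_gt0.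
apply: (@cvg_time_average_dissipation R
  (fun t => b ^+ 2 * S idx0 idx0 t + (- 2 * a * b) * S idx0 idx1 t +
    (param_det + a ^+ 2) * S idx1 idx1 t)
  (fun t => param_det + a ^+ 2 + b ^+ 2 +
    (- (2 * param_tau * param_det)) * S idx1 idx1 t) _ _ _
  (`|b ^+ 2| * B + `|- 2 * a * b| * B + `|param_det + a ^+ 2| * B)) => //.
- exact: (continuousD_fun (@continuous_cst_fun R _) (@continuousZ_fun R _ _ (@cS idx1 idx1))).
- move=> s s0; have [d0 d1 d2] := dS s0.
  by apply: is_derive_eq; rewrite /GRing.scale/= /param_det /param_tau; ring.
- move=> t t0; apply: le_trans (ler_normD _ _) _; apply: lerD.
    apply: le_trans (ler_normD _ _) _; apply: lerD; rewrite normrM ler_wpM2l//; exact: SB.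
  by rewrite normrM ler_wpM2l//; exact: SB.
- under eq_fun do rewrite mulNr subrK; exact: cvg_cst.
Qed.

(* The coefficients [al], [be], [q1], [q2], [q3] solve the adjoint equation of
   the limiting system: they make the derivative of the combination below equal
   to [C - 2 k Var q + o(1)]. *)
Lemma cvg_average_score :
  T^-1 * time_integral (S idx3 idx3) T @[T --> +oo] --> rate_X.
Proof.
have [B SB] := covariance_bounded.
have B0 : 0 <= B := le_trans (normr_ge0 _) (SB idx0 idx0 isT isT 0 (lexx 0)).
have k0 := param_kappa_gt0 p; have kc0 := param_kappa_neq.
have tau0 := param_tau_gt0; have D0 := param_det_gt0; have De0 := rate_den_gt0.
pose D := param_det; pose tD : R := 2 * param_tau * D.
have tD0 : tD != 0 by rewrite gt_eqF// !mulr_gt0.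
have tauN0 : - (a + c) != 0 by rewrite gt_eqF.
have acN0 : a + c != 0 by rewrite -oppr_eq0.
have DN0 : a * c - b * th != 0 by rewrite gt_eqF.
(* With A the drift matrix of (X, Y), the row (al, be) solves (al, be) (k I - A) = (2 b, 0), and
   [rate_den] is the determinant. Up to o(1) this cancels the covariances of q with X and Y. *)
pose al : R := 2 * b * (k - c) / rate_den; pose be : R := 2 * b * th / rate_den.
(* A quadratic form in (X, Y) solving a Lyapunov equation: it cancels b (al Var X + be Cov(X, Y)),
   which (al, be) has introduced. *)
pose q1 : R := (D * (al * b) + al * b * c ^+ 2 - be * b * b * c) / tD.
pose q2 : R := (D * (be * b) - 2 * (al * b) * (c * th) + be * b * (a * c + b * th)) / tD.
pose q3 : R := (al * b * th ^+ 2 - be * b * a * th) / tD.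
have eu : al * (k - a) = 2 * b + be * b.
  by rewrite /al /be; move: De0; rewrite /rate_den /param_tau /param_det => De0; field; rewrite gt_eqF.
have ev_ : al * th = be * (k - c) by rewrite /al /be; ring.
have e1 : al * b + 2 * a * q1 + b * q2 = 0.
  move: tD0; rewrite /q1 /q2 /tD /D /param_tau /param_det => tD0; field; rewrite ?tauN0 ?DN0 ?acN0//.
have e2 : be * b + 2 * th * q1 + (a + c) * q2 + 2 * b * q3 = 0.
  by move: tD0; rewrite /q1 /q2 /q3 /tD /D /param_tau /param_det => tD0; field; rewrite ?tauN0 ?DN0 ?acN0//.
have e3 : th * q2 + 2 * c * q3 = 0.
  by move: tD0; rewrite /q2 /q3 /tD /D /param_tau /param_det => tD0; field; rewrite ?tauN0 ?DN0 ?acN0//.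
(* The limit of the noise contributions: the variance of the noise of q, its covariances with X and
   Y weighted by al and be, and the unit noises of X and Y weighted by q1 and q3. *)
pose C : R := (th / k) ^+ 2 + al * (th / k) + be * (th / k * (th / (k - c))) + q1 + q3.
have k2 := param_kappa_sqr p.
have kN0 : k != 0 by rewrite gt_eqF.
have DeN0 : rate_den != 0 by rewrite gt_eqF.
have q13 : q1 + q3 = 2 * k * b ^+ 2 / tD.
  have -> : q1 + q3 = (al * b * (D + k ^+ 2) - be * b * (b * c + a * th)) / tD.
    by rewrite k2 /q1 /q3; ring.
  have -> : al * b * (D + k ^+ 2) - be * b * (b * c + a * th) =
      2 * b ^+ 2 / rate_den * ((k - c) * (D + k ^+ 2) - th * (b * c + a * th)).
    by rewrite /al /be; ring.
  have -> : (k - c) * (D + k ^+ 2) - th * (b * c + a * th) = k * rate_den.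
    rewrite /rate_den /param_tau /D /param_det.
    rewrite [RHS](_ : _ = k * k ^+ 2 + k * (a * c - b * th) - (a + c) * k ^+ 2); last by ring.
    by rewrite k2; ring.
  by congr (_ / _); field.
have alh : al * (th / k) + be * (th / k * (th / (k - c))) = 4 * b * th / rate_den.
  have -> : al * (th / k) + be * (th / k * (th / (k - c))) =
      2 * b * th / rate_den * ((k - c + th ^+ 2 / (k - c)) / k).
    by rewrite /al /be; ring.
  have -> : th ^+ 2 = (k - c) * (k + c) by rewrite -[LHS](addKr (c ^+ 2)) -k2; ring.
  field; rewrite ?kN0 ?kc0 ?DeN0//.
have -> : rate_X = C / (2 * k).
  have -> : C = (th / k) ^+ 2 + (al * (th / k) + be * (th / k * (th / (k - c)))) + (q1 + q3).
    by rewrite /C; ring.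
  rewrite alh q13 /rate_X -/D -/tD.
  field; rewrite ?kN0 ?DeN0 ?tD0//.
(* Time dependence of the drift survives only in the factor error_drift + k, which tends to 0 and
   multiplies bounded covariances. *)
pose phi (t : R) : R := (al * S idx0 idx3 t + be * S idx1 idx3 t + 2 * S idx3 idx3 t) *
  (error_drift p t + k) + (gain p t ^+ 2 + al * gain p t +
  be * (gain p t * gain_m p t) + (q1 + q3)) - 2 * k * S idx3 idx3 t.
have cphi : continuous phi.
  have cg := @continuous_gain R p; have cgm := @continuous_gain_m R p.
  apply: continuousD_fun; last exact/continuousN_fun/continuousZ_fun.
  apply: continuousD_fun.
    apply: continuousM_fun; last first.
      by apply: continuousD_fun; [exact: continuous_error_drift|exact: continuous_cst_fun].
    by do ![apply: continuousD_fun]; exact: continuousZ_fun.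
  apply: continuousD_fun; last exact: continuous_cst_fun.
  apply: continuousD_fun; last by apply: continuousZ_fun; exact: continuousM_fun.
  by apply: continuousD_fun; [exact: continuousX_fun|exact: continuousZ_fun].
apply: (@cvg_time_average_dissipation R
  (fun t => S idx3 idx3 t + al * S idx0 idx3 t + be * S idx1 idx3 t +
    q1 * S idx0 idx0 t + q2 * S idx0 idx1 t + q3 * S idx1 idx1 t) phi _ _ _
  (B + `|al| * B + `|be| * B + `|q1| * B + `|q2| * B + `|q3| * B)) => //.
- by do ![apply: continuousD_fun]; do ?[exact: continuousZ_fun]; exact: cS.
- move=> s s0; have [d0 d1 d2] := dS s0; have [d3 d4 d5] := dSq s0.
  apply: is_derive_eq; rewrite /GRing.scale/= /phi.
  transitivity ((al * S idx0 idx3 s + be * S idx1 idx3 s + 2 * S idx3 idx3 s) *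
    (error_drift p s + k) + (gain p s ^+ 2 + al * gain p s +
    be * (gain p s * gain_m p s) + (q1 + q3)) - 2 * k * S idx3 idx3 s +
    (al * b + 2 * a * q1 + b * q2) * S idx0 idx0 s +
    (be * b + 2 * th * q1 + (a + c) * q2 + 2 * b * q3) * S idx0 idx1 s +
    (th * q2 + 2 * c * q3) * S idx1 idx1 s +
    (2 * b + be * b - al * (k - a)) * S idx0 idx3 s +
    (al * th - be * (k - c)) * S idx1 idx3 s); first by ring.
  by rewrite e1 e2 e3 -eu ev_ !subrr !mul0r !addr0.
- move=> t t0.
  have hB x i j : i != idx2 -> j != idx2 -> `|x * S i j t| <= `|x| * B.
    by move=> hi hj; rewrite normrM ler_wpM2l//; exact: SB.
  by do ![apply: le_trans (ler_normD _ _) _; apply: lerD]; [exact: SB|exact: hB..].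
- by rewrite gt_eqF// mulr_gt0.
- rewrite /phi; under eq_fun do rewrite subrK.
  have -> : C = 0 + ((th / k) ^+ 2 + al * (th / k) + be * (th / k * (th / (k - c))) + (q1 + q3)).
    by rewrite /C; ring.
  apply: cvgD; last first.
    apply: cvgD; last exact: cvg_cst.
    apply: cvgD; last by apply: cvgM; [exact: cvg_cst|exact: cvgM cvg_gain cvg_gain_m].
    by apply: cvgD; [exact: cvgM cvg_gain cvg_gain|apply: cvgM; [exact: cvg_cst|exact: cvg_gain]].
  have ek : error_drift p t + k @[t --> +oo] --> (0 : R).
    by rewrite -(addNr k); apply: cvgD; [exact: cvg_error_drift|exact: cvg_cst].
  apply: (@bounded_mul_cvg0 R _ _ (`|al| * B + `|be| * B + `|2| * B)) => // t t0.
  have hB x i j : i != idx2 -> j != idx2 -> `|x * S i j t| <= `|x| * B.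
    by move=> hi hj; rewrite normrM ler_wpM2l//; exact: SB.
  by do ![apply: le_trans (ler_normD _ _) _; apply: lerD]; exact: hB.
Qed.

End FisherRates.

Ltac nonneg_terms := do ?[exact: sqr_ge0 | exact: normr_ge0 | exact: ler0n |
  exact: ler01 | exact: ltW | done | apply: exprn_ge0 | apply: addr_ge0 |
  apply: divr_ge0 | apply: mulr_ge0].

(** * The ratio of the rates and its four limits *)

Section FisherRatio.
Context (R : realType) (gamma : R -> R -> R -> R).
Hypothesis hgamma : forall c th : R, riccati_solution c th (gamma c th).

Section Model.
Variables (p : params R) (M : model gamma p).

Lemma rate_XY_gt0 : 0 < rate_XY p.
Proof.
rewrite divr_gt0 ?mulr_gt0 ?param_tau_gt0 ?param_det_gt0//.
by rewrite addr_gt0 ?exprn_even_gt0 ?pb_neq0// ltr_wpDr ?sqr_ge0// param_det_gt0.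
Qed.

Lemma cvg_fisher_rates :
  ((T^-1)%:E * fisher_X M T @[T --> +oo%R] --> (rate_X p)%:E)%E /\
  ((T^-1)%:E * fisher_XY M T @[T --> +oo%R] --> (rate_XY p)%:E)%E.
Proof.
have [S0 sysS fisherE] := model_covariance hgamma M.
have [S odeS SE] := covariance_system_ode sysS.
have IE i (T : R) : time_integral (S0 i i) T = time_integral (S i i) T.
  by apply: eq_time_integral => s /andP[s0 _]; rewrite SE.
have aux (F : R -> \bar R) i (L : R) :
    (forall T, 0 <= T -> F T = (time_integral (S0 i i) T)%:E) ->
    T^-1 * time_integral (S i i) T @[T --> +oo%R] --> L ->
    ((T^-1)%:E * F T @[T --> +oo%R] --> L%:E)%E.
  move=> FE cL.
  have cE : (T^-1 * time_integral (S i i) T)%:E @[T --> +oo%R] --> L%:E.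
    by apply: cvg_EFin => //; near=> T.
  apply: cvg_trans cE; apply: near_eq_cvg; near=> T.
  by rewrite FE ?IE ?EFinM//; near: T; exact: nbhs_pinfty_ge.
split.
- by apply: (aux _ idx3) (cvg_average_score odeS) => T T0; have [] := fisherE T T0.
- by apply: (aux _ idx1) (cvg_average_Y odeS) => T T0; have [] := fisherE T T0.
Unshelve. all: by end_near. Qed.

Lemma fisher_rate_XE : fisher_rate_X M = (rate_X p)%:E.
Proof. by apply/cvg_lim; [exact: ereal_hausdorff|case: cvg_fisher_rates]. Qed.

Lemma fisher_rate_XYE : fisher_rate_XY M = (rate_XY p)%:E.
Proof. by apply/cvg_lim; [exact: ereal_hausdorff|case: cvg_fisher_rates]. Qed.

Lemma fisher_rates_existP : fisher_rates_exist M.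
Proof.
have [hX hXY] := cvg_fisher_rates; split.
- by apply/cvg_ex; exists (rate_X p)%:E.
- by apply/cvg_ex; exists (rate_XY p)%:E.
- by rewrite fisher_rate_XE.
- by rewrite fisher_rate_XYE.
- by rewrite fisher_rate_XYE lte_fin rate_XY_gt0.
Qed.

Local Notation a := (pa p).
Local Notation b := (pb p).
Local Notation c := (pc p).
Local Notation th := (pth p).
Local Notation k := (param_kappa p).
Local Notation D := (param_det p).
Local Notation tau := (param_tau p).

(** Both rates are multiplied by 2 tau D. The factor D / [rate_den] is kept apart because it lies
    between 0 and 1. *)
Lemma fisher_ratioE : fisher_ratio M =
  (b ^+ 2 + 4 * tau / k * (b * th) * (D / rate_den p) + tau * (th ^+ 2 / k ^+ 3) * D) /
  (D + a ^+ 2 + b ^+ 2).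
Proof.
rewrite /fisher_ratio fisher_rate_XE fisher_rate_XYE /=.
have k0 := param_kappa_gt0 p; have tau0 := param_tau_gt0 p.
have D0 := param_det_gt0 p; have De0 := rate_den_gt0 p.
have E0 : 0 < D + a ^+ 2 + b ^+ 2.
  by rewrite addr_gt0 ?exprn_even_gt0 ?pb_neq0// ltr_wpDr ?sqr_ge0.
rewrite /rate_X /rate_XY; move: tau0 D0 E0 De0.
move: (param_tau p) (param_det p) (rate_den p) => t d e t0 d0 E0 e0.
by field; rewrite !gt_eqF.
Qed.

End Model.
(** Each limit below is proved with an explicit error K / h; the threshold [B0] allows the bound to
    start only where the determinant is already large, or the domain empty. *)
Lemma cvg_params_to_infty (f h : params R -> R) (Dom : set (params R)) (L K B0 : R) :
  0 <= K -> (forall p, Dom p -> 1 <= h p -> B0 < h p -> `|f p - L| <= K / h p) ->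
  f p @[p --> params_to_infty Dom h] --> L.
Proof.
move=> K0 fL; apply/cvgrPdist_le => e e0.
exists (Num.max (Num.max B0 1) (K / e)) => // p [Dp].
rewrite !gt_max => /andP[/andP[hB h1] hK].
have h0 : 0 < h p := lt_trans ltr01 h1.
rewrite /= distrC; apply: le_trans (fL p Dp (ltW h1) hB) _.
by rewrite ler_pdivrMr// mulrC -ler_pdivrMr// ltW.
Qed.

Section Limits.
Variable M : forall p : params R, model gamma p.

Local Notation D p := (param_det p).
Local Notation tau p := (param_tau p).
Local Notation k p := (param_kappa p).

Let E (p : params R) : R := D p + pa p ^+ 2 + pb p ^+ 2.

Let E_gt0 p : 0 < E p.
Proof.
rewrite /E addr_gt0 ?exprn_even_gt0 ?pb_neq0// ltr_wpDr ?sqr_ge0//.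
exact: param_det_gt0.
Qed.

(** D is affine in b and D <= [rate_den], so numerator and denominator are both b^2 + O(|b|). *)
Lemma fisher_ratio_cvg_b a c th :
  fisher_ratio (M p) @[p --> params_to_infty
    [set p | [/\ pa p = a, pc p = c & pth p = th]] (fun p => `|pb p|)] --> (1 : R).
Proof.
pose ka := kappa c th; pose w := th ^+ 2 / ka ^+ 3; pose ta := - (a + c).
pose K := 4 * `|ta| / ka * `|th| + (`|ta| * w + 1) * (`|a * c| + `|th|) + a ^+ 2.
have ka0 : 0 <= ka by exact: kappa_ge0.
have w0 : 0 <= w by rewrite divr_ge0 ?sqr_ge0// exprn_ge0.
have K0 : 0 <= K.
  rewrite /K; nonneg_terms.
apply: (@cvg_params_to_infty _ _ _ 1 K 0 K0) => p [pa_ pc_ pth_] b1 _.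
have k0 := param_kappa_gt0 p; have tau0 := param_tau_gt0 p.
have D0 := param_det_gt0 p; have De0 := rate_den_gt0 p; have E0 := E_gt0 p.
have kE : k p = ka by rewrite /param_kappa pc_ pth_.
have tE : tau p = ta by rewrite /param_tau pa_ pc_.
have ta0 : 0 < ta by rewrite -tE.
set b := pb p in b1 *; set d := D p in D0 *.
have dE : d = a * c - b * th by rewrite /d /param_det pa_ pc_ pth_.
have q1 : d / rate_den p <= 1.
  by rewrite ler_pdivrMr// mul1r /rate_den lerDr addr_ge0 ?sqr_ge0// mulr_ge0// ltW.
have q0 : 0 <= d / rate_den p by rewrite divr_ge0// ltW.
have dle : d <= (`|a * c| + `|th|) * `|b|.
  rewrite dE; apply: le_trans (ler_norm _) _; apply: le_trans (ler_normB _ _) _.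
  rewrite mulrDl normrM; apply: lerD; last by rewrite normrM mulrC.
  by rewrite ler_peMr.
rewrite fisher_ratioE -/(E p) -/b -/d tE kE pth_ -/w.
have -> : (b ^+ 2 + 4 * ta / ka * (b * th) * (d / rate_den p) + ta * w * d) / E p - 1 =
  (4 * ta / ka * (b * th) * (d / rate_den p) + ta * w * d - d - a ^+ 2) / E p.
  rewrite -[X in _ - X = _](divff (lt0r_neq0 E0)) -mulrBl; congr (_ / _).
  by rewrite /E -/b -/d pa_; ring.
rewrite normrM normfV (gtr0_norm E0) ler_pdivrMr//.
have b0 : 0 < `|b| := lt_le_trans ltr01 b1.
apply: (@le_trans _ _ (K * `|b|)).
  apply: le_trans (ler_normB _ _) _; rewrite (ger0_norm (sqr_ge0 a)).
  have -> : K * `|b| = (4 * `|ta| / ka * `|th| + (`|ta| * w + 1) * (`|a * c| + `|th|)) * `|b| +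
      a ^+ 2 * `|b| by rewrite -mulrDl.
  apply: lerD; last by rewrite ler_peMr// sqr_ge0.
  apply: le_trans (ler_normB _ _) _; rewrite (gtr0_norm D0).
  have x1 : `|4 * ta / ka * (b * th) * (d / rate_den p)| <= 4 * `|ta| / ka * `|th| * `|b|.
    rewrite normrM (ger0_norm q0); apply: le_trans (ler_piMr _ q1) _ => //.
    rewrite !normrM normfV (ger0_norm ka0) (ger0_norm (_ : 0 <= 4))//.
    by rewrite le_eqVlt; apply/orP; left; apply/eqP; ring.
  have x2 : `|ta * w * d| = `|ta| * w * d.
    by rewrite normrM (gtr0_norm D0) normrM (ger0_norm w0).
  apply: le_trans (lerD (ler_normD _ _) (lexx d)) _; rewrite x2.
  have x3 : (`|ta| * w + 1) * d <= (`|ta| * w + 1) * ((`|a * c| + `|th|) * `|b|).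
    by rewrite ler_wpM2l// addr_ge0// mulr_ge0.
  by lra.
rewrite -mulrA ler_wpM2l// ler_pdivlMl//.
have -> : `|b| * `|b| = b ^+ 2 by rewrite -expr2 real_normK ?num_real.
by rewrite /E -/b -/d lerDr addr_ge0 ?sqr_ge0// ltW.
Qed.

Let rate_den_ge (p : params R) : k p ^+ 2 <= rate_den p /\ tau p * k p <= rate_den p.
Proof.
have k0 := param_kappa_gt0 p; have tau0 := param_tau_gt0 p; have D0 := param_det_gt0 p.
have kk : 0 <= k p ^+ 2 by exact: sqr_ge0.
have tk : 0 <= tau p * k p by rewrite mulr_ge0// ltW.
by rewrite /rate_den; split; lra.
Qed.

(** The denominator is bounded below by D alone, which suits the limits in th and c, where D tends
    to infinity. *)
Lemma ler_norm_fisher_ratio (p : params R) : `|fisher_ratio (M p)| <=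
  pb p ^+ 2 / D p + 4 * `|pb p * pth p| * (tau p / (k p * rate_den p)) +
  pth p ^+ 2 * (tau p / k p ^+ 3).
Proof.
have k0 := param_kappa_gt0 p; have tau0 := param_tau_gt0 p.
have D0 := param_det_gt0 p; have De0 := rate_den_gt0 p; have E0 := E_gt0 p.
rewrite fisher_ratioE -/(E p) normrM normfV (gtr0_norm E0) ler_pdivrMr//.
set X := (X in _ <= X * _).
have X0 : 0 <= X.
  by rewrite /X; nonneg_terms.
apply: (@le_trans _ _ (X * D p)); last first.
  by rewrite ler_wpM2l// /E -addrA lerDl addr_ge0 ?sqr_ge0.
have -> : X * D p = pb p ^+ 2 + 4 * tau p / k p * `|pb p * pth p| * (D p / rate_den p) +
    tau p * (pth p ^+ 2 / k p ^+ 3) * D p.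
  rewrite /X; move: D0 k0 De0.
  move: (param_tau p) (param_det p) (rate_den p) => t d e d0 k0 e0.
  by field; rewrite !gt_eqF.
apply: le_trans (ler_normD _ _) _; apply: lerD; last first.
  have w0 : 0 <= pth p ^+ 2 / k p ^+ 3 by rewrite divr_ge0 ?sqr_ge0// exprn_ge0// ltW.
  by rewrite normrM normrM (gtr0_norm D0) (gtr0_norm tau0) (ger0_norm w0).
apply: le_trans (ler_normD _ _) _; apply: lerD; first by rewrite ger0_norm// sqr_ge0.
rewrite normrM [`|_ * (pb p * pth p)|]normrM.
have u0 : 0 < 4 * tau p / k p by rewrite divr_gt0 ?mulr_gt0.
have q0 : 0 < D p / rate_den p by rewrite divr_gt0.
by rewrite (gtr0_norm u0) (gtr0_norm q0).
Qed.

(** D grows like |b th| and k >= |th|, which makes each of the three terms of the general bound O(1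
    / |th|). *)
Lemma fisher_ratio_cvg_th a b c :
  fisher_ratio (M p) @[p --> params_to_infty
    [set p | [/\ pa p = a, pb p = b & pc p = c]] (fun p => `|pth p|)] --> (0 : R).
Proof.
pose ta := - (a + c); pose K := 2 * `|b| + 4 * `|b| * `|ta| + `|ta|.
have K0 : 0 <= K by rewrite /K !addr_ge0 ?mulr_ge0.
apply: (@cvg_params_to_infty _ _ _ 0 K (2 * `|a * c| / `|b|) K0) => p [pa_ pb_ pc_] t1 tB.
have k0 := param_kappa_gt0 p; have tau0 := param_tau_gt0 p.
have D0 := param_det_gt0 p; have De0 := rate_den_gt0 p.
have [De1 De2] := rate_den_ge p.
have b0 : 0 < `|b| by rewrite normr_gt0 -pb_ pb_neq0.
have tE : tau p = `|ta| by rewrite -[LHS]gtr0_norm// /param_tau pa_ pc_.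
rewrite subr0; apply: le_trans (ler_norm_fisher_ratio p) _; rewrite pb_ tE.
move: tB; rewrite ltr_pdivrMr// => tB.
(* Past the threshold, |a c| is at most half of |b th|. *)
have dge : `|b| * `|pth p| <= 2 * D p.
  have := lerB_dist (b * pth p) (a * c); rewrite normrM => h.
  have : `|b * pth p - a * c| = D p.
    by rewrite distrC -[RHS]gtr0_norm// /param_det pa_ pb_ pc_.
  by lra.
have tk : `|pth p| <= k p.
  rewrite -(ler_pXn2r (n := 2)) ?nnegrE ?(ltW k0)//.
  by rewrite real_normK ?num_real// param_kappa_sqr lerDr sqr_ge0.
have t2 : pth p ^+ 2 = `|pth p| ^+ 2 by rewrite real_normK ?num_real.
set t := `|pth p| in t1 tB dge tk t2 *.
have t0 : 0 < t := lt_le_trans ltr01 t1.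
have k1 : 1 <= k p := le_trans t1 tk.
have tt : t ^+ 2 <= k p ^+ 2 by rewrite ler_pXn2r// nnegrE ltW.
have ttt : t ^+ 3 <= k p ^+ 3 by rewrite ler_pXn2r// nnegrE ltW.
have -> : K / t = 2 * `|b| / t + 4 * `|b| * `|ta| / t + `|ta| / t by rewrite /K; ring.
apply: lerD; first apply: lerD.
- rewrite ler_pdivrMr// mulrAC ler_pdivlMr//.
  have -> : b ^+ 2 = `|b| * `|b| by rewrite -expr2 real_normK ?num_real.
  by have := ler_wpM2l (ltW b0) dge; lra.
- rewrite normrM -/t -!mulrA; do 2![rewrite ler_wpM2l//].
  rewrite mulrCA ler_wpM2l// ler_pdivrMr ?mulr_gt0// ler_pdivlMl// -expr2.
  apply: le_trans tt _; apply: le_trans De1 _.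
  by rewrite ler_peMl// ltW.
- by rewrite t2 mulrCA ler_wpM2l// ler_pdivrMr ?exprn_gt0// ler_pdivlMl//.
Qed.

(** For a != 0 the determinant grows like |a c|; for a = 0 it would remain - b th and the limit
    would be b / (b - th). For a > 0 the domain is eventually empty, and the estimate covers this
    case without a split. *)
Lemma fisher_ratio_cvg_c a b th : a != 0 ->
  fisher_ratio (M p) @[p --> params_to_infty
    [set p | [/\ pa p = a, pb p = b & pth p = th]] (fun p => - pc p)] --> (0 : R).
Proof.
move=> a0; pose K := 2 * b ^+ 2 / `|a| + 4 * `|b * th| + th ^+ 2 * (`|a| + 1).
have K0 : 0 <= K.
  rewrite /K; nonneg_terms.
have {}a0 : 0 < `|a| by rewrite normr_gt0.
apply: (@cvg_params_to_infty _ _ _ 0 K (2 * `|b * th| / `|a|) K0) => p [pa_ pb_ pth_] c1 cB.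
have k0 := param_kappa_gt0 p; have tau0 := param_tau_gt0 p.
have D0 := param_det_gt0 p; have De0 := rate_den_gt0 p.
have [De1 De2] := rate_den_ge p.
rewrite subr0; apply: le_trans (ler_norm_fisher_ratio p) _; rewrite pb_ pth_.
set t := - pc p in c1 cB *.
have t0 : 0 < t := lt_le_trans ltr01 c1.
have tn : `|pc p| = t by rewrite -normrN gtr0_norm.
have tk : t <= k p by rewrite -tn ler_norm_param_kappa.
have k1 : 1 <= k p := le_trans c1 tk.
move: cB; rewrite ltr_pdivrMr// => cB.
have dge : `|a| * t <= 2 * D p.
  have := lerB_dist (a * pc p) (b * th); rewrite normrM tn => h.
  have : `|a * pc p - b * th| = D p by rewrite -[RHS]gtr0_norm// /param_det pa_ pb_ pth_.
  by lra.
have kk : t <= k p ^+ 2 by apply: le_trans tk _; rewrite expr2 ler_peMr// ltW.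
have tauk : tau p <= (`|a| + 1) * k p.
  have : tau p = - a + t by rewrite /param_tau pa_ /t; ring.
  move=> ->; rewrite mulrDl mul1r; apply: lerD => //.
  by apply: (le_trans (ler_norm _)); rewrite normrN ler_peMr.
have -> : K / t = 2 * b ^+ 2 / `|a| / t + 4 * `|b * th| / t + th ^+ 2 * (`|a| + 1) / t.
  by rewrite /K; ring.
apply: lerD; first apply: lerD.
- have -> : 2 * b ^+ 2 / `|a| / t = b ^+ 2 * (2 / (`|a| * t)).
    by field; rewrite !gt_eqF.
  rewrite ler_wpM2l ?sqr_ge0// ler_pdivlMr ?mulr_gt0// mulrC ler_pdivrMr//.
- rewrite -[X in _ <= X]mulrA -[X in X <= _]mulrA !ler_wpM2l//.
  rewrite ler_pdivrMr ?mulr_gt0// ler_pdivlMl//.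
  apply: (@le_trans _ _ (k p ^+ 2 * tau p)); first by rewrite ler_wpM2r// ltW.
  by rewrite expr2 -mulrA ler_wpM2l ?(ltW k0)// mulrC.
- rewrite -[X in _ <= X]mulrA ler_wpM2l ?sqr_ge0// ler_pdivrMr ?exprn_gt0// mulrAC ler_pdivlMr//.
  apply: (@le_trans _ _ ((`|a| + 1) * k p * t)); first by rewrite ler_wpM2r// ltW.
  rewrite -[X in X <= _]mulrA ler_wpM2l ?addr_ge0// exprS ler_wpM2l ?(ltW k0)//.
Qed.

Lemma fisher_ratio_cvg_a b c th : c != 0 -> th != 0 ->
  exists2 rho : R, 0 < rho < 1 &
    fisher_ratio (M p) @[p --> params_to_infty
      [set p | [/\ pb p = b, pc p = c & pth p = th]] (fun p => - pa p)] --> rho.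
Proof.
move=> c_neq0 th0; have [c0|c0|c0] := ltgtP c 0; last by rewrite c0 eqxx in c_neq0.
- pose ka := kappa c th; pose w := th ^+ 2 / ka ^+ 3.
  have k0 : 0 < ka by rewrite kappa_gt0// c_neq0.
  have th20 : 0 < th ^+ 2 by rewrite exprn_even_gt0.
  have w0 : 0 < w by rewrite divr_gt0// exprn_gt0.
  (* It is below 1 because th^2 < k^2 and |c| <= k. *)
  exists (w * - c).
    rewrite mulr_gt0 ?oppr_gt0//= /w mulrAC ltr_pdivrMr ?exprn_gt0// mul1r.
    have ck : - c <= ka by rewrite -ltr0_norm// ler_norm_kappa.
    have tk : th ^+ 2 < ka ^+ 2.
      by rewrite kappa_sqr ltrDr exprn_even_gt0.
    apply: (@lt_le_trans _ _ (ka ^+ 2 * - c)).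
      by rewrite ltr_pM2r// oppr_gt0.
    by rewrite [ka ^+ 3]exprSr ler_wpM2l ?sqr_ge0.
  pose q := `|b * th|; pose K := b ^+ 2 + 4 / ka ^+ 2 * q * (`|c| + q) + w * (q + `|c| * b ^+ 2).
  have K0 : 0 <= K.
    rewrite /K; nonneg_terms.
  apply: (@cvg_params_to_infty _ _ _ (w * - c) K 0 K0) => p [pb_ pc_ pth_] a1 _.
  have tau0 := param_tau_gt0 p; have D0 := param_det_gt0 p; have De0 := rate_den_gt0 p.
  have E0 := E_gt0 p; have [De1 De2] := rate_den_ge p.
  have kE : k p = ka by rewrite /param_kappa pc_ pth_.
  rewrite fisher_ratioE -/(E p) kE pb_ pth_ -/w; rewrite kE in De1 De2.
  set t := - pa p in a1 *; have t0 : 0 < t := lt_le_trans ltr01 a1.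
  (* The quadratic terms in a cancel: with E the denominator, tau D + c E = a b th + c b^2. What
     remains is O(|a|), against E >= a^2. *)
  have -> : (b ^+ 2 + 4 * tau p / ka * (b * th) * (D p / rate_den p) + tau p * w * D p) / E p -
      w * - c =
    (b ^+ 2 + 4 * tau p / ka * (b * th) * (D p / rate_den p) +
     w * (- (t * (b * th)) + c * b ^+ 2)) / E p.
    apply: (mulIf (lt0r_neq0 E0)); rewrite mulrBl !divfK ?gt_eqF//.
    move: (D p / rate_den p) => z.
    by rewrite /E /param_tau /param_det /t pb_ pc_ pth_; ring.
  rewrite normrM normfV (gtr0_norm E0) ler_pdivrMr//.
  apply: (@le_trans _ _ (K * t)); last first.
    rewrite -[X in _ <= X]mulrA ler_wpM2l// ler_pdivlMl// -expr2 /E /t sqrrN.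
    by rewrite -addrA addrCA lerDl addr_ge0 ?sqr_ge0// ltW.
  have -> : K * t = b ^+ 2 * t + 4 / ka ^+ 2 * q * ((`|c| + q) * t) +
      w * (q * t + `|c| * b ^+ 2 * t) by rewrite /K; ring.
  apply: le_trans (ler_normD _ _) _; apply: lerD; last first.
    rewrite normrM (gtr0_norm w0) ler_wpM2l ?(ltW w0)//.
    apply: le_trans (ler_normD _ _) _; apply: lerD.
      by rewrite normrN normrM (gtr0_norm t0) mulrC.
    by rewrite normrM (ger0_norm (sqr_ge0 b)) ler_peMr// mulr_ge0 ?sqr_ge0.
  apply: le_trans (ler_normD _ _) _; apply: lerD.
    by rewrite (ger0_norm (sqr_ge0 b)) ler_peMr// sqr_ge0.
  have Dle : D p <= (`|c| + q) * t.
    have -> : D p = - c * t - b * th by rewrite /param_det /t pb_ pc_ pth_; ring.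
    apply: le_trans (ler_norm _) _; apply: le_trans (ler_normB _ _) _.
    by rewrite mulrDl normrM normrN (gtr0_norm t0) lerD// ler_peMr.
  rewrite normrM [`|_ * (b * th)|]normrM -/q.
  have u0 : 0 < 4 * tau p / ka by rewrite divr_gt0 ?mulr_gt0.
  have q0 : 0 < D p / rate_den p by rewrite divr_gt0.
  rewrite (gtr0_norm u0) (gtr0_norm q0).
  (* Here tau grows with |a|, and so does [rate_den]: the bound tau k <= [rate_den] leaves a
     multiple of D, which is O(|a|). *)
  have -> : 4 * tau p / ka * q * (D p / rate_den p) =
      4 / ka ^+ 2 * q * (tau p * ka / rate_den p * D p).
    move: De0; move: (rate_den p) => e e0; by field; rewrite !gt_eqF.
  have v0 : 0 <= 4 / ka ^+ 2 * q by rewrite mulr_ge0 ?normr_ge0// divr_ge0// sqr_ge0.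
  rewrite ler_wpM2l//.
  apply: le_trans Dle; rewrite ler_piMl ?(ltW D0)//.
  by rewrite ler_pdivrMr// mul1r.
(* For c > 0, positivity of a c - b th forces - a < |b th| / c, so no parameters remain beyond this
   threshold and any value in (0, 1) is a limit. *)
exists (2^-1); first by apply/andP; split; lra.
apply: (@cvg_params_to_infty _ _ _ _ 0 (`|b * th| / c)) => // p [pb_ pc_ pth_] _.
rewrite ltr_pdivrMr// => aB; exfalso.
have := param_det_gt0 p; rewrite /param_det pb_ pc_ pth_.
by have := ler_norm (- (b * th)); rewrite normrN; lra.
Qed.

End Limits.
End FisherRatio.

Theorem mainTheorem4 (R : realType) (gamma : R -> R -> R -> R)
    (hgamma : forall c th : R, riccati_solution c th (gamma c th))
    (M : forall p : params R, model gamma p) :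
  (forall p : params R, fisher_rates_exist (M p)) /\
  [/\ (* |b| -> oo *)
      forall a c th : R,
        fisher_ratio (M p) @[p --> params_to_infty
          [set p | [/\ pa p = a, pc p = c & pth p = th]]
          (fun p => `|pb p|)] --> (1 : R),
      (* |theta| -> oo *)
      forall a b c : R,
        fisher_ratio (M p) @[p --> params_to_infty
          [set p | [/\ pa p = a, pb p = b & pc p = c]]
          (fun p => `|pth p|)] --> (0 : R),
      (* c -> -oo *)
      forall a b th : R, a != 0 ->
        fisher_ratio (M p) @[p --> params_to_infty
          [set p | [/\ pa p = a, pb p = b & pth p = th]]
          (fun p => - pc p)] --> (0 : R)
    & (* a -> -oo *)
      forall b c th : R, c != 0 -> th != 0 ->
        exists2 rho : R, 0 < rho < 1 &
          fisher_ratio (M p) @[p --> params_to_infty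
            [set p | [/\ pb p = b, pc p = c & pth p = th]]
            (fun p => - pa p)] --> rho].
Proof.
split; first by move=> p; exact: fisher_rates_existP.
split=> [a c th|a b c|a b th|b c th].
- exact: fisher_ratio_cvg_b.
- exact: fisher_ratio_cvg_th.
- exact: fisher_ratio_cvg_c.
- exact: fisher_ratio_cvg_a.
Qed.
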